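(* Let $n\ge 2$, let $\Sigma$ be a closed, connected, smooth $(n-1)$-manifold, and let $f:\Sigma\to\mathbb{C}P^{n-1}$ be a Lagrangian immersion with respect to the integral symplectic form $\frac1\pi\omega_{FS}$. Let $\pi:S^{2n-1}\to\mathbb{C}P^{n-1}$ be the principal Hopf $S^1$-bundle with connection $1$-form $\frac{i}{\pi}\alpha$, where $\alpha=i_0^*\left(\frac12\sum_{i=1}^n (x_i\,dy_i-y_i\,dx_i)\right)$ and $i_0:S^{2n-1}\to\mathbb{C}^n$ is the inclusion. For each chart $\Psi_j:B_j\times S^1\to S^{2n-1}$ ($1\le j\le n$) there exists a $1$-form $\tau_j$ on $B_j$ such that $\Psi_j^*(\alpha)=\frac12(dt-\tau_j)$, namely $\tau_j=-\sum_{i\ne j}(x_i\,dy_i-y_i\,dx_i)$. Suppose that (1) $\Gamma\int_\gamma\tau=0 \bmod 2\pi$ for all $[\gamma]\in H_1(\Sigma;\mathbb{Z})$ (with $\gamma$ a closed path in $\Sigma$ representing the class), and (2) for all $k\geq 2$ and all distinct points $x_1,\dots,x_k\in\Sigma$ such that $f(x_1)=f(x_j)$ for all $j\le k$, and a choice of path $\gamma_j$ in $\Sigma$ from $x_1$ to $x_j$ for $2\le j\le k$, the set $\left\{\Gamma\int_{\gamma_j}\tau \bmod 2\pi \;:\; 2\le j\le k\right\}$ has $k-1$ distinct values, none of which equals $0$. Then $f$ lifts to an embedding $\tilde f:\Sigma\to S^{2n-1}$ (that is, $\pi\circ\tilde f=f$) whose image $\tilde\Sigma$ is a Legendrian submanifold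 of $(S^{2n-1},\alpha)$. Furthermore, the cone $c\tilde\Sigma$ is Lagrangian in $\mathbb{C}^n$ with respect to the standard symplectic structure $\omega_0$.
   Context: Notation. $z_i=x_i+iy_i$ are coordinates on $\mathbb{C}^n$, and $\omega_0=\frac i2\sum dz_i\wedge d\bar z_i=\sum dx_i\wedge dy_i$. The form $\omega_{FS}$ is the Fubini–Study form on $\mathbb{C}P^{n-1}$ normalized so that $\int_{\mathbb{C}P^1}\omega_{FS}=\pi$; equivalently, it is the unique form whose pullback to $S^{2n-1}$ under the Hopf map equals the restriction of $\omega_0$ to $S^{2n-1}$. The contact structure on $S^{2n-1}$ is $\ker\alpha$. The cone $c\tilde\Sigma$ is the set $\{r p : r>0,\ p\in\tilde\Sigma\}\subset\mathbb{C}^n$. Hemispherical charts. For $1\le j\le n$, $B_j\subset\mathbb{C}^{n-1}$ is the open unit ball with coordinates numbered $z=(z_1,\dots,\widehat{z_j},\dots,z_n)$ (the index $j$ is omitted). Define $\psi_j:B_j\to\mathbb{C}P^{n-1}$ by $\psi_j(z)=[z_1:\dots:z_{j-1}:\sqrt{1-|z|^2}:z_{j+1}:\dots:z_n]$, with image $U_j=\{[z_1:\dots:z_n] : z_j\neq 0\}$, and $\Psi_j:B_j\times S^1\to S^{2n-1}$ by $\Psi_j(z,e^{it})=e^{it}(z_1,\dots,z_{j-1},\sqrt{1-|z|^2},z_{j+1},\dots,z_n)$, which trivializes the Hopf fibration over $U_j$. Lifting integral. Let $\gamma:[0,1]\to\Sigma$ be a (piecewise smooth) path. Choose $0=s_0<s_1<\dots<s_m=1$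 and indices $j_0,\dots,j_{m-1}\in\{1,\dots,n\}$ such that $f(\gamma([s_k,s_{k+1}]))\subset U_{j_k}$ for each $k$. For $s\in[s_k,s_{k+1}]$ set $t_k(s)=\int_{s_k}^s\tau_{j_k}\left((\psi_{j_k}^{-1}\circ f\circ\gamma)'(u)\right)du \bmod 2\pi$. For $k\ge1$ and $t\in\mathbb{R}/2\pi\mathbb{Z}$, let $\Psi_{j_kj_{k-1}}(t)$ denote the argument of the $S^1$-component of $\Psi_{j_k}^{-1}\circ\Psi_{j_{k-1}}(p,e^{it})$, where $p=\psi_{j_{k-1}}^{-1}(f(\gamma(s_k)))\in B_{j_{k-1}}$; explicitly it is $t+\arg(p_{j_k})$, where $p_{j_k}$ is the $z_{j_k}$-coordinate of $p$, if $j_k\ne j_{k-1}$, and it is $t$ if $j_k=j_{k-1}$. With initial value $t(0)=a$, the lifting integral is $$\Gamma\int_\gamma\tau:=\left[t_{m-1}(s_m)+\Psi_{j_{m-1}j_{m-2}}\left(\cdots\left(t_2(s_3)+\Psi_{j_2j_1}\left(t_1(s_2)+\Psi_{j_1j_0}(t_0(s_1)+a)\right)\right)\cdots\right)\right]\bmod 2\pi .$$ In the theorem the initial value is $a=0$, and for the paths considered (whose two endpoints have the same image under $f$) the first and last charts are taken to be the same, $j_{m-1}=j_0$. *)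

(* Defs.v *)
From HB Require Import structures.
From mathcomp Require Import all_boot all_order all_algebra generic_quotient.
From mathcomp Require Import all_classical all_reals all_analysis.
From mathcomp Require Import ring.

Set Implicit Arguments.
Unset Strict Implicit.
Unset Printing Implicit Defensive.

Import Order.TTheory GRing.Theory Num.Theory.
Import numFieldNormedType.Exports.

Local Open Scope classical_set_scope.
Local Open Scope quotient_scope.
Local Open Scope ring_scope.

Section Smooth.
Context {R : realType}.
Implicit Types E F : normedModType R.

Fixpoint Ck {E F} (k : nat) (U : set E) (f : E -> F) : Prop :=
  if k is k'.+1 then
    (forall x, U x -> differentiable f x) /\ (forall v, Ck k' U ('D_v f))
  else forall x, U x -> {for x, continuous f}.

(* C^oo on an open subset; adequate because every domain below is finite
   dimensional. *)
Definition smooth_on {E F} (U : set E) (f : E -> F) : Prop :=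
  open U /\ forall k, Ck k U f.

End Smooth.

Section Manifolds.
Context {R : realType}.

(* [param i] is the inverse of the chart [chart i : dom i -> E]; only its values
   on the image of [dom i] matter. *)
Record atlas (M : Type) (E : normedModType R) := Atlas {
  chart_index : Type;
  dom : chart_index -> set M;
  chart : chart_index -> M -> E;
  param : chart_index -> E -> M }.

Definition euclid (E : normedModType R) : atlas E E :=
  Atlas (fun _ : unit => [set: E]) (fun=> id) (fun=> id).

(* Smoothness on the open set D.  Requiring the domains of the local
   representatives to be open also makes D open and f continuous on it. *)
Definition smooth_map {M N : Type} {E F : normedModType R}
    (A : atlas M E) (B : atlas N F) (D : set M) (f : M -> N) : Prop :=
  forall (i : chart_index A) (j : chart_index B),
    smooth_on (chart i @` (dom i `&` D `&` f @^-1` dom j))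
              (chart j \o f \o param i).

Definition immersion {M N : Type} {E F : normedModType R}
    (A : atlas M E) (B : atlas N F) (f : M -> N) : Prop :=
  smooth_map A B setT f /\
  forall (i : chart_index A) (j : chart_index B) x, dom i x -> dom j (f x) ->
    injective ('d (chart j \o f \o param i) (chart i x)).

Definition smooth_manifold {M : topologicalType} {E : normedModType R}
    (A : atlas M E) : Prop :=
  [/\ hausdorff_space M, @second_countable M,
      forall x, exists i : chart_index A, dom i x,
      forall i : chart_index A,
        [/\ open (dom i), open (chart i @` dom i),
            forall x, dom i x -> param i (chart i x) = x,
            forall x, dom i x -> {for x, continuous (chart i)} &
            forall x, dom i x -> {for chart i x, continuous (param i)}] &
      smooth_map A A setT id].

Definition embedding {M : topologicalType} {E F : normedModType R}
    (A : atlas M E) (g : M -> F) : Prop :=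
  [/\ immersion A (euclid F) g, injective g &
      forall O, open O -> exists2 O', open O' & g @` O = range g `&` O'].

Definition local_param (d : nat) {F : normedModType R} (S : set F)
    (V : set 'rV[R]_d) (phi : 'rV[R]_d -> F) : Prop :=
  [/\ smooth_on V phi, forall y, V y -> injective ('d phi y),
      {in V &, injective phi} &
      forall O, O `<=` V -> open O ->
        exists2 O', open O' & phi @` O = S `&` O'].

Definition submanifold (d : nat) {F : normedModType R} (S : set F) : Prop :=
  forall p, S p -> exists V phi, local_param (d := d) S V phi /\ (phi @` V) p.

Definition tangent {F : normedModType R} (S : set F) (p : F) : set F :=
  [set v | exists (U : set R) (c : R -> F),
     [/\ smooth_on U c, U 0, forall t, U t -> S (c t), c 0 = p & derive1 c 0 = v]].

(* Only the values on [0, 1] matter.  Each piece is smooth up to its endpoints: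
   it extends smoothly to an open neighbourhood of the closed subinterval. *)
Definition piecewise_smooth {M : Type} {E : normedModType R} (A : atlas M E)
    (gamma : R -> M) : Prop :=
  exists (m : nat) (u : nat -> R),
    [/\ u 0%N = 0, u m = 1 &
        forall k, (k < m)%N -> u k < u k.+1 /\
          exists (D : set R) (eta : R -> M),
            [/\ smooth_map (euclid R) A D eta, [set` `[u k, u k.+1]] `<=` D &
                forall s, s \in `[u k, u k.+1] -> eta s = gamma s]].

End Manifolds.

Section Homology.
Context {R : realType} {M : topologicalType}.

Definition simplex2 : set (R * R) :=
  [set p | [/\ 0 <= p.1, 0 <= p.2 & p.1 + p.2 <= 1]].

(* A singular k-chain (k = 1, 2) is a formal sum of pairs (coefficient, singular
   simplex); a simplex is given by a total function of which only the restriction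
   to [0, 1], resp. [simplex2], matters. *)
Definition chain1 := seq (int * (R -> M)).
Definition chain2 := seq (int * (R * R -> M)).

Definition is_chain1 (c : chain1) : Prop :=
  foldr (fun (p : int * (R -> M)) P =>
           {within [set` `[0 : R, 1]], continuous p.2} /\ P) True c.
Definition is_chain2 (c : chain2) : Prop :=
  foldr (fun (p : int * (R * R -> M)) P =>
           {within simplex2, continuous p.2} /\ P) True c.

Definition multiplicity1 (c : chain1) (s : R -> M) : int :=
  \sum_(p <- c | `[< {in `[0 : R, 1], p.2 =1 s} >]) p.1.

Definition boundary1 (c : chain1) (x : M) : int :=
  \sum_(p <- c) p.1 * ((`[< p.2 1 = x >] : nat)%:Z - (`[< p.2 0 = x >] : nat)%:Z).

(* The vertices of simplex2 are ordered (0,0), (1,0), (0,1). *)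
Definition boundary2 (c : chain2) : chain1 :=
  flatten [seq [:: (p.1, fun t => p.2 (1 - t, t));
                   (- p.1, fun t => p.2 (0, t));
                   (p.1, fun t => p.2 (t, 0))] | p <- c].

Definition cycle1 (c : chain1) : Prop :=
  is_chain1 c /\ forall x, boundary1 c x = 0.

(* Equality of classes in H_1(M; Z) = ker boundary1 / im boundary2. *)
Definition homologous (c c' : chain1) : Prop :=
  exists2 d, is_chain2 d &
    forall s, multiplicity1 c s - multiplicity1 c' s = multiplicity1 (boundary2 d) s.

End Homology.

Section Hopf.
Context {R : realType}.

(* C^n as a real normed space: w = (x, y) stands for the vector x + i y. *)
Definition Cn (n : nat) := ('rV[R]_n * 'rV[R]_n)%type.

Definition normsq n (w : Cn n) : R :=
  \sum_i (w.1 ord0 i ^+ 2 + w.2 ord0 i ^+ 2).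

Definition phase n (t : R) (w : Cn n) : Cn n :=
  (cos t *: w.1 - sin t *: w.2, sin t *: w.1 + cos t *: w.2).

(* omega_0 = sum dx_i /\ dy_i *)
Definition omega0 n (u v : Cn n) : R :=
  \sum_i (u.1 ord0 i * v.2 ord0 i - u.2 ord0 i * v.1 ord0 i).

(* alpha = (1/2) sum (x_i dy_i - y_i dx_i) at w, applied to v *)
Definition alpha n (w v : Cn n) : R :=
  2^-1 * \sum_i (w.1 ord0 i * v.2 ord0 i - w.2 ord0 i * v.1 ord0 i).

Notation sphere n := {w : Cn n | normsq w == 1}.

Definition same_fiber n (p q : sphere n) : bool :=
  `[< exists t, val q = phase t (val p) >].

Lemma phaseD n s t (w : Cn n) : phase s (phase t w) = phase (s + t) w.
Proof.
rewrite /phase cosD sinD; congr pair; apply/rowP => i; rewrite !mxE /=; ring.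
Qed.

Lemma phase0 n (w : Cn n) : phase 0 w = w.
Proof.
by case: w => x y; rewrite /phase cos0 sin0 !scale1r !scale0r subr0 add0r.
Qed.

Lemma same_fiber_equiv n : equiv_class_of (@same_fiber n).
Proof.
have sym p q : @same_fiber n p q -> same_fiber q p.
  move=> /asboolP[t qE]; apply/asboolP; exists (- t).
  by rewrite qE phaseD addNr phase0.
split=> [p|p q|q p r /asboolP[s qE] /asboolP[t rE]].
- by apply/asboolP; exists 0; rewrite phase0.
- by apply/idP/idP; apply: sym.
- by apply/asboolP; exists (t + s); rewrite rE qE phaseD.
Qed.

Canonical same_fiber_equiv_rel n := EquivRelPack (@same_fiber_equiv n).

(* CP^{n-1}, as the quotient of S^{2n-1} by S^1 *)
Definition CP n := {eq_quot @same_fiber n}.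

Definition hopf n (p : sphere n) : CP n := \pi_(CP n) p.

(* B_j for every j.  In the chart j, the k-th coordinate of C^{n-1} is the one
   numbered [lift j k] in C^n. *)
Definition hball n : set (Cn n.-1) := [set z | normsq z < 1].

(* (z_1, ..., sqrt (1 - |z|^2), ..., z_n), with the square root at place j *)
Definition hsect n (j : 'I_n) (z : Cn n.-1) : Cn n :=
  (\row_i oapp (fun k => z.1 ord0 k) (Num.sqrt (1 - normsq z)) (unlift j i),
   \row_i oapp (fun k => z.2 ord0 k) 0 (unlift j i)).

Lemma hsect_sphere n (j : 'I_n) z : hball z -> normsq (hsect j z) == 1.
Proof.
rewrite /hball /= => z1; rewrite /normsq (bigD1 j) //=.
rewrite !mxE unlift_none /= expr0n addr0 sqr_sqrtr ?subr_ge0 1?ltW//.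
rewrite [X in _ + X](_ : _ = normsq z) ?subrK//.
case: n j z z1 => [[]//|n] j z _ /=.
rewrite /normsq (reindex_omap (lift j) (unlift j)) /=; last first.
  by move=> i; rewrite eq_sym => /unlift_some[k -> ->].
rewrite (eq_bigl xpredT) => [|k]; last by rewrite eq_sym neq_lift liftK eqxx.
by apply: eq_bigr => k _; rewrite !mxE liftK.
Qed.

Lemma hball0 n : hball (0 : Cn n.-1).
Proof. by rewrite /hball /normsq /= big1// => i _; rewrite !mxE expr0n addr0. Qed.

(* psi_j : B_j -> CP^{n-1}; the default value is used only outside B_j *)
Definition psi n (j : 'I_n) (z : Cn n.-1) : CP n :=
  hopf (insubd (Sub (hsect j 0) (hsect_sphere j (@hball0 n)) : sphere n)
               (hsect j z)).

Definition Uset n (j : 'I_n) : set (CP n) := psi j @` @hball n.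

Definition psi_inv n (j : 'I_n) : CP n -> Cn n.-1 :=
  'pinv_(fun=> 0) (@hball n) (psi j).

Definition CP_atlas n : atlas (CP n) (Cn n.-1) :=
  Atlas (@Uset n) (@psi_inv n) (@psi n).

(* Psi_j (z, e^{it}), with S^1 parametrized by t *)
Definition Psi n (j : 'I_n) (p : Cn n.-1 * R) : Cn n :=
  phase p.2 (hsect j p.1).

(* psi_j^* omega_FS: since psi_j = hopf o hsect_j on B_j and the pullback of
   omega_FS by the Hopf map is the restriction of omega_0, this is
   hsect_j^* omega_0 *)
Definition omegaFS n (j : 'I_n) (z u v : Cn n.-1) : R :=
  omega0 ('d (hsect j) z u) ('d (hsect j) z v).

(* f is a Lagrangian immersion of an (n-1)-manifold for (1/pi) omega_FS *)
Definition lagrangian_immersion n {M : Type} (A : atlas M 'rV[R]_n.-1)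
    (f : M -> CP n) : Prop :=
  immersion A (CP_atlas n) f /\
  forall (i : chart_index A) (j : 'I_n) x, dom i x -> Uset j (f x) ->
    let F := psi_inv j \o f \o param i in
    let y := chart i x in
    forall u v, pi^-1 * omegaFS j (F y) ('d F y u) ('d F y v) = 0.

Definition legendrian n (S : set (Cn n)) : Prop :=
  [/\ forall p, S p -> normsq p = 1, submanifold n.-1 S &
      forall p v, S p -> tangent S p v -> alpha p v = 0].

Definition lagrangian n (S : set (Cn n)) : Prop :=
  submanifold n S /\
  forall p u v, S p -> tangent S p u -> tangent S p v -> omega0 u v = 0.

Definition cone n (S : set (Cn n)) : set (Cn n) :=
  [set w | exists r p, [/\ 0 < r, S p & w = r *: p]].

(* tau_j = - sum_{i <> j} (x_i dy_i - y_i dx_i) at z, applied to v; with the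
   numbering of the coordinates on B_j the formula does not involve j *)
Definition tau n (j : 'I_n) (z v : Cn n.-1) : R :=
  - \sum_k (z.1 ord0 k * v.2 ord0 k - z.2 ord0 k * v.1 ord0 k).

Definition eqmod2pi (x y : R) : Prop := exists k : int, x - y = k%:~R * (2 * pi).

(* the argument in ]-pi, pi] of a + i b <> 0 *)
Definition carg (a b : R) : R :=
  let t := acos (a / Num.sqrt (a ^+ 2 + b ^+ 2)) in if 0 <= b then t else - t.

(* Psi_{j'j}(t) at p: the S^1-component of Psi_{j'}^{-1}(w) is w_{j'} / |w_{j'}| *)
Definition Psi_trans n (j' j : 'I_n) (p : Cn n.-1) (t : R) : R :=
  let w := Psi j (p, t) in carg (w.1 ord0 j') (w.2 ord0 j').

Section LiftingIntegral.
Context {n : nat} {M : Type} (f : M -> CP n) (gamma : R -> M).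
Variables (s : nat -> R) (j : nat -> 'I_n).

(* 0 = s_0 < ... < s_{m+1} = 1, with f (gamma [s_k, s_{k+1}]) in U_{j_k} *)
Definition subordinate (m : nat) : Prop :=
  [/\ s 0%N = 0, s m.+1 = 1 &
      forall k, (k <= m)%N -> s k < s k.+1 /\
        forall u, u \in `[s k, s k.+1] -> Uset (j k) (f (gamma u))].

(* t_k (s_{k+1}) *)
Definition tau_int (k : nat) : R :=
  let c := psi_inv (j k) \o f \o gamma in
  \int[lebesgue_measure]_(u in [set` `[s k, s k.+1]]) tau (j k) (c u) (derive1 c u).

(* The lifting integral over m+1 subintervals with initial value a; only its
   class mod 2 pi is meaningful. *)
Fixpoint lift_sum (a : R) (m : nat) : R :=
  if m is k.+1 then
    tau_int k.+1 +
    Psi_trans (j k.+1) (j k) (psi_inv (j k) (f (gamma (s k.+1)))) (lift_sum a k)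
  else tau_int 0 + a.

End LiftingIntegral.

(* v is (a representative mod 2 pi of) the lifting integral of tau along gamma
   with initial value 0, for some admissible choice of subdivision and charts
   with the same first and last chart. *)
Definition lifting_integral n {M : Type} (f : M -> CP n) (gamma : R -> M)
    (v : R) : Prop :=
  exists m s j, [/\ subordinate f gamma s j m, j m = j 0%N &
                    eqmod2pi v (lift_sum f gamma s j 0 m)].

End Hopf.

Notation sphere R n := {w : @Cn R n | normsq w == 1}.
Arguments Cn : clear implicits.
Arguments CP : clear implicits.

(* Main.v *)
From HB Require Import structures.
Require Import Defs.
From mathcomp Require Import all_boot all_order all_algebra.
From mathcomp Require Import all_classical all_reals all_analysis.
From mathcomp Require Import measurable_realfun ring lra.
From mathcomp Require generic_quotient.

Set Implicit Arguments.
Unset Strict Implicit.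
Unset Printing Implicit Defensive.

Import Order.TTheory GRing.Theory Num.Theory.
Import numFieldNormedType.Exports.

Local Open Scope classical_set_scope.
Local Open Scope ring_scope.

(** Call a map l from an open subset of Sigma to the sphere horizontal if it
    lifts f and alpha vanishes on its differential.  In the trivialization Psi_j
    a lift of f is Psi_j (g, th) with g = psi_j^-1 o f, and by [alpha_Psi] it is
    horizontal exactly when d th = g^* tau_j.  Since d tau_j = - 2 omega0, and
    omega0 is the Fubini-Study form in this chart, this 1-form is closed because
    f is Lagrangian; so horizontal lifts exist locally ([local_section], by the
    Poincare lemma), and two of them differ by a constant phase ([hor_unique]).
    In other words the circle bundle f^* S^{2n-1} over Sigma is flat, and paths
    in Sigma have horizontal lifts.

    Integrating tau_j on each piece of a path and passing from one trivialization
    to the next by Psi_trans is the same as following a horizontal lift, so the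
    lifting integral is the holonomy: the lift ends at phase v times its initial
    value ([lifting_integral_transport]).  The holonomy of a flat bundle extends
    to singular chains and is 0 mod 2 pi on boundaries ([Hol_boundary], by lifting
    whole triangles).  Hence if every homology class contains a closed path with
    zero lifting integral, all cycles have zero holonomy, and transporting one
    point of one fibre along arbitrary chains defines a global horizontal lift F
    ([global_section], [global_lift]).

    If F x = F x' with x <> x', then f x = f x' and the holonomy of any path
    from x to x' is 0, against the assumption on multiple points
    ([lift_injective]).  F is an immersion because f is one, and an embedding
    because Sigma is compact.  Its image is Legendrian since F is horizontal, and
    the cone over a Legendrian submanifold is Lagrangian ([legendrian_cone]),
    since differentiating the horizontality condition shows that omega0 vanishes
    on pairs of tangent vectors of the image. *)

(** * Interval induction *)

Section IntervalInduction.
Context {R : realType}.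

(** The supremum of the y such that P a y holds is b. *)
Lemma interval_induction (P : R -> R -> Prop) (a b : R) : a <= b ->
  (forall x y z, a <= x -> x <= y -> y <= z -> z <= b ->
     P x y -> P y z -> P x z) ->
  (forall x, a <= x <= b -> exists2 e, 0 < e &
     forall c d, a <= c -> c <= d -> d <= b -> x - e < c -> d < x + e ->
       P c d) ->
  P a b.
Proof.
move=> ab add loc.
pose S := [set y | a <= y <= b /\ P a y].
have Sa : S a.
  split; first by rewrite lexx.
  have [|e e0] := loc a; first by rewrite lexx.
  by apply; rewrite ?lexx//; lra.
have supS : has_sup S by split; [exists a | exists b => y [/andP[]]].
set z := sup S.
have az : a <= z by apply: ub_le_sup => //; case: supS.
have zb : z <= b by apply: ge_sup => [|y [/andP[]]//]; exists a.
have [|e e0 Pe] := loc z; first by rewrite az zb.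
have [y Sy zy] := sup_adherent e0 supS.
have yz : y <= z by apply: ub_le_sup => //; case: supS.
have [/andP[ay yb] Pay] := Sy.
have Paz : P a z.
  by apply: (add a y z) => //; apply: Pe => //; lra.
suff bz : b <= z by have -> : b = z by lra.
rewrite leNgt; apply/negP => zltb.
pose d := Num.min b (z + e / 2).
have zd : z < d by rewrite /d lt_min zltb; lra.
have db : d <= b by rewrite /d ge_min lexx.
have de : d <= z + e / 2 by rewrite /d ge_min lexx orbT.
have : d <= z.
  apply: ub_le_sup; first by case: supS.
  split; first by lra.
  apply: (add a z d) => //; [lra|].
  by apply: Pe => //; lra.
by lra.
Qed.

End IntervalInduction.

(** * Calculus of C^k maps *)

Section SmoothCalculus.
Context {R : realType}.
Implicit Types E F G : normedModType R.

Lemma differentiable_approx E F (f : E -> F) (x : E) (L : {linear E -> F}) :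
  continuous L -> f \o shift x = cst (f x) + L +o_ 0 id -> differentiable f x.
Proof. by move=> cL fL; apply/diff_locallyP; rewrite (diff_unique cL fL). Qed.

Lemma near_differentiable E F (f g : E -> F) (x : E) :
  (\forall y \near x, f y = g y) -> differentiable f x -> differentiable g x.
Proof.
move=> fg df; apply: (@differentiable_approx _ _ _ _ ('d f x)); first exact: diff_continuous.
apply/eqaddoP => e e0; have /eqaddoP/(_ e e0) := diff_locally df.
rewrite -(nbhs_singleton fg).
have fg0 : \forall h \near 0, f (h + x) = g (h + x).
  move: fg; rewrite (near_shift 0 x) /=; apply: filter_app; near=> h.
  by rewrite /= subr0.
apply: filterS2 fg0 => h fgh; rewrite [(f \o _ - _) h]/(f (h + x) - _) fgh; exact.
Unshelve. all: by end_near. Qed.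

Lemma Ck_eq E F k (U : set E) (f g : E -> F) : open U ->
  (forall x, U x -> f x = g x) -> Ck k U f -> Ck k U g.
Proof.
move=> oU; elim: k f g => [|k IH] f g fg /=.
  move=> cf x Ux; suff : g @ x --> g x by [].
  have : f @ x --> f x by exact: cf.
  rewrite -(fg x Ux); apply: cvg_trans; apply: near_eq_cvg; near=> y; apply: fg.
  by near: y; exact: open_nbhs_nbhs.
move=> [df Df]; split.
  move=> x Ux; apply: near_differentiable (df x Ux).
  by near=> y; apply: fg; near: y; exact: open_nbhs_nbhs.
move=> v; apply: IH (Df v) => x Ux; apply: near_eq_derive.
by near=> y; apply: fg; near: y; exact: open_nbhs_nbhs.
Unshelve. all: by end_near. Qed.

Lemma Ck_sub E F k (U V : set E) (f : E -> F) :
  V `<=` U -> Ck k U f -> Ck k V f.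
Proof.
by move=> VU; elim: k f => [|k IH] f /=; [move=> cf x /VU/cf|
  move=> [df Df]; split=> [x /VU/df|v]//; apply: IH].
Qed.

Lemma Ck_local E F k (U : set E) (f : E -> F) :
  (forall x, U x -> exists2 W, W x & Ck k W f) -> Ck k U f.
Proof.
elim: k f => [|k IH] f loc /=; first by move=> x Ux; have [W Wx] := loc x Ux; apply.
split=> [x Ux|v]; first by have [W Wx [/(_ x Wx)]] := loc x Ux.
by apply: IH => x Ux; have [W Wx [_ /(_ v)]] := loc x Ux; exists W.
Qed.

Lemma CkW E F k (U : set E) (f : E -> F) : Ck k.+1 U f -> Ck k U f.
Proof.
elim: k f => [|k IH] f [df Df] /=.
  by move=> x /df/differentiable_continuous.
by split=> // v; apply: IH; apply: Df.
Qed.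

Lemma Ck_diff E F k (U : set E) (f : E -> F) x :
  Ck k.+1 U f -> U x -> differentiable f x.
Proof. by case=> df _ /df. Qed.

Lemma Ck_cont E F k (U : set E) (f : E -> F) x :
  Ck k U f -> U x -> {for x, continuous f}.
Proof. by elim: k => [|k IH]; [apply|move/CkW]. Qed.

Lemma Ck_derive E F k (U : set E) (f : E -> F) v :
  Ck k.+1 U f -> Ck k U ('D_v f).
Proof. by move=> [_]; apply. Qed.

Lemma Ck_cst E F k (U : set E) (c : F) : Ck k U (cst c : E -> F).
Proof.
elim: k c => [|k IH] c /=; first by move=> x _; exact: cst_continuous.
split=> [x _|v]; first exact: differentiable_cst.
rewrite (_ : 'D_v _ = cst 0); first exact: IH.
by apply/funext => x; rewrite derive_cst.
Qed.

Lemma derive_linear E F (L : {linear E -> F}) x v : continuous L -> 'D_v L x = L v.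
Proof.
move=> cL; rewrite deriveE; last exact: linear_differentiable.
by rewrite (diff_lin _ cL).
Qed.

Lemma Ck_linear E F k (U : set E) (f : {linear E -> F}) :
  continuous f -> Ck k U f.
Proof.
move=> cf; case: k => [|k] /=; first by move=> x _; exact: cf.
split=> [x _|v]; first exact: linear_differentiable.
rewrite (_ : 'D_v _ = cst (f v)); first exact: Ck_cst.
by apply/funext => x; rewrite derive_linear.
Qed.

Lemma derive_lin E F G (L : {linear F -> G}) (f : E -> F) x v :
  continuous L -> differentiable f x -> 'D_v (L \o f) x = L ('D_v f x).
Proof.
move=> cL df.
have dL y : differentiable L y by exact: linear_differentiable.
rewrite deriveE; last exact: differentiable_comp.
by rewrite (diff_comp df (dL _))/= (diff_lin _ cL) deriveE.
Qed.

Lemma derive_comp_lin E F G (L : {linear E -> F}) (f : F -> G) x v :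
  continuous L -> differentiable f (L x) ->
  'D_v (f \o L) x = 'D_(L v) f (L x).
Proof.
move=> cL df.
have dL y : differentiable L y by exact: linear_differentiable.
rewrite deriveE; last exact: differentiable_comp.
by rewrite (diff_comp (dL _) df)/= (diff_lin _ cL) deriveE.
Qed.

Lemma Ck_lin E F G k (U : set E) (L : {linear F -> G}) (f : E -> F) :
  open U -> continuous L -> Ck k U f -> Ck k U (L \o f).
Proof.
move=> oU cL; elim: k f => [|k IH] f /=.
  by move=> cf x Ux; apply: continuous_comp; [exact: cf|exact: cL].
move=> [df Df]; split=> [x Ux|v].
  by apply: differentiable_comp; [exact: df|exact: linear_differentiable].
apply: (@Ck_eq _ _ _ _ (L \o 'D_v f)) => //; last exact: IH.
by move=> x Ux /=; rewrite derive_lin//; exact: df.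
Qed.

Lemma Ck_comp_lin E F G k (U : set F) (L : {linear E -> F}) (f : F -> G) :
  open U -> continuous L -> Ck k U f -> Ck k (L @^-1` U) (f \o L).
Proof.
move=> oU cL.
have oV : open (L @^-1` U) by apply: open_comp => // x _; exact: cL.
elim: k f => [|k IH] f /=.
  by move=> cf x Ux; apply: continuous_comp; [exact: cL|exact: cf].
move=> [df Df]; split=> [x Ux|v].
  by apply: differentiable_comp; [exact: linear_differentiable|exact: df].
apply: (@Ck_eq _ _ _ _ ('D_(L v) f \o L)) => //; last exact: IH.
by move=> x Ux /=; rewrite derive_comp_lin//; exact: df.
Qed.

Lemma CkD E F k (U : set E) (f g : E -> F) : open U ->
  Ck k U f -> Ck k U g -> Ck k U (fun x => f x + g x).
Proof.
move=> oU; elim: k f g => [|k IH] f g /=.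
  by move=> cf cg x Ux; apply: cvgD; [exact: cf|exact: cg].
move=> [df Df] [dg Dg]; split=> [x Ux|v].
  by apply: differentiableD; [exact: df|exact: dg].
apply: (@Ck_eq _ _ _ _ (fun x => 'D_v f x + 'D_v g x)) => //; last exact: IH.
by move=> x Ux /=; rewrite deriveD//; apply: diff_derivable; [exact: df|exact: dg].
Qed.

Lemma Ck_sum E F k (U : set E) (I : Type) (r : seq I) (f : I -> E -> F) :
  open U -> (forall i, Ck k U (f i)) -> Ck k U (fun x => \sum_(i <- r) f i x).
Proof.
move=> oU Uf; elim: r => [|i r IH].
  rewrite (_ : (fun _ => _) = cst 0); first exact: Ck_cst.
  by apply/funext => x; rewrite big_nil.
rewrite (_ : (fun _ => _) = fun x => f i x + \sum_(j <- r) f j x).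
  exact: CkD.
by apply/funext => x; rewrite big_cons.
Qed.

Lemma CkM E k (U : set E) (f g : E -> R) : open U ->
  Ck k U f -> Ck k U g -> Ck k U (fun x => f x * g x).
Proof.
move=> oU; elim: k f g => [|k IH] f g.
  by move=> cf cg x Ux; apply: cvgM; [exact: cf|exact: cg].
move=> Cf Cg; have Cf' := CkW Cf; have Cg' := CkW Cg.
have df x := Ck_diff Cf (x := x); have dg x := Ck_diff Cg (x := x).
split=> [x Ux|v].
  by apply: (differentiableM (df x Ux) (dg x Ux)).
apply: (@Ck_eq _ _ _ _ (fun x => f x * 'D_v g x + g x * 'D_v f x)) => //.
  move=> x Ux; rewrite (@deriveM _ _ f g)//.
    exact/diff_derivable/df.
  exact/diff_derivable/dg.
by apply: CkD => //; apply: IH => //; exact: Ck_derive.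
Qed.

Lemma derive_comp1 E (g : R -> R) (f : E -> R) x v :
  differentiable f x -> derivable g (f x) 1 ->
  'D_v (g \o f) x = 'D_1 g (f x) * 'D_v f x.
Proof.
move=> df /derivable1_diffP dg; rewrite deriveE; last exact: differentiable_comp.
rewrite (diff_comp df dg)/= -(deriveE v df).
have /derivable1_diffP/deriv1E -> := dg.
by rewrite derive1E mulrC.
Qed.

Lemma Ck_comp1 E k (U : set E) (V : set R) (g : R -> R) (f : E -> R) :
  open U -> (forall x, U x -> V (f x)) ->
  Ck k V g -> Ck k U f -> Ck k U (g \o f).
Proof.
move=> oU UV; elim: k f g UV => [|k IH] f g UV.
  move=> cg cf x Ux; apply: continuous_comp; [exact: cf|exact/cg/UV].
move=> Cg Cf; have Cf' := CkW Cf.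
have df x := Ck_diff Cf (x := x); have dg x := Ck_diff Cg (x := x).
split=> [x Ux|v].
  by apply: differentiable_comp; [exact: df|exact/dg/UV].
apply: (@Ck_eq _ _ _ _ (fun x => ('D_1 g \o f) x * 'D_v f x)) => //.
  move=> x Ux /=; rewrite [RHS]derive_comp1//; first exact: df.
  exact/derivable1_diffP/dg/UV.
apply: CkM => //; last exact: Ck_derive.
by apply: IH => //; exact: Ck_derive.
Qed.

Lemma Ck_real k (U : set R) (g : R -> R) : open U ->
  (forall x, U x -> derivable g x 1) -> Ck k U ('D_1 g) -> Ck k.+1 U g.
Proof.
move=> oU dg Cg; split=> [x Ux|v]; first exact/derivable1_diffP/dg.
apply: (@Ck_eq _ _ _ _ (fun x => v * 'D_1 g x)) => //.
  move=> x Ux; have dgx := dg x Ux.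
  by rewrite [RHS]deriveE ?deriv1E ?derive1E//; exact/derivable1_diffP.
by apply: CkM => //; exact: Ck_cst.
Qed.

Lemma Ck_cos_sin k (U : set R) : open U -> Ck k U (@cos R) /\ Ck k U (@sin R).
Proof.
move=> oU; elim: k => [|k [IHc IHs]].
  by split=> x _; [exact: continuous_cos|exact: continuous_sin].
split; apply: Ck_real => //.
  rewrite (_ : 'D_(1 : R) _ = (fun x => (-1) * sin x)).
    by apply: CkM => //; exact: Ck_cst.
  by apply/funext => x; rewrite derive_val mulN1r.
by rewrite (_ : 'D_(1 : R) _ = cos)//; apply/funext => x; rewrite derive_val.
Qed.

Lemma Ck_inv k (U : set R) : open U -> (forall x, U x -> x != 0) ->
  Ck k U (@GRing.inv R).
Proof.
move=> oU U0; elim: k => [|k IH]; first by move=> x /U0; exact: inv_continuous.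
apply: Ck_real => // [x /U0 x0|]; first exact/derivable1_diffP/differentiable_Rinv.
have C2 := CkM oU (Ck_cst k U (-1 : R)) (CkM oU IH IH).
apply: Ck_eq C2 => // x /U0 x0; rewrite deriveE; last exact: differentiable_Rinv.
by rewrite diff_Rinv// -[RHS]/(_ * 1) mulr1 mulN1r -expr2 exprVn.
Qed.

Lemma Ck_sqrt k (U : set R) : open U -> (forall x, U x -> 0 < x) ->
  Ck k U (@Num.sqrt R).
Proof.
move=> oU U0; elim: k => [|k IH]; first by move=> x _; exact: sqrt_continuous.
have ds x : U x -> is_derive x (1 : R) Num.sqrt (2 * Num.sqrt x)^-1.
  by move=> /U0; exact: is_derive1_sqrt.
apply: Ck_real => // [x /ds[]//|].
apply: (@Ck_eq _ _ _ _ (GRing.inv \o (fun x => 2 * Num.sqrt x))) => //.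
  by move=> x /ds dsx /=; rewrite derive_val.
apply: (@Ck_comp1 _ _ _ [set x | 0 < x]) => //.
- by move=> x /U0 x0; rewrite /= mulr_gt0 ?sqrtr_gt0.
- by apply: Ck_inv => [|x /= /gt_eqF ->]//; exact: open_gt.
- by apply: CkM => //; exact: Ck_cst.
Qed.

End SmoothCalculus.

(** * Symmetry of second derivatives *)

Section Lines.
Context {R : realType}.
Implicit Types E F : normedModType R.

Lemma is_diff_line E (x v : E) (t : R) :
  is_diff t (fun s : R => x + s *: v) ( *:%R^~ v).
Proof.
have := is_diffD (is_diff_cst x t) (is_diff_scalel t v).
by rewrite add0r.
Qed.

Lemma line_continuous E (x v : E) : continuous (fun s : R => x + s *: v).
Proof.
by move=> t; apply/differentiable_continuous; have [] := is_diff_line x v t.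
Qed.

Lemma is_derive_line E F (f : E -> F) (x v : E) (t : R) :
  differentiable f (x + t *: v) ->
  is_derive t (1 : R) (fun s : R => f (x + s *: v)) ('D_v f (x + t *: v)).
Proof.
move=> df; have [dl ll] := is_diff_line x v t.
have df' : differentiable (f \o fun s : R => x + s *: v) t.
  exact: differentiable_comp.
apply: DeriveDef; first exact/derivable1_diffP.
rewrite -[fun s => _]/(f \o fun s : R => x + s *: v) deriveE// diff_comp//=.
by rewrite ll scale1r deriveE.
Qed.

Lemma is_derive_dir E F (f : E -> F) (x v : E) (l : F) :
  is_derive (0 : R) (1 : R) (fun h : R => f (x + h *: v)) l -> is_derive x v f l.
Proof.
move=> [d1 d2].
have e : (fun h : R => h^-1 *: (((fun h : R => f (x + h *: v)) \o shift 0) (h *: (1 : R))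
     - f (x + 0 *: v))) = (fun h => h^-1 *: ((f \o shift x) (h *: v) - f x)).
  apply/funext => h /=; rewrite scale0r !addr0.
  by rewrite -[h *: (1 : R)]/(h * 1) mulr1 (addrC x).
by apply: DeriveDef; [rewrite /derivable -e|rewrite /derive -e].
Qed.

Lemma is_derive_along E F (f : E -> F) (x v : E) (t : R) (l : F) :
  is_derive (x + t *: v) v f l ->
  is_derive t (1 : R) (fun s : R => f (x + s *: v)) l.
Proof.
move=> [d1 d2].
have e : (fun h : R => h^-1 *: (((fun s : R => f (x + s *: v)) \o shift t) (h *: (1 : R))
     - f (x + t *: v))) =
   (fun h => h^-1 *: ((f \o shift (x + t *: v)) (h *: v) - f (x + t *: v))).
  apply/funext => h /=; congr (_ *: (f _ - _)).
  by rewrite -[h *: (1 : R)]/(h * 1) mulr1 scalerDl addrCA.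
by apply: DeriveDef; [rewrite /derivable e|rewrite /derive e].
Qed.

Lemma deriveZv E F (f : E -> F) (x v : E) (a : R) :
  differentiable f x -> 'D_(a *: v) f x = a *: 'D_v f x.
Proof. by move=> df; rewrite !deriveE// linearZ. Qed.

Lemma deriveDv E F (f : E -> F) (x v w : E) :
  differentiable f x -> 'D_(v + w) f x = 'D_v f x + 'D_w f x.
Proof. by move=> df; rewrite !deriveE// linearD. Qed.

Lemma MVT_closed (f df : R -> R) (a b : R) : a < b ->
  (forall x, a <= x <= b -> is_derive x (1 : R) f (df x)) ->
  exists2 c, a <= c <= b & f b - f a = df c * (b - a).
Proof.
move=> ab fdf.
have [||c cab fc] := @MVT R f df a b ab.
- move=> x; rewrite in_itv/= => /andP[/ltW ax /ltW xb]; by apply: fdf; rewrite ax xb.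
- apply: continuous_in_subspaceT => x /set_mem/=; rewrite in_itv/= => xab.
  by apply/differentiable_continuous/derivable1_diffP; case: (fdf x xab).
- by exists c => //; move: cab; rewrite in_itv/= => /andP[/ltW-> /ltW->].
Qed.

(** The mean value theorem along v, then along u.  The left-hand side does not
    change when u and v are exchanged, which is what makes mixed derivatives
    symmetric. *)
Lemma second_difference E (f : E -> R) (x u v : E) (h : R) : 0 < h ->
  (forall s t, 0 <= s <= h -> 0 <= t <= h ->
     differentiable f (x + s *: u + t *: v) /\
     differentiable ('D_v f) (x + s *: u + t *: v)) ->
  exists s t, [/\ 0 <= s <= h, 0 <= t <= h &
    f (x + h *: u + h *: v) - f (x + h *: u) - f (x + h *: v) + f x =
    'D_u ('D_v f) (x + s *: u + t *: v) * h ^+ 2].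
Proof.
move=> h0 df; have hh : 0 <= h <= h by rewrite lexx ltW.
have h00 : 0 <= (0 : R) <= h by rewrite lexx ltW.
have [t t0h et] := @MVT_closed
  (fun t => f (x + h *: u + t *: v) - f (x + t *: v))
  (fun t => 'D_v f (x + h *: u + t *: v) - 'D_v f (x + t *: v)) 0 h h0
  ltac:(move=> t t0h; have [dfx _] := df _ _ hh t0h;
        have [] := df _ _ h00 t0h; rewrite scale0r addr0 => dfx' _;
        apply: is_deriveB; exact: is_derive_line).
have [s s0h es] := @MVT_closed
  (fun s => 'D_v f (x + t *: v + s *: u))
  (fun s => 'D_u ('D_v f) (x + t *: v + s *: u)) 0 h h0
  ltac:(move=> s s0h; have [_] := df _ _ s0h t0h;
        rewrite addrAC => dfx; exact: is_derive_line).
exists s, t; split=> //.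
move: et es; rewrite !subr0 !scale0r !addr0 => et es.
rewrite (_ : f _ - _ - _ + _ =
  f (x + h *: u + h *: v) - f (x + h *: v) - (f (x + h *: u) - f x)); last by ring.
by rewrite et (addrAC x (h *: u)) es (addrAC x (s *: u)) expr2 mulrA.
Qed.

Let second_difference_close (a b p q k d1 d2 e : R) :
  d1 = p * k -> d2 = q * k -> 0 < k -> d1 = d2 ->
  `|a - p| < e / 2 -> `|b - q| < e / 2 -> `|a - b| <= e.
Proof.
move=> -> -> k0 /(mulIf (lt0r_neq0 k0)) -> aq bq.
rewrite (le_trans (ler_distD q _ _))//.
by rewrite ltW// [ltRHS]splitr ltrD// distrC.
Qed.

Lemma derive_symmetric E (U : set E) (f : E -> R) (x u v : E) :
  open U -> Ck 2 U f -> U x -> 'D_u ('D_v f) x = 'D_v ('D_u f) x.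
Proof.
move=> oU C2 Ux; have [df Df] := C2.
apply/eqP; rewrite -subr_eq0 -normr_le0; apply/ler_addgt0Pr => e e0; rewrite add0r.
have e20 : 0 < e / 2 by lra.
have cont a b : \forall y \near x, U y /\
    `|'D_a ('D_b f) x - 'D_a ('D_b f) y| < e / 2.
  have /cvgrPdist_lt/(_ _ e20) : 'D_a ('D_b f) y @[y --> x] --> 'D_a ('D_b f) x.
    have := Ck_cont (Ck_derive a (Ck_derive b C2)) Ux; exact.
  have : \forall y \near x, U y by exact: open_nbhs_nbhs.
  by apply: filterS2 => y Uy.
have : \forall p \near (0 : R * R), forall a b,
   (a, b) = (u, v) \/ (a, b) = (v, u) ->
   U (x + p.1 *: a + p.2 *: b) /\
   `|'D_a ('D_b f) x - 'D_a ('D_b f) (x + p.1 *: a + p.2 *: b)| < e / 2.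
  have cl a b : (fun p : R * R => x + p.1 *: a + p.2 *: b) @ (0 : R * R) --> x.
    suff : (fun p : R * R => x + p.1 *: a + p.2 *: b) @ (0 : R * R) -->
      x + (0 : R) *: a + (0 : R) *: b by rewrite !scale0r !addr0.
    apply: cvgD; last first.
      by apply: cvgZr_tmp; exact: cvg_snd.
    apply: cvgD; first exact: cvg_cst.
    by apply: cvgZr_tmp; exact: cvg_fst.
  have n a b : \forall p \near (0 : R * R), U (x + p.1 *: a + p.2 *: b) /\
      `|'D_a ('D_b f) x - 'D_a ('D_b f) (x + p.1 *: a + p.2 *: b)| < e / 2.
    exact: (cl a b _ (cont a b)).
  have n1 := n u v; have n2 := n v u.
  by apply: filterS2 n1 n2 => p p1 p2 a b [] [-> ->].
move=> /nbhs_ballP[h0 /= h00 hb].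
pose h := h0 / 2; have hgt0 : 0 < h by rewrite /h; lra.
have good s t a b : 0 <= s <= h -> 0 <= t <= h ->
   (a, b) = (u, v) \/ (a, b) = (v, u) ->
   U (x + s *: a + t *: b) /\
   `|'D_a ('D_b f) x - 'D_a ('D_b f) (x + s *: a + t *: b)| < e / 2.
  move=> sh th ab; apply: (hb (s, t)) => //.
  by split; rewrite /ball/= sub0r normrN ger0_norm; rewrite /h in sh th; lra.
have diffs s t a b : 0 <= s <= h -> 0 <= t <= h ->
   (a, b) = (u, v) \/ (a, b) = (v, u) ->
   differentiable f (x + s *: a + t *: b) /\
   differentiable ('D_b f) (x + s *: a + t *: b).
  move=> sh th ab; have [Up _] := good s t a b sh th ab.
  by split; [exact: df|exact: (Ck_diff (Ck_derive b C2) Up)].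
have [s [t [sh th e1]]] := second_difference hgt0
  (fun s t sh th => diffs s t u v sh th (or_introl erefl)).
have [s' [t' [sh' th' e2]]] := second_difference hgt0
  (fun s t sh th => diffs s t v u sh th (or_intror erefl)).
have [_ g1] := good s t u v sh th (or_introl erefl).
have [_ g2] := good s' t' v u sh' th' (or_intror erefl).
have hx : x + h *: v + h *: u = x + h *: u + h *: v by rewrite addrAC.
rewrite hx in e2.
apply: (second_difference_close e1 e2 _ _ g1 g2); first by rewrite exprn_gt0.
by rewrite (addrAC (f (x + h *: u + h *: v))).
Qed.

End Lines.

(** * The Poincare lemma on a ball *)

Section Poincare.
Context {R : realType} {E : normedModType R}.
Variables (y0 : E) (r : R) (b : E -> E -> R).
Let B : set E := ball y0 r.
Hypothesis bD : forall v w t y, B y -> b (v + t *: w) y = b v y + t * b w y.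
Hypothesis bC : forall v, Ck 1 B (b v).
Hypothesis closed_b : forall v w y, B y -> 'D_w (b v) y = 'D_v (b w) y.

Let oB : open B. Proof. exact: ball_open. Qed.

Let ray_in y s : B y -> 0 <= s <= 1 -> B (y0 + s *: (y - y0)).
Proof.
rewrite /B -ball_normE /= => By /andP[s0 s1].
rewrite opprD addrA subrr sub0r normrN normrZ ger0_norm//.
by rewrite (le_lt_trans _ By)// distrC ler_piMl.
Qed.

(** b v y is the value at the point y of a 1-form b on the vector v; it is
    integrated along the segment from the centre y0 to y. *)
Definition radial_primitive (y : E) : R :=
  \int[lebesgue_measure]_(s in `[0, 1]) b (y - y0) (y0 + s *: (y - y0)).

(** Closedness turns the derivative of the integrand in the direction v into the
    derivative of s * b v (y0 + s w) in s, whose integral over [0, 1] is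
    b v (y0 + w). *)
Lemma radial_primitive_derive (y v : E) : B y ->
  is_derive y v radial_primitive (b v y).
Proof.
move=> By.
pose w := y - y0.
(* the integrand along y + t v *)
pose p (t s : R) := y0 + s *: (w + t *: v).
pose f (t s : R) := b (w + t *: v) (p t s).
(* the derivative of f in t; at t = 0, closedness makes it d/ds (s * b v (p 0 s)) *)
pose df (t s : R) := s * ('D_v (b w) (p t s) + t * 'D_v (b v) (p t s)) + b v (p t s).
have [d d0 Bd] : exists2 d : R, 0 < d & forall t, `|t| <= d -> B (y + t *: v).
  have : (fun t : R => y + t *: v) @ (0 : R) --> y.
    by have := @line_continuous _ _ y v 0; rewrite /continuous_at scale0r addr0.
  move=> /(_ B)[]; first exact: open_nbhs_nbhs.
  move=> e /= e0 Be; exists (e / 2); first by lra.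
  by move=> t td; apply: Be; rewrite /ball/= sub0r normrN; lra.
have Bp t s : `|t| <= d -> 0 <= s <= 1 -> B (p t s).
  by move=> /Bd Bt s01; have := ray_in Bt s01; rewrite addrAC.
have pE t s : p t s = (y0 + s *: w) + t *: (s *: v).
  by rewrite /p scalerDr addrA !scalerA (mulrC s).
have fE t s : `|t| <= d -> 0 <= s <= 1 ->
    f t s = b w (p t s) + t * b v (p t s).
  by move=> td s01; rewrite /f bD//; exact: Bp.
have diffb u q : B q -> differentiable (b u) q by exact: Ck_diff.
have ddf t s : `|t| < d -> 0 <= s <= 1 -> is_derive t (1 : R) (f ^~ s) (df t s).
  move=> td s01; have Bts := Bp t s (ltW td) s01.
  have db u : is_derive t (1 : R) (fun t => b u (p t s)) (s * 'D_v (b u) (p t s)).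
    rewrite (_ : (fun t => _) = fun t => b u (y0 + s *: w + t *: (s *: v))); last first.
      by apply/funext => t'; rewrite pE.
    rewrite -[s * _]/(s *: _) -deriveZv; last exact: diffb.
    by rewrite pE; apply: is_derive_line; rewrite -pE; exact: diffb.
  apply: (@near_eq_is_derive _ _ _ (fun t => b w (p t s) + t * b v (p t s))).
    near=> t'; rewrite fE//; apply/ltW; near: t'.
    apply: (cvgr_lt (`|t|)) => //; exact: norm_continuous.
  have [d1 d2] := is_deriveD (db w) (is_deriveM (is_derive_id t 1) (db v)).
  apply: DeriveDef; first exact: d1.
  by apply: etrans d2 _; rewrite /df /GRing.scale/= !mulr1; ring.
have cp : continuous (fun q : R * R => p q.1 q.2).
  move=> q; apply: cvgD; first exact: cvg_cst.
  apply: cvgZ; first exact: cvg_snd.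
  apply: cvgD; first exact: cvg_cst.
  by apply: cvgZr_tmp; exact: cvg_fst.
have cg (g : E -> R) t s : {for p t s, continuous g} ->
    {for (t, s), continuous (fun q : R * R => g (p q.1 q.2))}.
  by move=> gc; apply: (continuous_comp (cp _)).
have cb u t s : `|t| <= d -> 0 <= s <= 1 ->
    {for (t, s), continuous (fun q : R * R => b u (p q.1 q.2))}.
  by move=> td s01; apply: cg; apply: (Ck_cont (bC u)); exact: Bp.
have cDb u t s : `|t| <= d -> 0 <= s <= 1 ->
    {for (t, s), continuous (fun q : R * R => 'D_v (b u) (p q.1 q.2))}.
  move=> td s01; apply: (cg ('D_v (b u))).
  by apply: (Ck_cont (Ck_derive v (bC u))); exact: Bp.
have cdf t s : `|t| <= d -> 0 <= s <= 1 ->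
    {for (t, s), continuous (fun q : R * R => df q.1 q.2)}.
  move=> td s01; apply: cvgD; last exact: cb.
  apply: cvgM; first exact: cvg_snd.
  apply: cvgD; first exact: cDb.
  by apply: cvgM; [exact: cvg_fst|exact: cDb].
have cf t s : `|t| < d -> 0 <= s <= 1 -> {for s, continuous (f t)}.
  move=> td s01; apply: (continuous_comp _ (Ck_cont (bC _) _)).
    exact: line_continuous.
  by apply: Bp => //; exact: ltW.
pose K : set (R * R) := `[- d, d] `*` `[0, 1].
have inK q : K q -> `|q.1| <= d /\ 0 <= q.2 <= 1.
  by move=> [] /=; rewrite !in_itv/= -ler_norml.
have [M M0 HM] : exists2 M, 0 <= M & forall q, K q -> `|df q.1 q.2| <= M.
  have cK : compact K by apply: compact_setX; exact: segment_compact.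
  have [|q|c Kc Hc] := @compact_EVT_max _ _ (fun q : R * R => `|df q.1 q.2|) K _ cK.
  - by exists (0, 0); split; rewrite /= in_itv/= ?lexx ?ler01//; apply/andP; lra.
  - apply: continuous_in_subspaceT => {}q /set_mem/inK[q1 q2].
    by apply: cvg_norm; case: q q1 q2 => t s; exact: cdf.
  - by exists `|df c.1 c.2| => // q /mem_set Kq; exact: Hc.
have within01 (g : R -> R) : (forall s, 0 <= s <= 1 -> {for s, continuous g}) ->
    {within `[0, 1], continuous g}.
  move=> gc s; apply: continuous_in_subspaceT => {}s /set_mem/=; rewrite in_itv/=.
  exact: gc.
have d00 : `|0 : R| < d by rewrite normr0.
have indd t : t \in `]- d, d[ -> `|t| < d by rewrite in_itv/= -ltr_norml.
have der := @cvg_differentiation_under_integral R _ _ lebesgue_measure f `[0, 1]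
  (measurable_itv _) 0 (- d) d.
have {}der : is_derive (0 : R) (1 : R)
    (fun t => \int[lebesgue_measure]_(s in `[0, 1]) f t s)
    (\int[lebesgue_measure]_(s in `[0, 1]) df 0 s).
  have d1ind (t s : R) : t \in `]- d, d[ -> s \in `[0, 1] ->
      partial1of2 f t s = df t s.
    move=> /indd td; rewrite in_itv/= => s01; rewrite partial1of2E.
    by have [] := ddf t s td s01.
  have intg (g : R -> R) : {within `[0, 1], continuous g} ->
      lebesgue_measure.-integrable `[0, 1] (EFin \o g).
    by move=> gc; apply: continuous_compact_integrable => //; exact: segment_compact.
  have I0 : `]- d, d[%classic (0 : R) by rewrite /= in_itv/=; apply/andP; lra.
  have bnd (t s : R) : t \in `]- d, d[ -> s \in `[0, 1] ->
      `|partial1of2 f t s| <= M.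
    move=> td s01; rewrite d1ind//; apply: (HM (t, s)); split => //=.
    by move: td; rewrite !in_itv/= => /andP[/ltW-> /ltW->].
  have {}der := der I0 (fun t td => intg _ (within01 _ (fun s s01 => cf t s (indd t td) s01)))
    (fun t s td s01 => let: DeriveDef h _ := ddf t s (indd t td) s01 in h)
    (fun=> M) (fun=> M0) (intg _ (@cst_continuous _ _ M)) bnd.
  have {}der : h^-1 *: (((fun t => \int[lebesgue_measure]_(s in `[0, 1]) f t s) \o shift 0)
       (h *: (1 : R)) - \int[lebesgue_measure]_(s in `[0, 1]) f 0 s)
     @[h --> (0 : R)^'] --> \int[lebesgue_measure]_(s in `[0, 1]) df 0 s.
    have <- : \int[lebesgue_measure]_(s in `[0, 1]) partial1of2 f 0 s =
        \int[lebesgue_measure]_(s in `[0, 1]) df 0 s.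
      by apply: eq_Rintegral => s /set_mem s01; rewrite d1ind.
    apply: cvg_trans der; apply: near_eq_cvg; near=> h.
    by rewrite /= -[h *: (1 : R)]/(h * 1) mulr1.
  by apply: DeriveDef; [apply/cvg_ex; eexists; exact: der|exact: cvg_lim der].
apply: is_derive_dir.
rewrite (_ : (fun h => _) = (fun t => \int[lebesgue_measure]_(s in `[0, 1]) f t s)); last first.
  by apply/funext => t; rewrite /radial_primitive /f /p -addrA (addrC _ (- y0)) addrA.
rewrite (_ : b v y = \int[lebesgue_measure]_(s in `[0, 1]) df 0 s)//.
rewrite /Rintegral.
have p0 s : p 0 s = y0 + s *: w by rewrite /p scale0r addr0.
pose F s := s * b v (y0 + s *: w).
have dF (s : R) : 0 <= s <= 1 -> is_derive s (1 : R) F (df 0 s).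
  move=> s01; have Bs := Bp 0 s (ltW d00) s01.
  have db : is_derive s (1 : R) (fun s => b v (y0 + s *: w)) ('D_w (b v) (p 0 s)).
    by rewrite p0; apply: is_derive_line; rewrite -p0; exact: diffb.
  have [d1 d2] := is_deriveM (is_derive_id s 1) db.
  apply: DeriveDef; first exact: d1.
  apply: etrans d2 _; rewrite /df /GRing.scale/= closed_b// p0; ring.
have cF (s : R) : 0 <= s <= 1 -> {for s, continuous F}.
  move=> /dF[dFs _]; exact/differentiable_continuous/derivable1_diffP.
rewrite (@continuous_FTC2 _ (df 0) F 0 1)//=.
- by rewrite /F mul1r mul0r subr0 scale1r /w subrKC.
- apply: within01 => s s01; have := cdf 0 s (ltW d00) s01.
  move=> /(@continuous_comp _ _ _ (fun s => (0, s))); apply.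
  exact: cvg_pair (cvg_cst _) cvg_id.
- split.
  + move=> s; rewrite in_itv/= => /andP[/ltW s0 /ltW s1].
    by have [] := dF s _; rewrite ?s0 ?s1.
  + by apply: cvg_at_right_filter; apply: cF; rewrite lexx ler01.
  + by apply: cvg_at_left_filter; apply: cF; rewrite lexx ler01.
- move=> s; rewrite in_itv/= => /andP[/ltW s0 /ltW s1].
  by rewrite derive1E; have [] := dF s _; rewrite ?s0 ?s1.
Unshelve. all: by end_near. Qed.

End Poincare.

Section PoincareCoordinates.
Context {R : realType} {d : nat}.
Let V := 'rV[R]_d.

Lemma rV_coord_le (h : V) k : `|h ord0 k| <= `|h|.
Proof.
by rewrite [leRHS]/Num.Def.normr/= mx_normrE (le_trans _ (le_bigmax _ _ (ord0, k))).
Qed.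

Lemma coord_form_continuous (c : 'I_d -> R) :
  continuous (fun v : V => \sum_k v ord0 k * c k).
Proof.
apply: continuous_big => [|k _ v]; first exact: add_continuous.
apply: (@continuousM _ _ (fun v : V => v ord0 k) (cst (c k))).
  exact: coord_continuous.
exact: cst_continuous.
Qed.

(** By the mean value theorem the increment of g is b h at an intermediate point,
    which is close to b h y uniformly in the direction of h. *)
Lemma differentiable_of_derive (U : set V) (g : V -> R) (b : V -> V -> R) :
  open U -> (forall v y, U y -> is_derive y v g (b v y)) ->
  (forall v y, U y -> b v y = \sum_k v ord0 k * b (delta_mx ord0 k) y) ->
  (forall v y, U y -> {for y, continuous (b v)}) ->
  forall y, U y -> differentiable g y.
Proof.
move=> oU dg bE cb y Uy.
pose c k := b (delta_mx ord0 k) y.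
pose L (v : V) := \sum_k v ord0 k * c k.
have linL : linear L.
  move=> a u w; rewrite /L scaler_sumr -big_split/=; apply: eq_bigr => k _.
  by rewrite !mxE mulrDl /GRing.scale/= mulrA.
pose LM := GRing.isLinear.Build _ _ _ _ _ linL.
pose LL : {linear V -> R} := HB.pack L LM.
apply: (@differentiable_approx _ _ _ _ _ LL); first exact: coord_form_continuous.
apply/eqaddoP => e e0.
pose e' := e / d.+1%:R.
have e'0 : 0 < e' by rewrite divr_gt0.
have nearU : \forall z \near y, U z /\
    forall k, `|c k - b (delta_mx ord0 k) z| < e'.
  have nk k : \forall z \near y, `|c k - b (delta_mx ord0 k) z| < e'.
    by have /cvgrPdist_lt/(_ _ e'0) := cb (delta_mx ord0 k) _ Uy.
  have /filter_forall nk' := nk.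
  have Un : \forall z \near y, U z by exact: open_nbhs_nbhs.
  by apply: filterS2 Un nk'.
have /nbhs_ballP[r /= r0 Br] := nearU.
have near0r : \forall h \near (0 : V), `|h| < r by exact: nbhs0_lt.
apply: filterS near0r => h hr.
have inB (t : R) : 0 <= t <= 1 -> U (y + t *: h) /\
    forall k, `|c k - b (delta_mx ord0 k) (y + t *: h)| < e'.
  move=> /andP[t0 t1]; apply: Br; rewrite -ball_normE/= opprD addrA subrr sub0r normrN.
  by rewrite normrZ ger0_norm// (le_lt_trans _ hr)// ler_piMl.
have [t t01] := @MVT_closed _ (fun t => g (y + t *: h)) (fun t => b h (y + t *: h))
  0 1 ltr01 (fun t t01 => is_derive_along (dg h _ (inB t t01).1)).
rewrite scale1r scale0r addr0 subr0 mulr1 => gE.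
have -> : (g \o +%R^~ y - (cst (g y) + L)) h = b h (y + t *: h) - L h.
  by rewrite -gE (addrC y h) -addrA -opprD.
have [Ut Bt] := inB t t01; rewrite bE// /L -sumrB.
rewrite (le_trans (ler_norm_sum _ _ _))//.
rewrite (@le_trans _ _ (\sum_(k < d) e' * `|h|))//.
  apply: ler_sum => k _; rewrite -mulrBr normrM mulrC ler_pM//.
    by rewrite distrC ltW// Bt.
  exact: rV_coord_le.
rewrite sumr_const card_ord -mulr_natr mulrAC ler_wpM2r// /e' -mulrA ler_piMr ?ltW//.
by rewrite mulrC ltr_pdivrMr// mul1r ltr_nat.
Qed.

End PoincareCoordinates.

(** * Angles modulo 2 pi *)

Section AnglesModulo2pi.
Context {R : realType}.
Implicit Types x y z : R.

Lemma eqmod2pi0P x y : eqmod2pi (x - y) 0 <-> eqmod2pi x y.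
Proof. by split=> -[k]; rewrite ?subr0 => e; exists k; rewrite ?subr0. Qed.

Lemma eqmod2pi_refl x : eqmod2pi x x.
Proof. by exists 0; rewrite subrr mul0r. Qed.

Lemma eqmod2piD x y x' y' :
  eqmod2pi x y -> eqmod2pi x' y' -> eqmod2pi (x + x') (y + y').
Proof.
by move=> [k e] [k' e']; exists (k + k'); rewrite intrD mulrDl -e -e' opprD addrACA.
Qed.

Lemma eqmod2piN x y : eqmod2pi x y -> eqmod2pi (- x) (- y).
Proof. by move=> [k e]; exists (- k); rewrite -opprD e mulrNz mulNr. Qed.

Lemma eqmod2pi_mulz (m : int) x : eqmod2pi x 0 -> eqmod2pi (m%:~R * x) 0.
Proof. by move=> [k]; rewrite subr0 => ->; exists (m * k); rewrite subr0 intrM mulrA. Qed.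

End AnglesModulo2pi.

(** * Paths and singular triangles as maps defined everywhere *)

Section Clamp.
Context {R : realType}.

(** Composing with a retraction of R onto [0, 1] turns continuity within [0, 1]
    into continuity. *)
Definition clamp (t : R) : R := Num.max 0 (Num.min t 1).

Lemma clamp_itv t : 0 <= clamp t <= 1.
Proof. by rewrite /clamp le_max lexx ge_max ler01 ge_min lexx orbT. Qed.

Lemma clamp_id t : 0 <= t <= 1 -> clamp t = t.
Proof. by move=> /andP[t0 t1]; rewrite /clamp (min_idPl t1) (max_idPr t0). Qed.

Lemma clamp_continuous : continuous clamp.
Proof.
move=> t.
have h1 : {for t, continuous (id \min cst 1 : R -> R^o)}.
  by apply: (@continuous_min R R id (cst 1)); [exact: cvg_id|exact: cst_continuous].
exact: (@continuous_max R R (cst 0) _ t (@cst_continuous _ _ _ t) h1).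
Qed.

Lemma pair_continuous (T S U : topologicalType) (f : T -> S) (g : T -> U) t :
  {for t, continuous f} -> {for t, continuous g} ->
  {for t, continuous (fun u => (f u, g u))}.
Proof. by move=> cf cg; exact: cvg_pair cf cg. Qed.

Lemma within_retract (T S X : topologicalType) (K : set S) (r : T -> S) (s : S -> X) :
  (forall t, K (r t)) -> continuous r -> {within K, continuous s} ->
  continuous (s \o r).
Proof.
move=> Kr cr /subspace_continuousP cs t A nA.
have sA : \forall u \near r t, K u -> A (s u) := cs _ (Kr t) A nA.
have : \forall u \near t, K (r u) -> A (s (r u)) := cr t _ sA.
by apply: filterS => u; apply; exact: Kr.
Qed.

Lemma within_clamp (X : topologicalType) (s : R -> X) :
  {within [set` `[0 : R, 1]], continuous s} -> continuous (s \o clamp).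
Proof.
apply: within_retract; last exact: clamp_continuous.
by move=> u; rewrite /= in_itv/=; exact: clamp_itv.
Qed.

(** A retraction of the plane onto the standard triangle. *)
Definition clamp2 (q : R * R) : R * R :=
  (clamp q.1, Num.min (clamp q.2) (1 - clamp q.1)).

Lemma clamp2_simplex q : simplex2 (clamp2 q).
Proof.
rewrite /simplex2/=; have /andP[a0 a1] := clamp_itv q.1; have /andP[b0 b1] := clamp_itv q.2.
split=> //; first by rewrite le_min b0 subr_ge0.
by rewrite addrC -lerBrDr ge_min lexx orbT.
Qed.

Lemma clamp2_id q : simplex2 q -> clamp2 q = q.
Proof.
case: q => s t [/= s0 t0 st]; rewrite /clamp2/= !clamp_id; last 2 first.
- by apply/andP; split=> //; lra.
- by apply/andP; split=> //; lra.
by congr pair; apply/min_idPl; lra.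
Qed.

Lemma clamp2_continuous : continuous clamp2.
Proof.
have c1 (q : R * R) : {for q, continuous (fun q : R * R => clamp q.1)}.
  by apply: continuous_comp; [exact: cvg_fst|exact: clamp_continuous].
have c2 (q : R * R) : {for q, continuous (fun q : R * R => clamp q.2)}.
  by apply: continuous_comp; [exact: cvg_snd|exact: clamp_continuous].
move=> q; apply: (@pair_continuous _ _ _ (fun q : R * R => clamp q.1)
  (fun q : R * R => Num.min (clamp q.2) (1 - clamp q.1))); first exact: c1.
apply: (@continuous_min _ _ (fun q : R * R => clamp q.2) (fun q : R * R => 1 - clamp q.1)).
  exact: c2.
by apply: cvgB; [exact: cvg_cst|exact: c1].
Qed.

Lemma within_clamp2 (X : topologicalType) (s : R * R -> X) :
  {within simplex2, continuous s} -> continuous (s \o clamp2).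
Proof. exact: within_retract clamp2_simplex clamp2_continuous. Qed.

End Clamp.

(** * Holonomy of flat circle bundles *)

(** A flat connection on a circle bundle, seen through its horizontal sections.
    The total space is P, with over x p saying that p is in the fibre of x and
    act t rotating the fibres by the angle t; hor x l says that l is a horizontal
    section near x.  Only the germ of l at x matters. *)
Section Monodromy.
Context {R : realType} {X : topologicalType} {P : Type}.
Variables (act : R -> P -> P) (over : X -> P -> Prop) (hor : X -> (X -> P) -> Prop).
Hypothesis actD : forall s t p, act s (act t p) = act (s + t) p.
Hypothesis act_fix : forall x t p, over x p -> act t p = p <-> eqmod2pi t 0.
Hypothesis over_act : forall x t p, over x p -> over x (act t p).
Hypothesis over_trans : forall x p q, over x p -> over x q -> exists t, q = act t p.
Hypothesis hor_over : forall x l, hor x l -> \forall y \near x, over y (l y).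
Hypothesis hor_near : forall x l, hor x l -> \forall y \near x, hor y l.
Hypothesis hor_act : forall x l c, hor x l -> hor x (act c \o l).
Hypothesis hor_unique : forall x l l', hor x l -> hor x l' ->
  exists c, \forall y \near x, l' y = act c (l y).
Hypothesis hor_ex : forall x, exists l, hor x l.

Let act_eq x p s t : over x p -> eqmod2pi s t -> act s p = act t p.
Proof.
move=> xp /eqmod2pi0P st; rewrite -[in LHS](subrK t s) -actD.
by apply/(act_fix (x := x)) => //; exact: over_act.
Qed.

Let act_inj x p s t : over x p -> act s p = act t p -> eqmod2pi s t.
Proof.
move=> xp; rewrite -[in LHS](subrK t s) -actD => /(act_fix (x := x)) => H.
by apply/eqmod2pi0P/H; exact: over_act.
Qed.

(** Near q the map p follows one horizontal section along s.  The parameter space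
    T is arbitrary because paths, squares and triangles are all lifted. *)
Definition lift_at (T : topologicalType) (s : T -> X) (p : T -> P) (q : T) : Prop :=
  exists2 l, hor (s q) l & \forall u \near q, p u = l (s u).

Lemma lift_over (T : topologicalType) (s : T -> X) p q :
  lift_at s p q -> over (s q) (p q).
Proof.
by move=> [l hl pl]; rewrite (nbhs_singleton pl); have := nbhs_singleton (hor_over hl).
Qed.

Lemma lift_at_act (T : topologicalType) (s : T -> X) p q c :
  lift_at s p q -> lift_at s (act c \o p) q.
Proof.
move=> [l hl pl]; exists (act c \o l); first exact: hor_act.
by apply: filterS pl => u /= ->.
Qed.

Lemma lift_at_comp (S T : topologicalType) (g : S -> T) (s : T -> X) p (q : S) :
  {for q, continuous g} -> lift_at s p (g q) -> lift_at (s \o g) (p \o g) q.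
Proof. by move=> cg [l hl pl]; exists l => //; exact: (cg _ pl). Qed.

Lemma lift_at_hor (T : topologicalType) (s : T -> X) l q :
  hor (s q) l -> lift_at s (l \o s) q.
Proof. by move=> hl; exists l => //; exact: nearW. Qed.

(** The phase relating two lifts is locally constant, and a phase fixing one point
    fixes all of them. *)
Lemma lift_eq_local (T : topologicalType) (s : T -> X) p p' q :
  {for q, continuous s} -> lift_at s p q -> lift_at s p' q ->
  \forall u \near q, p' u = p u <-> p' q = p q.
Proof.
move=> cs [l hl pl] [l' hl' pl'].
have [c lc] := hor_unique hl hl'.
have cE : forall u, p u = l (s u) -> p' u = l' (s u) -> l' (s u) = act c (l (s u)) ->
    over (s u) (l (s u)) -> p' u = p u <-> eqmod2pi c 0.
  by move=> u -> -> -> ov; exact: act_fix ov.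
have near_all : \forall u \near q, p' u = p u <-> eqmod2pi c 0.
  have n1 : \forall u \near q, l' (s u) = act c (l (s u)) := cs _ lc.
  have n2 : \forall u \near q, over (s u) (l (s u)) := cs _ (hor_over hl).
  by apply: filterS2 (filterI pl pl') (filterI n1 n2) => u [a b] [d e]; exact: cE.
have q_all := nbhs_singleton near_all.
by apply: filterS near_all => u ->; split=> /q_all.
Qed.

Lemma lift_eq_path (T : topologicalType) (s : T -> X) p p' (g : R -> T) (a b : R) :
  a <= b -> continuous g ->
  (forall u, a <= u <= b -> [/\ {for g u, continuous s}, lift_at s p (g u) &
     lift_at s p' (g u)]) ->
  p' (g a) = p (g a) <-> p' (g b) = p (g b).
Proof.
move=> ab cg gl.
apply: (@interval_induction _ (fun c d => p' (g c) = p (g c) <-> p' (g d) = p (g d))) => //.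
  by move=> x y z _ _ _ _ ->.
move=> x /gl[cs lp lp'].
have : \forall u \near x, p' (g u) = p (g u) <-> p' (g x) = p (g x).
  exact: (cg x _ (lift_eq_local cs lp lp')).
move=> /nbhs_ballP[e /= e0 Be]; exists e => // c d _ cd _ xc dx.
have [Bc Bd] : ball x e c /\ ball x e d.
  by split; rewrite /ball/= ltr_distl; apply/andP; lra.
by rewrite (Be _ Bc) (Be _ Bd).
Qed.

(** Gluing along the level set h = c needs lifts that agree there: by
    [lift_eq_local] they then agree on both sides. *)
Lemma lift_glue (T : topologicalType) (s : T -> X) (h : T -> R) (c : R)
    (K K' : set T) p p' : continuous s -> continuous h ->
  (forall q, K q -> h q <= c /\ lift_at s p q) ->
  (forall q, K' q -> c <= h q /\ lift_at s p' q) ->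
  (forall q, K q \/ K' q -> h q = c -> [/\ lift_at s p q, lift_at s p' q & p' q = p q]) ->
  forall q, K q \/ K' q -> lift_at s (fun q => if h q <= c then p q else p' q) q.
Proof.
move=> cs ch Kl Kl' Kc q Kq.
have [hq|hq|hq] := ltgtP (h q) c.
- have [l hl pl] : lift_at s p q.
    by case: Kq => [/Kl[]//|/Kl'[]]; rewrite leNgt hq.
  exists l => //.
  have : \forall u \near q, h u < c by apply: (cvgr_lt (h q)) => //; exact: ch.
  by apply: filterS2 pl => u -> /ltW ->.
- have [l hl pl] : lift_at s p' q.
    by case: Kq => [/Kl[]|/Kl'[]//]; rewrite leNgt hq.
  exists l => //.
  have : \forall u \near q, c < h u by apply: (cvgr_gt (h q)) => //; exact: ch.
  by apply: filterS2 pl => u -> hu; rewrite leNgt hu.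
- have [lp lp' pp] := Kc q Kq hq.
  have n := lift_eq_local (cs _) lp lp'.
  case: lp => l hl pl; exists l => //.
  by apply: filterS2 pl n => u pu [_ /(_ pp) ->]; rewrite pu if_same.
Qed.

Section SquareLift.
Variable s : R * R -> X.
Hypothesis cs : continuous s.

Let fst_line (u : R) : continuous (fun t : R => (t, u)).
Proof. by move=> t; apply: pair_continuous; [exact: cvg_id|exact: cst_continuous]. Qed.

Let snd_line (u : R) : continuous (fun t : R => (u, t)).
Proof. by move=> t; apply: pair_continuous; [exact: cst_continuous|exact: cvg_id]. Qed.

Let fst_cont : continuous (fun q : R * R => q.1).
Proof. by move=> q; exact: cvg_fst. Qed.

Let snd_cont : continuous (fun q : R * R => q.2).
Proof. by move=> q; exact: cvg_snd. Qed.

(** Lifts over a thin strip around the line q.1 = x0: two lifts over strips above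
    each other agree on the common segment once they agree at one point of it. *)
Let strip_lift (x0 : R) : exists2 e : R, 0 < e & exists p, forall q : R * R,
  `|q.1 - x0| <= e -> 0 <= q.2 <= 1 -> lift_at s p q.
Proof.
apply: (@interval_induction _ (fun c d => exists2 e : R, 0 < e & exists p, forall q : R * R,
  `|q.1 - x0| <= e -> c <= q.2 <= d -> lift_at s p q) 0 1) => //.
- move=> c y d _ cy yd _ [e1 e10 [p1 l1]] [e2 e20 [p2 l2]].
  pose e := Num.min e1 e2.
  have [ee1 ee2] : e <= e1 /\ e <= e2 by rewrite /e !ge_min !lexx orbT.
  exists e; first by rewrite /e lt_min e10.
  have near0 (g : R) : 0 < g -> `|x0 - x0| <= g by rewrite subrr normr0 => /ltW.
  have l1y : lift_at s p1 (x0, y) by apply: l1 => /=; [exact: near0|rewrite cy lexx].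
  have l2y : lift_at s p2 (x0, y) by apply: l2 => /=; [exact: near0|rewrite yd lexx].
  have [t tE] := over_trans (lift_over l2y) (lift_over l1y).
  pose p2' := act t \o p2.
  have L1 u : `|u - x0| <= e -> lift_at s p1 (u, y).
    by move=> ue; apply: l1 => /=; [exact: le_trans ee1|rewrite cy lexx].
  have L2 u : `|u - x0| <= e -> lift_at s p2' (u, y).
    by move=> ue; apply/lift_at_act/l2 => /=; [exact: le_trans ee2|rewrite yd lexx].
  exists (fun q => if q.2 <= y then p1 q else p2' q) => q qe qcd.
  pose K := [set q : R * R | `|q.1 - x0| <= e /\ c <= q.2 <= y].
  pose K' := [set q : R * R | `|q.1 - x0| <= e /\ y <= q.2 <= d].
  apply: (@lift_glue _ s (fun q => q.2) y K K') => //.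
  + by move=> {qe qcd}q [qe /andP[cq qy]]; split=> //; apply: l1; rewrite ?cq ?(le_trans qe).
  + move=> {qe qcd}q [qe /andP[yq qd]]; split=> //.
    by apply/lift_at_act/l2; rewrite ?yq ?(le_trans qe).
  + move=> [u v] /= Kuv vy; rewrite {v}vy in Kuv *.
    have ue : `|u - x0| <= e by case: Kuv => -[].
    split; [exact: L1|exact: L2|].
    have eq0 : p2' (x0, y) = p1 (x0, y) by rewrite tE.
    have go (a b : R) : a <= b -> (forall w, a <= w <= b -> `|w - x0| <= e) ->
        p2' (a, y) = p1 (a, y) <-> p2' (b, y) = p1 (b, y).
      move=> ab abe; apply: (@lift_eq_path _ s p1 p2' (fun t => (t, y)) a b ab) => //.
      by move=> w wab; split; [exact: cs|apply/L1/abe|apply/L2/abe].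
    move: ue; rewrite ler_distl => /andP[ue1 ue2].
    have [ux|xu] := leP u x0.
      by apply/(go u x0 ux) => // w /andP[w1 w2]; rewrite ler_distl; apply/andP; lra.
    apply/(go x0 u (ltW xu)) => // w /andP[w1 w2]; rewrite ler_distl; apply/andP; lra.
  + move: qcd => /andP[cq qd]; have [qy|yq] := leP q.2 y; first by left; rewrite /K/= cq.
    by right; split; rewrite // ltW.
- move=> y _; have [l hl] := hor_ex (s (x0, y)).
  have : \forall q \near (x0, y), hor (s q) l := @cs (x0, y) _ (hor_near hl).
  move=> /nbhs_ballP[e /= e0 Be]; exists (e / 2); first by lra.
  move=> c d _ _ _ yc dy; exists (e / 2); first by lra.
  exists (l \o s) => q qx /andP[cq qd]; apply: lift_at_hor; apply: Be.
  by move: qx; rewrite ler_distl => /andP[q1 q2]; split; rewrite /ball/= ltr_distl;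
    apply/andP; lra.
Qed.

Lemma square_lift : exists p, forall q : R * R,
  0 <= q.1 <= 1 -> 0 <= q.2 <= 1 -> lift_at s p q.
Proof.
apply: (@interval_induction _ (fun c d => exists p, forall q : R * R,
  c <= q.1 <= d -> 0 <= q.2 <= 1 -> lift_at s p q) 0 1) => //.
- move=> c y d _ cy yd _ [p1 l1] [p2 l2].
  have L1 u : 0 <= u <= 1 -> lift_at s p1 (y, u).
    by move=> ue; apply: l1 => //=; rewrite cy lexx.
  have l2y : lift_at s p2 (y, 0) by apply: l2; rewrite /= ?lexx ?yd ?ler01.
  have [|t tE] := over_trans (lift_over l2y) (lift_over (L1 0 _)).
    by rewrite lexx ler01.
  pose p2' := act t \o p2.
  have L2 u : 0 <= u <= 1 -> lift_at s p2' (y, u).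
    by move=> ue; apply/lift_at_act/l2 => //=; rewrite yd lexx.
  exists (fun q => if q.1 <= y then p1 q else p2' q) => q qcd q01.
  pose K := [set q : R * R | c <= q.1 <= y /\ 0 <= q.2 <= 1].
  pose K' := [set q : R * R | y <= q.1 <= d /\ 0 <= q.2 <= 1].
  apply: (@lift_glue _ s (fun q => q.1) y K K') => //.
  + by move=> {q01 qcd}q [/andP[cq qy] qe]; split=> //; apply: l1; rewrite ?cq.
  + by move=> {q01 qcd}q [/andP[yq qd] qe]; split=> //; apply/lift_at_act/l2; rewrite ?yq.
  + move=> [u v] /= Kuv uy; rewrite {u}uy in Kuv *.
    have ve : 0 <= v <= 1 by case: Kuv => -[].
    split; [exact: L1|exact: L2|].
    have /andP[v0 v1] := ve.
    apply/(@lift_eq_path _ s p1 p2' (fun t => (y, t)) 0 v v0) => //.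
    move=> w /andP[w0 wv]; have w01 : 0 <= w <= 1 by rewrite w0 (le_trans wv).
    by split; [exact: cs|exact: L1|exact: L2].
  + move: qcd => /andP[cq qd]; have [qy|yq] := leP q.1 y; first by left; rewrite /K/= cq.
    by right; rewrite /K'/= ltW.
- move=> y _; have [e e0 [p pl]] := strip_lift y.
  exists e => // c d _ _ _ yc dy; exists p => q /andP[cq qd] q01; apply: pl => //.
  by rewrite ler_distl; apply/andP; lra.
Qed.

End SquareLift.

Section Holonomy.

Let itv01 (u : R) : [set` `[0 : R, 1]] (clamp u).
Proof. by rewrite /= in_itv/=; exact: clamp_itv. Qed.

Let z01 : 0 <= (0 : R) <= 1. Proof. by rewrite lexx ler01. Qed.
Let o01 : 0 <= (1 : R) <= 1. Proof. by rewrite lexx ler01. Qed.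

(** A path is lifted as a map of the square that depends only on the first
    coordinate. *)
Lemma path_lift (s : R -> X) : continuous s ->
  exists p, forall u, 0 <= u <= 1 -> lift_at s p u.
Proof.
move=> cs; have [|p pl] := @square_lift (s \o fst).
  by move=> q; apply: continuous_comp; [exact: cvg_fst|exact: cs].
exists (fun u => p (u, 0)) => u u01.
have cu : {for u, continuous (fun u : R => (u, 0 : R))}.
  by apply: pair_continuous; [exact: cvg_id|exact: cst_continuous].
exact: (@lift_at_comp _ _ (fun u => (u, 0)) (s \o fst) p u cu (pl (u, 0) u01 z01)).
Qed.

Lemma path_lift_act (s : R -> X) p p' (t : R) : continuous s ->
  (forall u, 0 <= u <= 1 -> lift_at s p u) ->
  (forall u, 0 <= u <= 1 -> lift_at s p' u) ->
  p' 0 = act t (p 0) -> p' 1 = act t (p 1).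
Proof.
move=> cs lp lp'.
have := @lift_eq_path _ s (act t \o p) p' id 0 1 ler01 (fun=> cvg_id).
move=> [|+ _]; last exact.
by move=> u u01; split; [exact: cs|exact/lift_at_act/lp|exact: lp'].
Qed.

Lemma over_ex x : exists p, over x p.
Proof. by have [l hl] := hor_ex x; exists (l x); have := nbhs_singleton (hor_over hl). Qed.

(** An arbitrary point in each fibre, with respect to which angles are measured. *)
Definition ref (x : X) : P := sval (cid (over_ex x)).

Lemma over_ref x : over x (ref x).
Proof. exact: svalP (cid (over_ex x)). Qed.

Definition is_hol (s : R -> X) (t : R) : Prop := exists p,
  [/\ forall u, 0 <= u <= 1 -> lift_at s p u, p 0 = ref (s 0) & p 1 = act t (ref (s 1))].

(** The angle by which transport along s turns [ref (s 0)] into [ref (s 1)]; only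
    its class modulo 2 pi is determined by s. *)
Definition hol (s : R -> X) : R := xget 0 [set t | is_hol (s \o clamp) t].

Lemma hol_ext (s s' : R -> X) : {in `[0 : R, 1], s =1 s'} -> hol s = hol s'.
Proof.
move=> ss; rewrite /hol; suff -> : s \o clamp = s' \o clamp by [].
by apply/funext => u; apply: ss; exact: itv01.
Qed.

Lemma holP (s : R -> X) : continuous (s \o clamp) -> is_hol (s \o clamp) (hol s).
Proof.
move=> cs; suff [t ht] : exists t, is_hol (s \o clamp) t by exact: (xgetI 0 ht).
have [p lp] := path_lift cs.
have [t0 p0] := over_trans (lift_over (lp 0 z01)) (over_ref _).
have [t1 p1] := over_trans (over_ref _) (lift_over (lp 1 o01)).
exists (t0 + t1), (act t0 \o p); split=> [u u01||]; first exact/lift_at_act/lp.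
  exact: esym.
by rewrite /= p1 actD.
Qed.

Lemma hol_lift (s : R -> X) p (a b : R) : continuous (s \o clamp) ->
  (forall u, 0 <= u <= 1 -> lift_at (s \o clamp) p u) ->
  p 0 = act a (ref (s 0)) -> p 1 = act b (ref (s 1)) -> eqmod2pi (hol s) (b - a).
Proof.
move=> cs lp p0 p1; have [q [lq q0 q1]] := holP cs.
rewrite /= !clamp_id// in q0 q1.
have := @path_lift_act _ q p a cs lq lp.
rewrite q0 q1 p1 actD => /(_ p0) /(act_inj (over_ref _)) [k e].
by exists (- k); rewrite mulrNz mulNr -e; ring.
Qed.

Definition Hol (c : @chain1 R X) : R := \sum_(p <- c) p.1%:~R * hol p.2.

(** A chain is a list in which a simplex may occur several times, while homology
    only sees total multiplicities.  As hol is a function of the restriction of the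
    simplex to [0, 1], the terms with the same simplex can be collected; this gives
    an equality of real numbers, and not only modulo 2 pi. *)
Lemma Hol_zero c : (forall s, multiplicity1 c s = 0) -> Hol c = 0.
Proof.
have [k ck] := ubnP (size c); elim: k c ck => // k IH [|p0 c] ck m0; first by rewrite /Hol big_nil.
pose Q (p : int * (R -> X)) := `[< {in `[0 : R, 1], p.2 =1 p0.2} >].
rewrite /Hol (bigID Q)/=.
rewrite (eq_bigr (fun p : int * (R -> X) => p.1%:~R * hol p0.2)); last first.
  by move=> p /asboolP pp; rewrite (hol_ext pp).
rewrite -mulr_suml.
have -> : \sum_(p <- p0 :: c | Q p) p.1%:~R = (multiplicity1 (p0 :: c) p0.2)%:~R :> R.
  by rewrite /multiplicity1 -(big_morph _ (@intrD R) (erefl : 0%:~R = 0 :> R)).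
rewrite m0 mul0r add0r -big_filter; apply: IH.
  have Q0 : Q p0 by apply/asboolP.
  by rewrite size_filter/= Q0 add0n (leq_ltn_trans (count_size _ _)).
move=> s; rewrite /multiplicity1 big_filter_cond.
have [p0s|np0s] := asboolP {in `[0 : R, 1], p0.2 =1 s}.
  apply: big1 => p /andP[/asboolP nQ /asboolP ps]; case: nQ => u u01.
  by rewrite ps// p0s.
rewrite -[RHS](m0 s) /multiplicity1; apply: eq_bigl => p.
rewrite andbC; case: asboolP => //= ps; apply/asboolP => pp; apply: np0s => u u01.
by rewrite -pp// ps.
Qed.

Lemma Hol_cat c c' : Hol (c ++ c') = Hol c + Hol c'.
Proof. by rewrite /Hol big_cat. Qed.

Lemma Hol_cons p c : Hol (p :: c) = p.1%:~R * hol p.2 + Hol c.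
Proof. by rewrite /Hol big_cons. Qed.

Lemma Hol1 s : Hol [:: (1, s)] = hol s.
Proof. by rewrite /Hol big_seq1 mul1r. Qed.

Definition opp_chain (c : @chain1 R X) : chain1 := [seq (- p.1, p.2) | p <- c].

Lemma Hol_opp c : Hol (opp_chain c) = - Hol c.
Proof.
by rewrite /Hol big_map -sumrN; apply: eq_bigr => p _ /=; rewrite mulrNz mulNr.
Qed.

Lemma Hol_multiplicity c c' c'' :
  (forall s, multiplicity1 c s - multiplicity1 c' s = multiplicity1 c'' s) ->
  Hol c - Hol c' = Hol c''.
Proof.
move=> m; have : Hol (c ++ opp_chain (c' ++ c'')) = 0.
  apply: Hol_zero => s; rewrite /multiplicity1 big_cat big_map/= sumrN big_cat/=.
  by have := m s; rewrite /multiplicity1 => <-; ring.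
by rewrite Hol_cat Hol_opp Hol_cat opprD addrA => /eqP; rewrite subr_eq0 => /eqP.
Qed.

(** A horizontal lift of the whole triangle gives each vertex an angle, and the
    holonomy of an edge is the difference of the angles at its ends. *)
Lemma hol_triangle (s : R * R -> X) : {within simplex2, continuous s} ->
  eqmod2pi (hol (fun t => s (1 - t, t)) - hol (fun t => s (0, t)) + hol (fun t => s (t, 0))) 0.
Proof.
move=> /within_clamp2 cs; have [p lp] := square_lift cs.
have edge (g : R -> R * R) : continuous g ->
    (forall u, 0 <= u <= 1 -> simplex2 (g u)) -> forall a b,
    p (g 0) = act a (ref (s (g 0))) -> p (g 1) = act b (ref (s (g 1))) ->
    eqmod2pi (hol (s \o g)) (b - a).
  move=> cg g2 a b ga gb.
  have sgc : s \o clamp2 \o (g \o clamp) = s \o g \o clamp.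
    by apply/funext => u /=; rewrite clamp2_id//; exact/g2/clamp_itv.
  have cgc : continuous (g \o clamp).
    by move=> u; apply: continuous_comp; [exact: clamp_continuous|exact: cg].
  apply: (@hol_lift _ (p \o g \o clamp)).
  - rewrite -sgc => u; apply: continuous_comp; [exact: cgc|exact: cs].
  - move=> u _; rewrite -sgc; apply: lift_at_comp; first exact: cgc.
    have [g0 g1 g01] := g2 _ (clamp_itv u).
    by apply: lp; apply/andP; split; rewrite //=; lra.
  - by rewrite /= clamp_id.
  - by rewrite /= clamp_id.
have vertex u v : simplex2 (u, v) -> exists a, p (u, v) = act a (ref (s (u, v))).
  move=> uv; apply: over_trans; first exact: over_ref.
  rewrite -[X in s X](clamp2_id uv); have [/= u0 v0 uv1] := uv.
  by apply: (@lift_over _ (s \o clamp2)); apply: lp; apply/andP; rewrite /=; lra.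
have [|a0 e0] := vertex 0 0; first by split; rewrite /= ?addr0.
have [|a1 e1] := vertex 1 0; first by split; rewrite /= ?addr0.
have [|a2 e2] := vertex 0 1; first by split; rewrite /= ?add0r.
have h1 : eqmod2pi (hol (fun t => s (1 - t, t))) (a2 - a1).
  apply: (edge (fun t => (1 - t, t))); rewrite ?subr0 ?subrr//.
    move=> u; apply: (@pair_continuous _ _ _ (fun t : R => 1 - t) id); last exact: cvg_id.
    by apply: cvgB; [exact: cvg_cst|exact: cvg_id].
  by move=> u /andP[u0 u1]; split; rewrite /= ?subrK// subr_ge0.
have h2 : eqmod2pi (hol (fun t => s (0, t))) (a2 - a0).
  apply: (edge (fun t => (0, t))) => //.
    by move=> u; apply: pair_continuous; [exact: cst_continuous|exact: cvg_id].
  by move=> u /andP[u0 u1]; split; rewrite //= add0r.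
have h3 : eqmod2pi (hol (fun t => s (t, 0))) (a1 - a0).
  apply: (edge (fun t => (t, 0))) => //.
    by move=> u; apply: pair_continuous; [exact: cvg_id|exact: cst_continuous].
  by move=> u /andP[u0 u1]; split; rewrite //= addr0.
have := eqmod2piD (eqmod2piD h1 (eqmod2piN h2)) h3.
by rewrite (_ : a2 - a1 - (a2 - a0) + (a1 - a0) = 0); last by ring.
Qed.

Lemma Hol_boundary d : is_chain2 d -> eqmod2pi (Hol (boundary2 d)) 0.
Proof.
elim: d => [_|p d IH /= [cp /IH Hd]]; first by rewrite /Hol big_nil; exact: eqmod2pi_refl.
rewrite /boundary2/= !Hol_cons addrA addrA -[X in eqmod2pi _ X]addr0.
apply: eqmod2piD; last exact: Hd.
rewrite mulrNz mulNr -mulrN -!mulrDr; apply: eqmod2pi_mulz; exact: hol_triangle.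
Qed.

End Holonomy.

Section GlobalSection.
Hypothesis conX : connected [set: X].
Hypothesis local_paths : forall x U, nbhs x U -> \forall y \near x, exists s : R -> X,
  [/\ continuous s, s 0 = x, s 1 = y & forall u, 0 <= u <= 1 -> U (s u)].
Hypothesis closed_paths : forall z : @chain1 R X, cycle1 z -> exists (g : R -> X) p,
  [/\ continuous (g \o clamp), homologous z [:: (1, g)],
      forall u, 0 <= u <= 1 -> lift_at (g \o clamp) p u, g 0 = g 1 & p 0 = p 1].

(** The cycle z is homologous to a closed path whose lift closes up. *)
Lemma Hol_cycle z : cycle1 z -> eqmod2pi (Hol z) 0.
Proof.
move=> /closed_paths[g [p [cg [d d2 zg] lp g01 p01]]].
have [a pa] : exists a, p 0 = act a (ref (g 0)).
  apply: over_trans; first exact: over_ref.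
  by have := lift_over (lp 0 _); rewrite /= clamp_id ?lexx ?ler01//; apply.
have pa1 : p 1 = act a (ref (g 1)) by rewrite -p01 -g01.
have := hol_lift cg lp pa pa1; rewrite subrr => hg.
rewrite -[Hol z](subrK (Hol [:: (1, g)])) -[X in eqmod2pi _ X]addr0.
apply: eqmod2piD; first by rewrite (Hol_multiplicity zg); exact: Hol_boundary.
by rewrite Hol1.
Qed.

Let pt (x y : X) : int := (`[< x = y >] : nat)%:Z.

(** c is a chain leading from x0 to x. *)
Let reach x0 x (c : @chain1 R X) : Prop := is_chain1 c /\ forall y, boundary1 c y = pt x y - pt x0 y.

Let chain_cat c c' : is_chain1 (R := R) (M := X) c -> is_chain1 c' -> is_chain1 (c ++ c').
Proof. by move=> cc cc'; elim: c cc => //= p c IH [cp /IH]. Qed.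

Let chain_opp c : is_chain1 (R := R) (M := X) c -> is_chain1 (opp_chain c).
Proof. by elim: c => //= p c IH [cp /IH]. Qed.

Let boundary_cat (c c' : @chain1 R X) y :
  boundary1 (c ++ c') y = boundary1 c y + boundary1 c' y.
Proof. by rewrite /boundary1 big_cat. Qed.

Let boundary_opp (c : @chain1 R X) y : boundary1 (opp_chain c) y = - boundary1 c y.
Proof. by rewrite /boundary1 big_map -sumrN; apply: eq_bigr => p _; rewrite mulNr. Qed.

Let path_chain (s : R -> X) : continuous s -> is_chain1 [:: (1, s)].
Proof. by move=> cs; split=> //; exact: continuous_subspaceT. Qed.

Let boundary_path (s : R -> X) y : boundary1 [:: (1, s)] y = pt (s 1) y - pt (s 0) y.
Proof. by rewrite /boundary1 big_seq1 mul1r. Qed.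

Let reach_path x0 c (s : R -> X) : continuous s -> reach x0 (s 0) c ->
  reach x0 (s 1) (c ++ [:: (1, s)]).
Proof.
move=> cs [cc bc]; split=> [|y]; first exact/chain_cat/path_chain.
by rewrite boundary_cat boundary_path bc; ring.
Qed.

Let reach_path_rev x0 c (s : R -> X) : continuous s -> reach x0 (s 1) c ->
  reach x0 (s 0) (c ++ opp_chain [:: (1, s)]).
Proof.
move=> cs [cc bc]; split=> [|y]; first exact/chain_cat/chain_opp/path_chain.
by rewrite boundary_cat boundary_opp boundary_path bc; ring.
Qed.

(** The set of points that can be reached from x0 is open and closed. *)
Let reachable x0 x : exists c, reach x0 x c.
Proof.
pose S := [set x | exists c, reach x0 x c].
suff ST : S = [set: X] by rewrite -[exists c, _]/(S x) ST.
apply: conX; first by exists x0, [::]; split=> // y; rewrite /boundary1 big_nil subrr.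
  exists S; last by rewrite setTI.
  rewrite openE => y [c yc]; apply: filterS (local_paths (@filterT _ (nbhs y) _)).
  by move=> z [s [cs s0 s1 _]]; eexists; rewrite -s1; apply: reach_path => //; rewrite s0; exact: yc.
exists S; last by rewrite setTI.
rewrite -[S]setCK; apply: open_closedC; rewrite openE => y Sy.
apply: filterS (local_paths (@filterT _ (nbhs y) _)) => z [s [cs s0 s1 _]] [c zc].
by apply: Sy; eexists; rewrite -s0; apply: reach_path_rev => //; rewrite s1; exact: zc.
Qed.

(** F x is the point [ref x] rotated by the holonomy of a chain from x0 to x, that
    is, the transport of [ref x0] along that chain.  By [Hol_cycle] the chain can be
    chosen through a nearby point, so F follows the horizontal sections up to a
    locally constant phase. *)
Theorem global_section : exists F : X -> P, forall x l, hor x l ->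
  exists c, \forall y \near x, F y = act c (l y).
Proof.
have [[x0 _]|nX] := pselect (exists x : X, True); last first.
  by exists ref => x; case: nX; exists x.
pose ch x := sval (cid (reachable x0 x)).
have chP x : reach x0 x (ch x) := svalP (cid (reachable x0 x)).
exists (fun x => act (Hol (ch x)) (ref x)) => x l hl.
have ovx : over x (l x) by have := nbhs_singleton (hor_over hl).
have [c cE] : exists c, act (Hol (ch x)) (ref x) = act c (l x).
  exact: (over_trans ovx (over_act _ (over_ref _))).
exists c; apply: filterS (local_paths (hor_near hl)) => y [s [cs s0 s1 sl]].
have sc : continuous (s \o clamp).
  by move=> u; apply: continuous_comp; [exact: clamp_continuous|exact: cs].
have [t tE] : exists t, act c (l y) = act t (ref y).
  have o01 : 0 <= (1 : R) <= 1 by rewrite lexx ler01.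
  have oy := nbhs_singleton (hor_over (sl 1 o01)); rewrite s1 in oy.
   exact: (over_trans (over_ref _) (over_act _ oy)).
rewrite tE; apply: (act_eq (over_ref _)).
have hs : eqmod2pi (hol s) (t - Hol (ch x)).
  apply: (@hol_lift s (act c \o l \o s \o clamp)) => //.
  - move=> u u01; apply: (@lift_at_comp _ _ (s \o clamp) id); first exact: sc.
    apply: (@lift_at_hor _ id (act c \o l)); apply/hor_act/sl.
    by rewrite /= clamp_id.
  - by rewrite /= clamp_id ?lexx ?ler01// s0.
  - by rewrite /= clamp_id ?lexx ?ler01// s1.
have [cx bx] := chP x; have [cy by_] := chP y.
have : cycle1 (ch x ++ [:: (1, s)] ++ opp_chain (ch y)).
  split=> [|z]; first by do 2 (apply: chain_cat => //); [exact: path_chain|exact: chain_opp].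
  by rewrite !boundary_cat boundary_opp boundary_path bx by_ s0 s1; ring.
move=> /Hol_cycle; rewrite !Hol_cat Hol_opp Hol1 => hz.
have := eqmod2piD hs (eqmod2piN hz).
rewrite (_ : hol s + _ = Hol (ch y) - Hol (ch x)); last by ring.
rewrite oppr0 addr0 => /(eqmod2piD (eqmod2pi_refl (Hol (ch x)))).
by rewrite addrC subrK [X in eqmod2pi _ X]addrC subrK.
Qed.

End GlobalSection.

End Monodromy.

(** * Polar coordinates *)

Section Circle.
Context {R : realType}.
Implicit Types t x : R.

Lemma cos_sin_2piz x (k : int) :
  cos (x + k%:~R * (2 * pi)) = cos x /\ sin (x + k%:~R * (2 * pi)) = sin x.
Proof.
have nat_case (y : R) (m : nat) : cos (y + m%:R * (2 * pi)) = cos y /\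
    sin (y + m%:R * (2 * pi)) = sin y.
  rewrite [m%:R * _]mulr_natl [2 * pi]mulr_natl.
  by rewrite (periodicn (@cosD2pi R)) (periodicn (@sinD2pi R)).
case: k => m; first exact: nat_case.
have [c s] := nat_case (x + (Negz m)%:~R * (2 * pi)) m.+1.
by rewrite -c -s NegzE mulrNz mulNr subrK.
Qed.

Lemma cos_eq1 t : cos t = 1 -> eqmod2pi t 0.
Proof.
move=> ct; pose k := Num.floor ((t + pi) / (2 * pi)).
pose s := t - k%:~R * (2 * pi).
have pi0 := pi_gt0 R; have pi20 : 0 < 2 * pi :> R by rewrite mulr_gt0.
have /andP[k1 k2] := floor_itv ((t + pi) / (2 * pi)).
rewrite ler_pdivlMr// in k1; rewrite ltr_pdivrMr// intrD mulrDl mul1r in k2.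
have cs : cos `|s| = 1.
  by rewrite cos_norm -ct; have := (cos_sin_2piz s k).1; rewrite subrK => ->.
have : `|s| = 0.
  apply: (@cos_inj R); last by rewrite cs cos0.
    rewrite in_itv/= normr_ge0 ler_norml /s -/k in k1 k2 *.
    by apply/andP; split; lra.
  by rewrite in_itv/= lexx ltW.
by move=> /eqP; rewrite normr_eq0 subr_eq0 => /eqP ->; exists k; rewrite subr0.
Qed.

Lemma eqmod2pi_cos_sin s t : eqmod2pi s t -> cos s = cos t /\ sin s = sin t.
Proof. by move=> [k e]; rewrite -(subrK t s) e addrC; exact: cos_sin_2piz. Qed.

Lemma carg_polar (r t : R) : 0 < r ->
  cos (carg (r * cos t) (r * sin t)) = cos t /\ sin (carg (r * cos t) (r * sin t)) = sin t.
Proof.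
move=> r0; rewrite /carg !exprMn -mulrDr cos2Dsin2 mulr1 sqrtr_sqr (ger0_norm (ltW r0)).
rewrite mulrAC divff ?mul1r; last exact: lt0r_neq0.
have c1 : -1 <= cos t <= 1 by rewrite cos_geN1 cos_le1.
have sa : sin (acos (cos t)) = `|sin t|.
  by rewrite sin_acos// -sin2cos2 sqrtr_sqr.
have ca : cos (acos (cos t)) = cos t by rewrite acosK// in_itv/=.
rewrite (pmulr_rge0 _ r0); case: ifPn => st; first by rewrite ca sa ger0_norm.
by rewrite cosN sinN ca sa ltr0_norm ?opprK// ltNge.
Qed.

Lemma polar_ex (a b r : R) : 0 < r -> r ^+ 2 = a ^+ 2 + b ^+ 2 ->
  exists t, a = r * cos t /\ b = r * sin t.
Proof.
move=> r0 rr; have rn0 := lt0r_neq0 r0.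
have x1 : -1 <= a / r <= 1.
  rewrite -ler_norml normrM normfV (gtr0_norm r0) ler_pdivrMr// mul1r.
  by rewrite -(ler_pXn2r (isT : (0 < 2)%N)) ?nnegrE ?normr_ge0 ?(ltW r0)// real_normK ?num_real// rr lerDl sqr_ge0.
have sa : r * sin (acos (a / r)) = `|b|.
  have rs x : r * Num.sqrt x = Num.sqrt (r ^+ 2 * x).
    by rewrite sqrtrM ?sqr_ge0// sqrtr_sqr (ger0_norm (ltW r0)).
  rewrite sin_acos// -(sqrtr_sqr b) rs mulrBr mulr1 -exprMn mulrC divfK//.
  by rewrite rr (addrC (a ^+ 2)) addrK.
have ca : r * cos (acos (a / r)) = a by rewrite acosK ?in_itv// mulrC divfK.
have [b0|b0] := leP 0 b.
  by exists (acos (a / r)); rewrite sa ca ger0_norm.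
by exists (- acos (a / r)); rewrite cosN sinN mulrN sa ca ltr0_norm// opprK.
Qed.

End Circle.

(** * The complex space and its Hermitian structure *)

Section ComplexSpace.
Context {R : realType} {n : nat}.
Local Notation V := (Cn R n).
Implicit Types u v w : V.

Definition re (i : 'I_n) w : R := w.1 ord0 i.
Definition im (i : 'I_n) w : R := w.2 ord0 i.

Fact re_linear i : linear (re i : V -> R).
Proof. by move=> a u v; rewrite /re !mxE. Qed.
Fact im_linear i : linear (im i : V -> R).
Proof. by move=> a u v; rewrite /im !mxE. Qed.
HB.instance Definition _ i :=
  GRing.isLinear.Build R V R *:%R (re i) (re_linear i).
HB.instance Definition _ i :=
  GRing.isLinear.Build R V R *:%R (im i) (im_linear i).

Lemma re_continuous i : continuous (re i).
Proof.
by move=> w; apply: (continuous_comp (f := fst) (g := fun x : 'rV[R]_n => x ord0 i));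
  [exact: cvg_fst|exact: coord_continuous].
Qed.
Lemma im_continuous i : continuous (im i).
Proof.
by move=> w; apply: (continuous_comp (f := snd) (g := fun x : 'rV[R]_n => x ord0 i));
  [exact: cvg_snd|exact: coord_continuous].
Qed.

Lemma Cn_eq u v : (forall i, re i u = re i v) -> (forall i, im i u = im i v) -> u = v.
Proof.
case: u v => [a b] [c d] e1 e2; congr pair; apply/rowP => i; [exact: e1|exact: e2].
Qed.

(** Multiplication by the imaginary unit. *)
Definition Jc w : V := (- w.2, w.1).

Lemma re_phase t w i : re i (phase t w) = cos t * re i w - sin t * im i w.
Proof. by rewrite /re /im /phase !mxE. Qed.
Lemma im_phase t w i : im i (phase t w) = sin t * re i w + cos t * im i w.
Proof. by rewrite /re /im /phase !mxE. Qed.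
Lemma re_J w i : re i (Jc w) = - im i w.
Proof. by rewrite /re /im !mxE. Qed.
Lemma im_J w i : im i (Jc w) = re i w.
Proof. by []. Qed.
Lemma reD u v i : re i (u + v) = re i u + re i v. Proof. exact: linearD. Qed.
Lemma imD u v i : im i (u + v) = im i u + im i v. Proof. exact: linearD. Qed.
Lemma reZ a v i : re i (a *: v) = a * re i v. Proof. exact: linearZ. Qed.
Lemma imZ a v i : im i (a *: v) = a * im i v. Proof. exact: linearZ. Qed.

Definition coordE := (re_phase, im_phase, re_J, im_J, reD, imD, reZ, imZ).

Lemma Cn_decomposition w :
  w = \sum_i (re i w *: (delta_mx ord0 i, 0) + im i w *: (0, delta_mx ord0 i)) :> V.
Proof.
apply: Cn_eq => j; rewrite linear_sum (bigD1 j)//= big1 => [|i /negbTE ij].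
- by rewrite addr0 !coordE /re !mxE !eqxx mulr1 mulr0 addr0.
- by rewrite !coordE /re !mxE eqxx eq_sym ij !mulr0 addr0.
- by rewrite addr0 !coordE /im !mxE !eqxx mulr1 mulr0 add0r.
- by rewrite !coordE /im !mxE eqxx eq_sym ij !mulr0 addr0.
Qed.

Lemma phaseDv t u v : phase t (u + v) = phase t u + phase t v.
Proof. by apply: Cn_eq => i; rewrite !coordE; ring. Qed.
Lemma phaseZv t a v : phase t (a *: v) = a *: phase t v.
Proof. by apply: Cn_eq => i; rewrite !coordE; ring. Qed.
Lemma phase_J t w : phase t (Jc w) = Jc (phase t w).
Proof. by apply: Cn_eq => i; rewrite !coordE; ring. Qed.
Lemma phase_eq s t w : cos s = cos t -> sin s = sin t -> phase s w = phase t w.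
Proof. by rewrite /phase => -> ->. Qed.

(** The real part of the Hermitian product, the sum of the conj(u_i) v_i; omega0 is
    its imaginary part. *)
Definition dot u v : R := \sum_i (re i u * re i v + im i u * im i v).

Lemma omega0E u v : omega0 u v = \sum_i (re i u * im i v - im i u * re i v).
Proof. by []. Qed.
Lemma alphaE w v : alpha w v = 2^-1 * omega0 w v.
Proof. by []. Qed.
Lemma normsqE w : normsq w = dot w w.
Proof. by rewrite /dot; apply: eq_bigr => i _; rewrite -!expr2. Qed.
Lemma dotC u v : dot u v = dot v u.
Proof. by apply: eq_bigr => i _; ring. Qed.
Lemma dotDl u v w : dot (u + v) w = dot u w + dot v w.
Proof. by rewrite /dot -big_split/=; apply: eq_bigr => i _; rewrite !coordE; ring. Qed.
Lemma dotZl a u w : dot (a *: u) w = a * dot u w.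
Proof. by rewrite /dot mulr_sumr; apply: eq_bigr => i _; rewrite !coordE; ring. Qed.
Lemma dotDr u v w : dot w (u + v) = dot w u + dot w v.
Proof. by rewrite !(dotC w) dotDl. Qed.
Lemma dotZr a u w : dot w (a *: u) = a * dot w u.
Proof. by rewrite !(dotC w) dotZl. Qed.
Lemma omega_dot u v : omega0 u v = dot (Jc u) v.
Proof. by apply: eq_bigr => i _; rewrite !coordE /re /im; ring. Qed.
Lemma dot_phase t u v : dot (phase t u) (phase t v) = dot u v.
Proof.
apply: eq_bigr => i _; rewrite !coordE.
rewrite -[RHS]mul1r -(cos2Dsin2 t); ring.
Qed.
Lemma normsq_phase t w : normsq (phase t w) = normsq w.
Proof. by rewrite !normsqE dot_phase. Qed.
Lemma omega_phase t u v : omega0 (phase t u) (phase t v) = omega0 u v.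
Proof. by rewrite !omega_dot -phase_J dot_phase. Qed.
Lemma dot_JJ u v : dot (Jc u) (Jc v) = dot u v.
Proof. by apply: eq_bigr => i _; rewrite !coordE; ring. Qed.
Lemma dot_Jself u : dot (Jc u) u = 0.
Proof. by apply: big1 => i _; rewrite !coordE; ring. Qed.
Lemma omegaC u v : omega0 u v = - omega0 v u.
Proof. by rewrite !omega0E -sumrN; apply: eq_bigr => i _; ring. Qed.
Lemma omegaDl u v w : omega0 (u + v) w = omega0 u w + omega0 v w.
Proof. by rewrite !omega0E -big_split/=; apply: eq_bigr => i _; rewrite !coordE; ring. Qed.
Lemma omegaZl a u w : omega0 (a *: u) w = a * omega0 u w.
Proof. by rewrite !omega0E mulr_sumr; apply: eq_bigr => i _; rewrite !coordE; ring. Qed.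
Lemma omegaDr u v w : omega0 w (u + v) = omega0 w u + omega0 w v.
Proof. by rewrite !omega_dot dotDr. Qed.
Lemma omegaZr a u w : omega0 w (a *: u) = a * omega0 w u.
Proof. by rewrite !omega_dot dotZr. Qed.
Lemma omega_J u v : omega0 u (Jc v) = dot u v.
Proof. by rewrite omega_dot dot_JJ. Qed.
Lemma omega_self u : omega0 u u = 0.
Proof. by rewrite omega_dot dot_Jself. Qed.

Lemma phase_cos_sin t w : phase t w = cos t *: w + sin t *: Jc w.
Proof. by apply: Cn_eq => i; rewrite !coordE; ring. Qed.

Lemma phase_fix t w : normsq w = 1 -> phase t w = w <-> eqmod2pi t 0.
Proof.
move=> w1; split=> [tw|/eqmod2pi_cos_sin[c s]]; last first.
  by rewrite (phase_eq _ c s) phase0.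
apply: cos_eq1; have : dot (phase t w) w = 1 by rewrite tw -normsqE.
by rewrite phase_cos_sin dotDl !dotZl dot_Jself mulr0 addr0 -normsqE w1 mulr1.
Qed.

End ComplexSpace.

(** * The Hopf fibration and its trivializations *)

Section HopfFibration.
Context {R : realType} {n : nat}.
Implicit Types (w : Cn R n) (c : CP R n) (z : Cn R n.-1) (j : 'I_n).

Definition over_hopf c w : Prop := exists2 p : sphere R n, val p = w & hopf p = c.

Lemma hopf_eqP (p q : sphere R n) : hopf p = hopf q <-> exists t, val q = phase t (val p).
Proof.
split=> [/generic_quotient.eqmodP/asboolP//|pq].
exact/generic_quotient.eqmodP/asboolP.
Qed.

Lemma over_hopf_norm c w : over_hopf c w -> normsq w = 1.
Proof. by move=> [p <- _]; exact/eqP/(valP p). Qed.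

Lemma over_hopf_phase c t w : over_hopf c w -> over_hopf c (phase t w).
Proof.
move=> [p <- pc]; have tp : normsq (phase t (val p)) == 1.
  by rewrite normsq_phase; exact: valP p.
exists (Sub (phase t (val p)) tp); rewrite ?SubK// -pc.
by apply/hopf_eqP; exists (- t); rewrite SubK phaseD addNr phase0.
Qed.

Lemma over_hopf_trans c w w' : over_hopf c w -> over_hopf c w' -> exists t, w' = phase t w.
Proof. by move=> [p <- <-] [q <- /esym/hopf_eqP]. Qed.

Lemma over_hopf_psi j z : hball z -> over_hopf (psi j z) (hsect j z).
Proof.
move=> zB; eexists; last by [].
by rewrite val_insubd hsect_sphere.
Qed.

Lemma psi_invP j c : Uset j c -> hball (psi_inv j c) /\ psi j (psi_inv j c) = c.
Proof.
move=> Uc; split; last by apply: pinvK; rewrite inE.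
apply: (@surjpinv_image_sub _ _ (fun=> 0) (@hball R n) (@Uset R n j) (psi j)); last by exists c.
by [].
Qed.

Lemma over_hopf_Psi j c t : Uset j c -> over_hopf c (Psi j (psi_inv j c, t)).
Proof.
by move=> /psi_invP[B Pc]; rewrite -[in over_hopf c]Pc; exact/over_hopf_phase/over_hopf_psi.
Qed.

Lemma re_hsect_lift j z k : re (lift j k) (hsect j z) = re k z.
Proof. by rewrite /re mxE liftK. Qed.
Lemma im_hsect_lift j z k : im (lift j k) (hsect j z) = im k z.
Proof. by rewrite /im mxE liftK. Qed.
Lemma re_hsect_self j z : re j (hsect j z) = Num.sqrt (1 - normsq z).
Proof. by rewrite /re mxE unlift_none. Qed.
Lemma im_hsect_self j z : im j (hsect j z) = 0.
Proof. by rewrite /im mxE unlift_none. Qed.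

Lemma hsect_self_gt0 z : hball z -> 0 < Num.sqrt (1 - normsq z).
Proof. by move=> zB; rewrite sqrtr_gt0 subr_gt0. Qed.

(** The j'-th coordinate of [hsect j' z] is a positive real, so that the phase of a
    point in the trivialization Psi_j' is the argument of its j'-th coordinate. *)
Lemma Psi_transP j j' c t : Uset j c -> Uset j' c ->
  Psi j (psi_inv j c, t) = Psi j' (psi_inv j' c, Psi_trans j' j (psi_inv j c) t).
Proof.
move=> Uj Uj'.
have [t' e] := over_hopf_trans (over_hopf_Psi 0 Uj') (over_hopf_Psi t Uj).
rewrite /Psi/= phase0 in e; rewrite {1}/Psi/= e /Psi/= /Psi_trans.
have [zB _] := psi_invP Uj'; set z' := psi_inv j' c in e zB *.
rewrite -/(re _ _) -/(im _ _) /Psi/= e re_phase im_phase re_hsect_self im_hsect_self.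
rewrite !mulr0 subr0 addr0 !(mulrC _ (Num.sqrt _)).
by have [c1 s1] := carg_polar t' (hsect_self_gt0 zB); apply: phase_eq.
Qed.

(** Some coordinate of a representative is nonzero; rotating it to the positive
    reals puts the point in the image of the corresponding section. *)
Lemma Uset_cover c : exists j, Uset j c.
Proof.
pose p := generic_quotient.repr c.
have pc : hopf p = c by exact: generic_quotient.reprK.
have [j jp] : exists j, 0 < re j (val p) ^+ 2 + im j (val p) ^+ 2.
  apply/existsP; rewrite -[X in is_true X]negbK; apply/negP; rewrite negb_exists => /forallP p0.
  have := valP p; rewrite /normsq big1 ?(eq_sym 0) ?oner_eq0// => i _.
  apply/eqP; rewrite eq_le addr_ge0 ?sqr_ge0// andbT leNgt; exact: p0.
exists j.
pose r := Num.sqrt (re j (val p) ^+ 2 + im j (val p) ^+ 2).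
have r0 : 0 < r by rewrite sqrtr_gt0.
have rr : r ^+ 2 = re j (val p) ^+ 2 + im j (val p) ^+ 2 by rewrite sqr_sqrtr// ltW.
have [t [ct st]] : exists t, re j (val p) = r * cos t /\ im j (val p) = r * sin t.
  exact: polar_ex.
pose w := phase (- t) (val p).
have rw : re j w = r.
  rewrite re_phase ct st cosN sinN mulNr opprK !(mulrCA _ r) -mulrDr -!expr2.
  by rewrite cos2Dsin2 mulr1.
have iw : im j w = 0 by rewrite im_phase ct st cosN sinN; ring.
pose z : Cn R n.-1 := (\row_k re (lift j k) w, \row_k im (lift j k) w).
have nw : normsq w = 1 by rewrite normsq_phase; exact/eqP/(valP p).
have nz : normsq w = r ^+ 2 + normsq z.
  rewrite [LHS]normsqE /dot (bigD1_ord j)//= rw iw mulr0 addr0 -expr2; congr (_ + _).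
  by apply: eq_bigr => k _; rewrite !mxE !expr2.
have zB : hball z by rewrite /hball/= -(ltrD2l (r ^+ 2)) -nz nw ltrDr exprn_gt0.
have hz : hsect j z = w.
  have sq : Num.sqrt (1 - normsq z) = r by rewrite -nw nz addrK sqrtr_sqr ger0_norm// ltW.
  apply: Cn_eq => i; have [k ->|->] := unliftP j i.
  - by rewrite re_hsect_lift /re/= mxE.
  - by rewrite re_hsect_self sq rw.
  - by rewrite im_hsect_lift /im/= mxE.
  - by rewrite im_hsect_self iw.
exists z => //.
have [q qz <-] := over_hopf_psi j zB; rewrite -pc; apply/hopf_eqP.
by exists t; rewrite qz hz /w phaseD subrr phase0.
Qed.

End HopfFibration.

Section SmoothComplexMaps.
Context {R : realType} {E : normedModType R} {n : nat}.
Implicit Types (f : E -> Cn R n) (U : set E).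

Lemma Ck_scale {F : normedModType R} (v : F) k U (g : E -> R) : open U -> Ck k U g ->
  Ck k U (fun x => g x *: v).
Proof.
move=> oU; elim: k g => [|k IH] g.
  by move=> cg x Ux; apply: cvgZr_tmp; exact: cg.
move=> Cg; split=> [x Ux|w]; first exact/differentiableZl/(Ck_diff Cg).
apply: (@Ck_eq _ _ _ _ _ (fun x => 'D_w g x *: v)) => // [x Ux|].
  have dg := Ck_diff Cg Ux.
  by rewrite [RHS]deriveE ?diffZl//= ?deriveE//; exact: differentiableZl.
by apply: IH; exact: Ck_derive.
Qed.

Lemma Ck_Cn k U f : open U ->
  (forall i, Ck k U (re i \o f)) -> (forall i, Ck k U (im i \o f)) -> Ck k U f.
Proof.
move=> oU Cr Ci.
apply: (@Ck_eq _ _ _ _ _ (fun x => \sum_i (re i (f x) *: (delta_mx ord0 i, 0) +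
    im i (f x) *: (0, delta_mx ord0 i)))) => //.
  by move=> x _; rewrite -Cn_decomposition.
by apply: Ck_sum => // i; apply: CkD => //; [exact: (Ck_scale _ oU (Cr i))|
  exact: (Ck_scale _ oU (Ci i))].
Qed.

Lemma Ck_phase k U f (th : E -> R) : open U -> Ck k U th -> Ck k U f ->
  Ck k U (fun x => phase (th x) (f x)).
Proof.
move=> oU Ct Cf.
have Cre i : Ck k U (re i \o f) by apply: Ck_lin => //; exact: re_continuous.
have Cim i : Ck k U (im i \o f) by apply: Ck_lin => //; exact: im_continuous.
have Cc : Ck k U (cos \o th).
  by apply: (@Ck_comp1 _ _ _ _ setT) => //; exact: (Ck_cos_sin k (@openT R)).1.
have Cs : Ck k U (sin \o th).
  by apply: (@Ck_comp1 _ _ _ _ setT) => //; exact: (Ck_cos_sin k (@openT R)).2.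
apply: Ck_Cn => // i.
  apply: (@Ck_eq _ _ _ _ _ (fun x => cos (th x) * re i (f x) + (-1) * (sin (th x) * im i (f x)))) => //.
    by move=> x _ /=; rewrite re_phase mulN1r.
  exact: (CkD oU (CkM oU Cc (Cre i)) (CkM oU (Ck_cst _ _ _) (CkM oU Cs (Cim i)))).
apply: (@Ck_eq _ _ _ _ _ (fun x => sin (th x) * re i (f x) + cos (th x) * im i (f x))) => //.
  by move=> x _ /=; rewrite im_phase.
exact: (CkD oU (CkM oU Cs (Cre i)) (CkM oU Cc (Cim i))).
Qed.

Lemma derive_re f x v i : differentiable f x -> re i ('D_v f x) = 'D_v (re i \o f) x.
Proof. by move=> df; rewrite derive_lin//; exact: re_continuous. Qed.

Lemma derive_im f x v i : differentiable f x -> im i ('D_v f x) = 'D_v (im i \o f) x.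
Proof. by move=> df; rewrite derive_lin//; exact: im_continuous. Qed.

Lemma diff_re f x i : differentiable f x -> differentiable (re i \o f) x.
Proof.
by move=> df; apply: differentiable_comp => //; exact/linear_differentiable/re_continuous.
Qed.

Lemma diff_im f x i : differentiable f x -> differentiable (im i \o f) x.
Proof.
by move=> df; apply: differentiable_comp => //; exact/linear_differentiable/im_continuous.
Qed.

Lemma derive_phase (th : E -> R) f x v : differentiable th x -> differentiable f x ->
  differentiable (fun x => phase (th x) (f x)) x ->
  'D_v (fun x => phase (th x) (f x)) x =
  phase (th x) ('D_v f x) + 'D_v th x *: Jc (phase (th x) (f x)).
Proof.
move=> dt df dp.
have dc : is_derive x v (cos \o th) (- sin (th x) * 'D_v th x).
  apply: DeriveDef.
    by apply/diff_derivable/differentiable_comp => //; exact/derivable1_diffP.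
  by rewrite derive_comp1// derive_val.
have ds : is_derive x v (sin \o th) (cos (th x) * 'D_v th x).
  apply: DeriveDef.
    by apply/diff_derivable/differentiable_comp => //; exact/derivable1_diffP.
  by rewrite derive_comp1// derive_val.
have dr i : is_derive x v (re i \o f) (re i ('D_v f x)).
  by rewrite derive_re//; apply/derivableP/diff_derivable/diff_re.
have di i : is_derive x v (im i \o f) (im i ('D_v f x)).
  by rewrite derive_im//; apply/derivableP/diff_derivable/diff_im.
apply: Cn_eq => i; rewrite ?derive_re ?derive_im//.
  have [_ e] := is_deriveB (is_deriveM dc (dr i)) (is_deriveM ds (di i)).
  rewrite [LHS](_ : _ = 'D_v ((cos \o th) * (re i \o f) - (sin \o th) * (im i \o f)) x); last first.
    by congr ('D_v _ x); apply/funext => y /=; rewrite re_phase.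
  apply: etrans e _; rewrite !coordE /GRing.scale/=.
  move: (re i _) (im i _) (re i _) (im i _) ('D_v th x) => a b c d e'; ring.
have [_ e] := is_deriveD (is_deriveM ds (dr i)) (is_deriveM dc (di i)).
rewrite [LHS](_ : _ = 'D_v ((sin \o th) * (re i \o f) + (cos \o th) * (im i \o f)) x); last first.
  by congr ('D_v _ x); apply/funext => y /=; rewrite im_phase.
apply: etrans e _; rewrite !coordE /GRing.scale/=.
move: (re i _) (im i _) (re i _) (im i _) ('D_v th x) => a b c d e'; ring.
Qed.

End SmoothComplexMaps.

Section HopfCharts.
Context {R : realType} {n : nat}.
Implicit Types (w : Cn R n) (z u v : Cn R n.-1) (j : 'I_n).

Lemma Ck_normsq {E : normedModType R} m k (U : set E) (g : E -> Cn R m) : open U ->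
  Ck k U g -> Ck k U (fun x => normsq (g x)).
Proof.
move=> oU Cg.
have Cre i : Ck k U (re i \o g) by apply: Ck_lin => //; exact: re_continuous.
have Cim i : Ck k U (im i \o g) by apply: Ck_lin => //; exact: im_continuous.
apply: (@Ck_eq _ _ _ _ _ (fun x => \sum_i (re i (g x) * re i (g x) + im i (g x) * im i (g x)))).
- exact: oU.
- by move=> x _; rewrite normsqE.
apply: Ck_sum => // i.
exact: (CkD oU (CkM oU (Cre i) (Cre i)) (CkM oU (Cim i) (Cim i))).
Qed.

Lemma Ck_id {E : normedModType R} k (U : set E) : Ck k U id.
Proof. by apply: (@Ck_linear _ _ _ _ _ idfun) => x; exact: cvg_id. Qed.

Lemma hball_open : open (@hball R n).
Proof.
rewrite (_ : @hball R n = (fun z : Cn R n.-1 => normsq z) @^-1` [set x | x < 1])//.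
apply: open_comp; last exact: open_lt.
by move=> z _; exact: (Ck_cont (Ck_normsq openT (Ck_id 0 setT))).
Qed.

Lemma Ck_hsect_comp {E : normedModType R} j k (U : set E) (g : E -> Cn R n.-1) :
  open U -> (forall x, U x -> hball (g x)) -> Ck k U g -> Ck k U (hsect j \o g).
Proof.
move=> oU UB Cg.
apply: Ck_Cn => // i; have [l ->|->] := unliftP j i.
- apply: (@Ck_eq _ _ _ _ _ (re l \o g)) => // [x _|]; first by rewrite /= re_hsect_lift.
  by apply: Ck_lin => //; exact: re_continuous.
- apply: (@Ck_eq _ _ _ _ _ (Num.sqrt \o (fun x => 1 + (-1) * normsq (g x)))) => //.
    by move=> x _; rewrite /= re_hsect_self mulN1r.
  apply: (@Ck_comp1 _ _ _ _ [set x | 0 < x]) => //.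
  + by move=> x /UB gB; rewrite /= mulN1r subr_gt0.
  + by apply: Ck_sqrt => //; exact: open_gt.
  + exact: (CkD oU (Ck_cst _ _ _) (CkM oU (Ck_cst _ _ _) (Ck_normsq oU Cg))).
- apply: (@Ck_eq _ _ _ _ _ (im l \o g)) => // [x _|]; first by rewrite /= im_hsect_lift.
  by apply: Ck_lin => //; exact: im_continuous.
- apply: (@Ck_eq _ _ _ _ _ (cst 0)) => // [x _|]; first by rewrite /= im_hsect_self.
  exact: Ck_cst.
Qed.

Lemma Ck_hsect j k : Ck k (@hball R n) (hsect j).
Proof. exact: (Ck_hsect_comp j hball_open (fun z zB => zB) (Ck_id k _)). Qed.

Lemma hsect_diff j z : hball z -> differentiable (hsect j) z.
Proof. exact: Ck_diff (Ck_hsect j 1). Qed.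

Lemma re_dhsect j z v k : hball z -> re (lift j k) ('D_v (hsect j) z) = re k v.
Proof.
move=> zB; rewrite derive_re; last exact: hsect_diff.
rewrite (_ : re _ \o _ = re k); last by apply/funext => y; rewrite /= re_hsect_lift.
by apply: derive_linear; exact: re_continuous.
Qed.

Lemma im_dhsect j z v k : hball z -> im (lift j k) ('D_v (hsect j) z) = im k v.
Proof.
move=> zB; rewrite derive_im; last exact: hsect_diff.
rewrite (_ : im _ \o _ = im k); last by apply/funext => y; rewrite /= im_hsect_lift.
by apply: derive_linear; exact: im_continuous.
Qed.

Lemma im_dhsect_self j z v : hball z -> im j ('D_v (hsect j) z) = 0.
Proof.
move=> zB; rewrite derive_im; last exact: hsect_diff.
rewrite (_ : im _ \o _ = cst 0); last by apply/funext => y; rewrite /= im_hsect_self.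
by rewrite derive_cst.
Qed.

(** For [hsect j] and its derivative: their j-th coordinates are real, so these
    coordinates contribute nothing to omega0. *)
Lemma omega_lift j (a b : Cn R n) u v :
  (forall k, re (lift j k) a = re k u) -> (forall k, im (lift j k) a = im k u) ->
  (forall k, re (lift j k) b = re k v) -> (forall k, im (lift j k) b = im k v) ->
  im j a = 0 -> im j b = 0 -> omega0 a b = omega0 u v.
Proof.
move=> ra ia rb ib a0 b0; rewrite !omega0E (bigD1_ord j)//= a0 b0 mulr0 mul0r subrr add0r.
by apply: eq_bigr => k _; rewrite ra ia rb ib.
Qed.

Lemma omega_dhsect j z u v : hball z ->
  omega0 ('D_u (hsect j) z) ('D_v (hsect j) z) = omega0 u v.
Proof.
move=> zB; apply: (@omega_lift j) => [k|k|k|k||]; [exact: re_dhsect|exact: im_dhsect|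
  exact: re_dhsect|exact: im_dhsect|exact: im_dhsect_self|exact: im_dhsect_self].
Qed.

Lemma omega_hsect_dhsect j z v : hball z ->
  omega0 (hsect j z) ('D_v (hsect j) z) = - tau j z v.
Proof.
move=> zB; rewrite /tau opprK; apply: (@omega_lift j) => [k|k|k|k||].
- exact: re_hsect_lift.
- exact: im_hsect_lift.
- exact: re_dhsect.
- exact: im_dhsect.
- exact: im_hsect_self.
- exact: im_dhsect_self.
Qed.

Lemma normsq_hsect j z : hball z -> normsq (hsect j z) = 1.
Proof. by move=> zB; apply/eqP/hsect_sphere. Qed.

Lemma omegaFSE j z u v : hball z -> omegaFS j z u v = omega0 u v.
Proof.
move=> zB; have dz := hsect_diff j zB.
by rewrite -(omega_dhsect j u v zB) /omegaFS !deriveE.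
Qed.

(** The derivative of Psi_j at (z, t) on (v, c) is the rotation by t of the
    derivative of the section, plus c times the rotation field J; the first term
    gives - tau_j and the second |w|^2 = 1. *)
Lemma alpha_Psi j z (t : R) : hball z -> forall v (c : R),
  alpha (Psi j (z, t)) ('d (Psi j) (z, t) (v, c)) = 2^-1 * (c - tau j z v).
Proof.
move=> zB v c.
pose E := (Cn R n.-1 * R)%type.
have fst_cont : continuous (fst : E -> Cn R n.-1) by move=> q; exact: cvg_fst.
have snd_cont : continuous (snd : E -> R) by move=> q; exact: cvg_snd.
pose U : set E := fst @^-1` @hball R n.
have oU : open U by apply: open_comp => [q _|]; [exact: fst_cont|exact: hball_open].
have Ch : Ck 1 U (hsect j \o (fst : E -> Cn R n.-1)).
  exact: (Ck_comp_lin hball_open fst_cont (Ck_hsect j 1)).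
have Ct : Ck 1 U (snd : E -> R) by apply: Ck_linear.
have CP := Ck_phase oU Ct Ch.
have Uzt : U (z, t) by [].
have dh := Ck_diff Ch Uzt; have dt := Ck_diff Ct Uzt; have dP := Ck_diff CP Uzt.
rewrite -deriveE//.
have -> : 'D_(v, c) (Psi j) (z, t) = phase t ('D_v (hsect j) z) + c *: Jc (Psi j (z, t)).
  have e1 : 'D_(v, c) (hsect j \o (fst : E -> Cn R n.-1)) (z, t) = 'D_v (hsect j) z.
    by apply: derive_comp_lin => //; exact: hsect_diff.
  have e2 : 'D_(v, c) (snd : E -> R) (z, t) = c by exact: derive_linear.
  apply: (etrans (derive_phase (v, c) dt dh dP)).
  by apply: (f_equal2 (fun a b => phase t a + b *: Jc (Psi j (z, t)))).
have := omega_hsect_dhsect j v zB; move: ('D_v (hsect j) z) => d hd.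
rewrite alphaE omegaDr omegaZr omega_J -normsqE /Psi/= omega_phase normsq_phase.
by rewrite hd normsq_hsect// mulr1 addrC.
Qed.

End HopfCharts.

(** * Derivatives of omega0 and dot along maps *)

Lemma near_continuous (T S : topologicalType) (g : T -> S) t (Q : set S) :
  {for t, continuous g} -> (\forall z \near g t, Q z) -> \forall y \near t, Q (g y).
Proof. by move=> cg; exact: cg. Qed.

Section DerivativesOfForms.
Context {R : realType} {E : normedModType R} {m : nat}.
Implicit Types (f g : E -> Cn R m) (U : set E).

Lemma Ck_omega k U f g : open U -> Ck k U f -> Ck k U g ->
  Ck k U (fun x => omega0 (f x) (g x)).
Proof.
move=> oU Cf Cg.
have Cr i h : Ck k U h -> Ck k U (@re R m i \o h).
  by move=> Ch; apply: Ck_lin => //; exact: re_continuous.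
have Ci i h : Ck k U h -> Ck k U (@im R m i \o h).
  by move=> Ch; apply: Ck_lin => //; exact: im_continuous.
apply: (@Ck_eq _ _ _ _ _ (fun x => \sum_i (re i (f x) * im i (g x) +
    (-1) * (im i (f x) * re i (g x))))) => //.
  by move=> x _; rewrite omega0E; apply: eq_bigr => i _; rewrite mulN1r.
apply: Ck_sum => // i.
exact: (CkD oU (CkM oU (Cr i f Cf) (Ci i g Cg))
  (CkM oU (Ck_cst _ _ _) (CkM oU (Ci i f Cf) (Cr i g Cg)))).
Qed.

Lemma is_derive_omega f g x v : differentiable f x -> differentiable g x ->
  is_derive x v (fun x => omega0 (f x) (g x))
    (omega0 ('D_v f x) (g x) + omega0 (f x) ('D_v g x)).
Proof.
move=> df dg.
have dr h i : differentiable h x -> is_derive x v (@re R m i \o h) (re i ('D_v h x)).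
  by move=> dh; rewrite derive_re//; apply/derivableP/diff_derivable/diff_re.
have di h i : differentiable h x -> is_derive x v (@im R m i \o h) (im i ('D_v h x)).
  by move=> dh; rewrite derive_im//; apply/derivableP/diff_derivable/diff_im.
have [d e] := is_derive_sum (fun i => is_deriveB (is_deriveM (dr f i df) (di g i dg))
   (is_deriveM (di f i df) (dr g i dg))).
move: ('D_v f x) ('D_v g x) d e => a b d e.
have fE : (fun x => omega0 (f x) (g x)) = \sum_(i < m) ((re i \o f) * (im i \o g) -
    (im i \o f) * (re i \o g)).
  by apply/funext => y; rewrite omega0E fct_sumE.
apply: DeriveDef; first by rewrite fE; exact: d.
rewrite fE; apply: etrans e _.
rewrite !omega0E -big_split/=; apply: eq_bigr => i _; rewrite /GRing.scale/=; ring.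
Qed.

Lemma is_derive_dot f g x v : differentiable f x -> differentiable g x ->
  is_derive x v (fun x => dot (f x) (g x))
    (dot ('D_v f x) (g x) + dot (f x) ('D_v g x)).
Proof.
move=> df dg.
have dr h i : differentiable h x -> is_derive x v (@re R m i \o h) (re i ('D_v h x)).
  by move=> dh; rewrite derive_re//; apply/derivableP/diff_derivable/diff_re.
have di h i : differentiable h x -> is_derive x v (@im R m i \o h) (im i ('D_v h x)).
  by move=> dh; rewrite derive_im//; apply/derivableP/diff_derivable/diff_im.
have [d e] := is_derive_sum (fun i => is_deriveD (is_deriveM (dr f i df) (dr g i dg))
   (is_deriveM (di f i df) (di g i dg))).
move: ('D_v f x) ('D_v g x) d e => a b d e.
have fE : (fun x => dot (f x) (g x)) = \sum_(i < m) ((re i \o f) * (re i \o g) +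
    (im i \o f) * (im i \o g)).
  by apply/funext => y; rewrite /dot fct_sumE.
apply: DeriveDef; first by rewrite fE; exact: d.
rewrite fE; apply: etrans e _.
rewrite -big_split/=; apply: eq_bigr => i _; rewrite /GRing.scale/=; ring.
Qed.

Lemma unit_dot U f x v : open U -> (forall y, U y -> normsq (f y) = 1) -> U x ->
  differentiable f x -> dot (f x) ('D_v f x) = 0.
Proof.
move=> oU f1 Ux df; have [_ De] := is_derive_dot v df df.
have nU : \forall y \near x, U y by exact: open_nbhs_nbhs.
have D0 : 'D_v (fun y => dot (f y) (f y)) x = 0.
  apply: etrans (@near_eq_derive _ _ _ _ (cst (1 : R)) x v _) (derive_cst _ _ _).
  by apply: filterS nU => y Uy; rewrite -normsqE f1.
have := etrans (esym D0) De; rewrite (dotC ('D_v _ x)).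
by move: (dot _ _) => d d0; lra.
Qed.

Lemma derive_symmetric_Cn U f x u v : open U -> Ck 2 U f -> U x ->
  'D_u ('D_v f) x = 'D_v ('D_u f) x.
Proof.
move=> oU C2 Ux.
have nearU : \forall y \near x, U y by exact: open_nbhs_nbhs.
have reE a b i : re i ('D_a ('D_b f) x) = 'D_a ('D_b (re i \o f)) x.
  rewrite derive_re; last exact: (Ck_diff (Ck_derive b C2) Ux).
  apply: near_eq_derive; apply: filterS nearU => y Uy /=.
  by rewrite derive_re//; exact: (Ck_diff C2 Uy).
have imE a b i : im i ('D_a ('D_b f) x) = 'D_a ('D_b (im i \o f)) x.
  rewrite derive_im; last exact: (Ck_diff (Ck_derive b C2) Ux).
  apply: near_eq_derive; apply: filterS nearU => y Uy /=.
  by rewrite derive_im//; exact: (Ck_diff C2 Uy).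
apply: Cn_eq => i.
  apply: etrans (reE u v i) _; apply: etrans _ (esym (reE v u i)).
  by apply: (derive_symmetric _ _ oU) => //; apply: Ck_lin => //; exact: re_continuous.
apply: etrans (imE u v i) _; apply: etrans _ (esym (imE v u i)).
by apply: (derive_symmetric _ _ oU) => //; apply: Ck_lin => //; exact: im_continuous.
Qed.

Lemma diff_phase (th : E -> R) f x : differentiable th x -> differentiable f x ->
  differentiable (fun x => phase (th x) (f x)) x.
Proof.
move=> dt df.
have C1 : Ck 1 setT (fun q : R * Cn R m => phase q.1 q.2).
  apply: Ck_phase; first exact: openT.
    by apply: Ck_linear => q; exact: cvg_fst.
  by apply: Ck_linear => q; exact: cvg_snd.
apply: (@differentiable_comp _ _ _ _ (fun x => (th x, f x)) (fun q : R * Cn R m => phase q.1 q.2)).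
  exact: differentiable_pair.
exact: (Ck_diff C1).
Qed.

Lemma omega_linear_sum d (p : Cn R m) (L : {linear 'rV[R]_d -> Cn R m}) v :
  omega0 p (L v) = \sum_k v ord0 k * omega0 p (L (delta_mx ord0 k)).
Proof.
rewrite {1}(row_sum_delta v) linear_sum.
rewrite (big_morph (omega0 p) (fun u w => omegaDr u w p) (_ : omega0 p 0 = 0)); last first.
  by rewrite -(scale0r (0 : Cn R m)) omegaZr mul0r.
by apply: eq_bigr => k _; rewrite linearZ omegaZr.
Qed.

Lemma Ck_of_derive k U (g : E -> R) (b : E -> E -> R) : open U ->
  (forall y, U y -> differentiable g y) ->
  (forall v y, U y -> 'D_v g y = b v y) -> (forall v, Ck k U (b v)) -> Ck k.+1 U g.
Proof.
move=> oU dg gb Cb; split=> // v; apply: Ck_eq (Cb v) => // y Uy.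
by rewrite gb.
Qed.

Lemma derive0_ball (y0 : E) (r : R) (g : E -> R) :
  (forall y v, ball y0 r y -> is_derive y v g 0) ->
  forall y, ball y0 r y -> g y = g y0.
Proof.
move=> dg y By; have By' := By; rewrite -ball_normE /= in By'.
have [|t t01] := @MVT_closed _ (fun t => g (y0 + t *: (y - y0))) (fun=> 0) 0 1 ltr01 _.
  move=> t t01; apply: is_derive_along; apply: dg.
  rewrite -ball_normE /= opprD addrA subrr sub0r normrN normrZ.
  have /andP[t0 t1] := t01.
  by rewrite ger0_norm// (le_lt_trans _ By')// distrC ler_piMl.
by rewrite scale1r scale0r addr0 subrKC mul0r => /eqP; rewrite subr_eq0 => /eqP.
Qed.

End DerivativesOfForms.

(** * Horizontal lifts of a Lagrangian immersion *)

Section HorizontalSections.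
Context {R : realType} {n : nat} {Sigma : topologicalType}.
Variables (A : atlas Sigma 'rV[R]_n.-1) (f : Sigma -> CP R n).
Hypothesis hSigma : smooth_manifold A.
Hypothesis hf : lagrangian_immersion A f.
Local Notation E := 'rV[R]_n.-1.
Implicit Types (i : chart_index A) (j : 'I_n) (x : Sigma) (y v : E).

Lemma chart_cover x : exists i, dom i x.
Proof. by have [_ _ H _ _] := hSigma. Qed.
Lemma dom_open i : open (dom i).
Proof. by have [_ _ _ /(_ i)[]] := hSigma. Qed.
Lemma chart_image_open i : open (chart i @` dom i).
Proof. by have [_ _ _ /(_ i)[]] := hSigma. Qed.
Lemma chartK i x : dom i x -> param i (chart i x) = x.
Proof. by have [_ _ _ /(_ i)[_ _ H _ _] _] := hSigma; exact: H. Qed.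
Lemma chart_continuous i x : dom i x -> {for x, continuous (chart i)}.
Proof. by have [_ _ _ /(_ i)[_ _ _ H _] _] := hSigma; exact: H. Qed.
Lemma param_continuous i x : dom i x -> {for chart i x, continuous (param i)}.
Proof. by have [_ _ _ /(_ i)[_ _ _ _ H] _] := hSigma; exact: H. Qed.

Lemma param_near i x (U : set Sigma) : dom i x -> nbhs x U ->
  \forall y \near chart i x, U (param i y).
Proof. by move=> ix xU; apply: (param_continuous ix); rewrite chartK. Qed.

Lemma chart_near i x (U : set E) : dom i x -> nbhs (chart i x) U ->
  \forall x' \near x, dom i x' /\ U (chart i x').
Proof.
move=> ix xU; have d : \forall x' \near x, dom i x'.
  by apply: open_nbhs_nbhs; split=> //; exact: dom_open.
have c : \forall x' \near x, U (chart i x') := chart_continuous ix xU.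
exact: filterS2 d c.
Qed.

Definition coord_map i j : E -> Cn R n.-1 := psi_inv j \o f \o param i.

Definition coord_dom i j : set E := chart i @` (dom i `&` f @^-1` Uset j).

Lemma coord_domP i j y : coord_dom i j y ->
  [/\ dom i (param i y), chart i (param i y) = y, Uset j (f (param i y)) &
      hball (coord_map i j y)].
Proof.
move=> [x [ix jx] <-]; rewrite /coord_map /= chartK//; split=> //.
by have [] := psi_invP jx.
Qed.

Lemma coord_dom_chart i j x : dom i x -> Uset j (f x) -> coord_dom i j (chart i x).
Proof. by move=> ix jx; exists x. Qed.

Lemma coord_map_smooth i j :
  open (coord_dom i j) /\ forall k, Ck k (coord_dom i j) (coord_map i j).
Proof. by have [[/(_ i j)]] := hf; rewrite setIT. Qed.

Lemma coord_map_lagrangian i j y u v : coord_dom i j y ->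
  omega0 ('D_u (coord_map i j) y) ('D_v (coord_map i j) y) = 0.
Proof.
move=> Uy; have [oU CF] := coord_map_smooth i j.
have dF := Ck_diff (CF 1) Uy.
have [iy cy jy By] := coord_domP Uy.
have := hf.2 i j (param i y) iy jy; rewrite cy => /(_ u v)/eqP.
rewrite mulf_eq0 invr_eq0 (gt_eqF (pi_gt0 R)) /= => /eqP.
by rewrite omegaFSE// -!deriveE.
Qed.

(** The form F^* tau_j, where F is the local representative of f. *)
Let b i j v y : R := tau j (coord_map i j y) ('D_v (coord_map i j) y).

Let bE i j v y : b i j v y = - omega0 (coord_map i j y) ('D_v (coord_map i j) y).
Proof. by []. Qed.

Let bC i j v k : Ck k (coord_dom i j) (b i j v).
Proof.
have [oU CF] := coord_map_smooth i j.
apply: (@Ck_eq _ _ _ _ _ (fun y => (-1) * omega0 (coord_map i j y) ('D_v (coord_map i j) y))) => //.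
  by move=> y _; rewrite mulN1r.
exact: (CkM oU (Ck_cst _ _ _) (Ck_omega oU (CF k) (Ck_derive v (CF k.+1)))).
Qed.

(** The second derivatives of F cancel by symmetry, and the rest is a multiple of
    F^* omega0, which vanishes as f is Lagrangian. *)
Let b_closed i j v w y : coord_dom i j y -> 'D_w (b i j v) y = 'D_v (b i j w) y.
Proof.
move=> Uy; have [oU CF] := coord_map_smooth i j.
have D v' w' : 'D_w' (b i j v') y = - (omega0 ('D_w' (coord_map i j) y) ('D_v' (coord_map i j) y)
    + omega0 (coord_map i j y) ('D_w' ('D_v' (coord_map i j)) y)).
  have [_ e] := is_deriveN (is_derive_omega w' (Ck_diff (CF 1) Uy)
    (Ck_diff (Ck_derive v' (CF 2)) Uy)).
  exact: e.
have sym := derive_symmetric_Cn w v oU (CF 2) Uy.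
have lag := etrans (coord_map_lagrangian w v Uy) (esym (coord_map_lagrangian v w Uy)).
apply: etrans (D v w) _; apply: etrans _ (esym (D w v)).
exact: (f_equal2 (fun a c => - (a + omega0 (coord_map i j y) c)) lag sym).
Qed.

Let b_linear i j v w t y : coord_dom i j y -> b i j (v + t *: w) y = b i j v y + t * b i j w y.
Proof.
move=> Uy; have [oU CF] := coord_map_smooth i j; have dF := Ck_diff (CF 1) Uy.
rewrite !bE (deriveDv v (t *: w) dF) (deriveZv w t dF).
by move: (coord_map i j y) ('D_v _ y) ('D_w _ y) => p q q'; rewrite omegaDr omegaZr; ring.
Qed.

Lemma horizontal_angle i j x : dom i x -> Uset j (f x) ->
  exists (r : R) (th : E -> R), [/\ 0 < r, ball (chart i x) r `<=` coord_dom i j,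
    forall k, Ck k (ball (chart i x) r) th &
    forall y v, ball (chart i x) r y ->
      'D_v th y = tau j (coord_map i j y) ('D_v (coord_map i j) y)].
Proof.
move=> ix jx; have [oU CF] := coord_map_smooth i j.
have /nbhs_ballP[r /= r0 BU] : nbhs (chart i x) (coord_dom i j).
  by apply: open_nbhs_nbhs; split=> //; exact: coord_dom_chart.
pose B := ball (chart i x) r; have oB : open B by exact: ball_open.
pose th := radial_primitive (chart i x) (b i j).
have Dth v y : B y -> is_derive y v th (b i j v y).
  apply: radial_primitive_derive => [v' w t y' /BU|v'|v' w y' /BU].
  - exact: b_linear.
  - exact: Ck_sub BU (bC _ _ _ _).
  - exact: b_closed.
have b_sum v y : B y -> b i j v y = \sum_k v ord0 k * b i j (delta_mx ord0 k) y.
  move=> By; have dF := Ck_diff (CF 1) (BU _ By).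
  rewrite bE deriveE// omega_linear_sum -sumrN; apply: eq_bigr => k _.
  by rewrite bE deriveE// mulrN.
have dth y : B y -> differentiable th y.
  apply: (differentiable_of_derive oB Dth b_sum) => v y' /BU By'.
  exact: (Ck_cont (bC i j v 0)).
exists r, th; split=> // [k|y v By]; last by have [] := Dth v y By.
case: k => [|k].
  by move=> y By; exact: (differentiable_continuous (dth y By)).
apply: (Ck_of_derive oB dth) => [v y By|v]; first by have [_ ->] := Dth v y By.
exact: Ck_sub BU (bC _ _ _ _).
Qed.

(** The last clause says that alpha vanishes on the differential of l, alpha w being
    half of omega0 w. *)
Definition hor_cond i (l : Sigma -> Cn R n) y : Prop :=
  [/\ over_hopf (f (param i y)) (l (param i y)), differentiable (l \o param i) y &
      forall v, omega0 (l (param i y)) ('D_v (l \o param i) y) = 0].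

(** Horizontality near x is stated in one chart; by [hor_chart] it then holds in
    every chart around x. *)
Definition hor x (l : Sigma -> Cn R n) : Prop :=
  exists2 i, dom i x & \forall y \near chart i x, hor_cond i l y.

Lemma hor_chart x l i : hor x l -> dom i x -> \forall y \near chart i x, hor_cond i l y.
Proof.
move=> [i0 i0x cl] ix.
have [_ _ _ _ /(_ i i0)] := hSigma; rewrite setIT => -[oT CT].
set T := chart i @` _ in oT CT; set g := chart i0 \o id \o param i in CT.
have Tx : T (chart i x) by exists x.
have gx : g (chart i x) = chart i0 x by rewrite /g /= chartK.
have nT : \forall y \near chart i x, T y by exact: open_nbhs_nbhs.
have ng : \forall y \near chart i x, hor_cond i0 l (g y).
  have cg : {for chart i x, continuous g} := Ck_cont (CT 0%N) Tx.
  have ng0 : \forall z \near g (chart i x), hor_cond i0 l z by rewrite gx.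
  exact: (near_continuous cg ng0).
have gT y : T y -> param i0 (g y) = param i y.
  by move=> [x' [ix' i0x'] <-]; rewrite /g /= chartK// chartK.
apply: filterS2 nT ng => y Ty [ov dl hl].
have dg := Ck_diff (CT 1%N) Ty.
have nE : \forall z \near y, ((l \o param i0) \o g) z = (l \o param i) z.
  have nTy : \forall z \near y, T z by exact: open_nbhs_nbhs.
  by apply: filterS nTy => z Tz /=; rewrite gT.
have e := gT y Ty; rewrite e in ov.
split; [exact: ov| |move=> v].
  by apply: (near_differentiable nE); exact: differentiable_comp.
have De : 'D_v (l \o param i) y = 'D_('D_v g y) (l \o param i0) (g y).
  apply: etrans (esym (near_eq_derive v nE)) _.
  by rewrite deriveE; [rewrite (diff_comp dg dl)/= !deriveE|exact: differentiable_comp].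
by rewrite De -e; exact: hl.
Qed.

Lemma hor_near x l : hor x l -> \forall x' \near x, hor x' l.
Proof.
move=> [i ix /nbhs_interior ci].
by apply: filterS (chart_near ix ci) => x' [ix' cx']; exists i.
Qed.

Lemma hor_over x l : hor x l -> \forall x' \near x, over_hopf (f x') (l x').
Proof.
move=> [i ix ci]; apply: filterS (chart_near ix ci) => x' [ix' []].
by rewrite chartK.
Qed.

Lemma hor_act x l c : hor x l -> hor x (phase c \o l).
Proof.
move=> [i ix ci]; exists i; first exact: ix.
apply: filterS ci => y [ov dl hl]; split.
- exact: over_hopf_phase.
- exact: (diff_phase (differentiable_cst c y) dl).
- move=> v; have dp := diff_phase (differentiable_cst c y) dl.
  have := derive_phase v (differentiable_cst c y) dl dp.
  rewrite derive_cst scale0r addr0 => e.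
  rewrite [X in omega0 _ X](_ : _ = phase c ('D_v (l \o param i) y)); last exact: e.
  by rewrite /= omega_phase.
Qed.

(** A vector orthogonal to the complex line spanned by L is orthogonal to the same
    line spanned by L'. *)
Let orth (L L' a : Cn R n) : normsq L = 1 -> (exists c, L' = phase c L) ->
  dot L a = 0 -> omega0 L a = 0 -> dot a L' = 0 /\ omega0 a L' = 0.
Proof.
move=> L1 [c ->] La oa; rewrite phase_cos_sin dotDr omegaDr !dotZr !omegaZr omega_J.
rewrite (dotC a L) La (dotC a) -omega_dot oa omegaC oa; split; ring.
Qed.

(** If L' = phase c L with L of norm 1, then dot L L' = cos c and
    omega0 L L' = sin c.  The derivatives of both functions vanish, because the
    derivatives of horizontal maps to the sphere are orthogonal to the complex
    lines spanned by their values. *)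
Lemma hor_unique x l l' : hor x l -> hor x l' ->
  exists c, \forall x' \near x, l' x' = phase c (l x').
Proof.
move=> hl hl'; have [i ix] := chart_cover x.
have n12 : nbhs (chart i x) (hor_cond i l `&` hor_cond i l').
  exact: (filterI (hor_chart hl ix) (hor_chart hl' ix)).
move: n12 => /nbhs_ballP[r /= r0 Br].
set y0 := chart i x in Br; pose B := ball y0 r.
pose L := l \o param i; pose L' := l' \o param i.
have tr y : B y -> exists c, L' y = phase c (L y).
  by move=> /Br[[ov _ _] [ov' _ _]]; exact: over_hopf_trans ov ov'.
have tr' y : B y -> exists c, L y = phase c (L' y).
  by move=> /Br[[ov _ _] [ov' _ _]]; exact: over_hopf_trans ov' ov.
have unit y : B y -> normsq (L y) = 1 /\ normsq (L' y) = 1.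
  by move=> /Br[[ov _ _] [ov' _ _]]; split; [exact: over_hopf_norm ov|exact: over_hopf_norm ov'].
have oB : open B by exact: ball_open.
have Dd y v : B y -> is_derive y v (fun z => dot (L z) (L' z)) 0.
  move=> By; have [[_ dl hl0] [_ dl' hl0']] := Br y By.
  have [n1 n2] := unit y By.
  have t1 := unit_dot v oB (fun z Bz => (unit z Bz).1) By dl.
  have t2 := unit_dot v oB (fun z Bz => (unit z Bz).2) By dl'.
  have [e1 _] := orth n1 (tr y By) t1 (hl0 v).
  have [e2 _] := orth n2 (tr' y By) t2 (hl0' v).
  have := is_derive_dot v dl dl'; rewrite -/L -/L' e1 dotC e2 addr0; exact.
have Do y v : B y -> is_derive y v (fun z => omega0 (L z) (L' z)) 0.
  move=> By; have [[_ dl hl0] [_ dl' hl0']] := Br y By.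
  have [n1 n2] := unit y By.
  have t1 := unit_dot v oB (fun z Bz => (unit z Bz).1) By dl.
  have t2 := unit_dot v oB (fun z Bz => (unit z Bz).2) By dl'.
  have [_ e1] := orth n1 (tr y By) t1 (hl0 v).
  have [_ e2] := orth n2 (tr' y By) t2 (hl0' v).
  have := is_derive_omega v dl dl'; rewrite -/L -/L' e1 omegaC e2 oppr0 addr0; exact.
have By0 : B y0 by exact: ballxx.
have [c cE] := tr y0 By0.
exists c.
have cB y : B y -> L' y = phase c (L y).
  move=> By; have [c' c'E] := tr y By; rewrite c'E.
  have [n1 _] := unit y By; have [m1 _] := unit y0 By0.
  have := derive0_ball Dd By; have := derive0_ball Do By; rewrite /= c'E cE.
  rewrite !phase_cos_sin !omegaDr !omegaZr !dotDr !dotZr !omega_J !omega_self.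
  rewrite !(dotC _ (Jc _)) !dot_Jself -!normsqE n1 m1 !mulr0 !mulr1 !add0r !addr0.
  by move=> s_eq c_eq; rewrite c_eq s_eq.
have nB0 : nbhs y0 B by exact: open_nbhs_nbhs.
apply: filterS (chart_near ix nB0) => x' [ix' Bx'].
by have := cB _ Bx'; rewrite /L /L' /= chartK.
Qed.

Lemma local_section i j x : dom i x -> Uset j (f x) ->
  exists (r : R) (th : E -> R) (l : Sigma -> Cn R n),
  [/\ 0 < r, ball (chart i x) r `<=` coord_dom i j,
    forall k, Ck k (ball (chart i x) r) th /\ Ck k (ball (chart i x) r) (l \o param i),
    forall y v, ball (chart i x) r y ->
      'D_v th y = tau j (coord_map i j y) ('D_v (coord_map i j) y) &
    forall y, ball (chart i x) r y ->
      hor (param i y) l /\ l (param i y) = Psi j (coord_map i j y, th y)].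
Proof.
move=> ix jx; have [r [th [r0 BU Cth Dth]]] := horizontal_angle ix jx.
have [oU CF] := coord_map_smooth i j.
pose B := ball (chart i x) r; have oB : open B by exact: ball_open.
pose l x' := Psi j (psi_inv j (f x'), th (chart i x')).
have lE y : B y -> l (param i y) = Psi j (coord_map i j y, th y).
  by move=> /BU/coord_domP[_ cy _ _]; rewrite /l cy.
have CF' k : Ck k B (coord_map i j) by exact: Ck_sub BU (CF k).
have FB y : B y -> hball (coord_map i j y) by move=> /BU/coord_domP[].
have Ch k : Ck k B (hsect j \o coord_map i j).
  exact: (Ck_hsect_comp j oB FB (CF' k)).
have Cl k : Ck k B (l \o param i).
  by apply: Ck_eq (Ck_phase oB (Cth k) (Ch k)) => // y By; rewrite /= lE.
exists r, th, l; split=> // y By; split; last exact: lE.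
have [iy cy jy _] := coord_domP (BU y By).
exists i => //; rewrite cy.
have nB : \forall z \near y, B z by exact: open_nbhs_nbhs.
apply: filterS nB => z Bz; have [iz cz jz hz] := coord_domP (BU z Bz).
have dl := Ck_diff (Cl 1%N) Bz.
split=> // [|v]; first by rewrite lE//; exact: over_hopf_Psi.
rewrite lE//.
have nE : \forall z' \near z, (l \o param i) z' = phase (th z') ((hsect j \o coord_map i j) z').
  have nBz : \forall z' \near z, B z' by exact: open_nbhs_nbhs.
  by apply: filterS nBz => z' Bz' /=; rewrite lE.
rewrite (near_eq_derive v nE).
have dh := Ck_diff (Ch 1%N) Bz; have dt := Ck_diff (Cth 1%N) Bz.
rewrite (derive_phase v dt dh (diff_phase dt dh)).
have -> : 'D_v (hsect j \o coord_map i j) z = 'D_('D_v (coord_map i j) z) (hsect j) (coord_map i j z).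
  have dF := Ck_diff (CF' 1%N) Bz; have ds := hsect_diff j hz.
  by rewrite deriveE ?diff_comp//= ?deriveE//; exact: differentiable_comp.
rewrite Dth//.
have := omega_hsect_dhsect j ('D_v (coord_map i j) z) hz.
move: ('D_('D_v _ z) _ _) (tau _ _ _) => a t at_.
rewrite omegaDr omegaZr omega_J -normsqE /Psi/= omega_phase normsq_phase at_.
by rewrite normsq_hsect// mulr1 addNr.
Qed.

Lemma hor_ex x : exists l, hor x l.
Proof.
have [i ix] := chart_cover x; have [j jx] := Uset_cover (f x).
have [r [th [l [r0 _ _ _ /(_ (chart i x) (ballxx _ r0))]]]] := local_section ix jx.
by rewrite chartK// => -[hl _]; exists l.
Qed.

End HorizontalSections.

(** * Integrals along subdivided intervals *)

Section IntegralsOnIntervals.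
Context {R : realType}.
Local Notation mu := (@lebesgue_measure R).

(** The degenerate intervals at u 0 are a separate assumption because there may be
    no piece at all. *)
Lemma partition_induction (P : R -> R -> Prop) (u : nat -> R) (m : nat) :
  (forall x y z, x <= y -> y <= z -> P x y -> P y z -> P x z) ->
  (forall k, (k < m)%N -> u k <= u k.+1) ->
  (forall k c d, (k < m)%N -> u k <= c -> c <= d -> d <= u k.+1 -> P c d) ->
  (forall c, c = u 0%N -> P c c) ->
  forall c d, u 0%N <= c -> c <= d -> d <= u m -> P c d.
Proof.
move=> add; elim: m => [|m IH] um pieces P0 c d uc cd du.
  have c0 : c = u 0%N by lra.
  by have -> : d = c by [lra]; exact: P0.
have um' k : (k < m)%N -> u k <= u k.+1 by move=> km; apply: um; exact: ltnW.
have pieces' k c' d' : (k < m)%N -> u k <= c' -> c' <= d' -> d' <= u k.+1 -> P c' d'.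
  by move=> km; apply: pieces; exact: ltnW.
have [dm|md] := leP d (u m); first exact: (IH um' pieces' P0).
have [cm|mc] := leP c (u m); last first.
  exact: (pieces m c d (ltnSn m) (ltW mc) cd du).
apply: (add c (u m) d cm (ltW md)); first exact: (IH um' pieces' P0 c (u m) uc cm).
exact: (pieces m (u m) d (ltnSn m) (lexx _) (ltW md) du).
Qed.

Let mitv (a b : itv_bound R) : measurable [set` Interval a b].
Proof. exact: measurable_itv. Qed.

Lemma integrable_cat (T : R -> R) (x y z : R) : x <= y -> y <= z ->
  mu.-integrable `[x, y] (EFin \o T) -> mu.-integrable `[y, z] (EFin \o T) ->
  mu.-integrable `[x, z] (EFin \o T) /\
  \int[mu]_(u in `[x, z]) T u = \int[mu]_(u in `[x, y]) T u + \int[mu]_(u in `[y, z]) T u.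
Proof.
move=> xy yz i1 i2.
have i2' : mu.-integrable `]y, z] (EFin \o T).
  by apply: integrableS i2 => //; apply: subset_itvr; rewrite bnd_simp.
have E : `[x, z]%classic = `[x, y]%classic `|` `]y, z]%classic :> set R.
  by apply: itv_bndbnd_setU; rewrite bnd_simp.
have D : [disjoint `[x, y]%classic & `]y, z]%classic : set R].
  apply/disj_setPS => u [/=]; rewrite !in_itv/= => /andP[_ uy] /andP[].
  by rewrite ltNge uy.
have i : mu.-integrable `[x, z] (EFin \o T).
  have /integrableP[m1 f1] := i1; have /integrableP[m2 f2] := i2'.
  have mT := (measurable_funU _ (mitv _ _) (mitv _ _)).2 (conj m1 m2).
  rewrite E; apply/integrableP; split; first exact: mT.
  rewrite ge0_integral_setU//=.
  - by rewrite lte_add_pinfty.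
  - apply/measurable_EFinP; apply: measurableT_comp => //; exact/measurable_EFinP.
split=> //; rewrite E Rintegral_setU// -?E//.
by congr (_ + _); rewrite Rintegral_itv_obnd_cbnd.
Qed.

(** T need not agree with the derivative h of g at the ends: there the path from
    which T comes may have a corner. *)
Lemma FTC_itv (g h T : R -> R) (c d : R) : c <= d ->
  (forall u, c <= u <= d -> is_derive u (1 : R) g (h u) /\ {for u, continuous h}) ->
  (forall u, c < u < d -> T u = h u) ->
  mu.-integrable `[c, d] (EFin \o T) /\ \int[mu]_(u in `[c, d]) T u = g d - g c.
Proof.
rewrite le_eqVlt => /predU1P[<- _ _|cd gh Th].
  rewrite set_itv1 Rintegral_set1 subrr; split=> //.
  apply/integrableP; split; first exact: measurable_fun_set1.
  by rewrite integral_set1.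
have hc : {within `[c, d], continuous h}.
  apply: continuous_in_subspaceT => u /set_mem/=; rewrite in_itv/= => ucd.
  by case: (gh u ucd).
have ih : mu.-integrable `[c, d] (EFin \o h).
  by apply: continuous_compact_integrable => //; exact: segment_compact.
have iToo : mu.-integrable `]c, d[ (EFin \o T).
  apply: (@eq_integrable _ _ _ mu `]c, d[%classic _ (EFin \o h)) => //.
    by move=> u /set_mem/=; rewrite in_itv/= => ucd; rewrite Th.
  by apply: integrableS ih => //; exact: subset_itv_oo_cc.
have /integrableP[/emeasurable_fun_itv_cc mT _] := iToo.
have iT : mu.-integrable `[c, d] (EFin \o T).
  apply/(@negligible_integrable _ _ _ mu `[c, d]%classic ([set c] `|` [set d])) => //.
  - by apply: measurableU; exact: measurable_set1.
  - apply: countable_lebesgue_measure0; apply: finite_set_countable.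
    by rewrite finite_setU; split; exact: finite_set1.
  - apply: integrableS iToo => //.
      by apply: measurableD => //; apply: measurableU; exact: measurable_set1.
    move=> u /=; rewrite !in_itv/= => -[/andP[cu ud] /not_orP[uc ud']].
    by rewrite !lt_neqAle cu ud !andbT; apply/andP; split; apply/eqP => // e; apply: uc.
split=> //.
rewrite -Rintegral_itv_bndo_bndc; last first.
  by apply: integrableS iT => //; apply: subset_itvl; rewrite bnd_simp.
rewrite -Rintegral_itv_obnd_cbnd//.
rewrite (@eq_Rintegral _ _ _ mu _ h); last first.
  by move=> u /set_mem/=; rewrite in_itv/= => ucd; rewrite Th.
rewrite Rintegral_itv_obnd_cbnd; last first.
  by apply: integrableS ih => //; exact: subset_itv_oo_cc.
rewrite Rintegral_itv_bndo_bndc; last first.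
  by apply: integrableS ih => //; apply: subset_itvl; rewrite bnd_simp.
have cont u : c <= u <= d -> {for u, continuous g}.
  by move=> /gh[[dg _] _]; exact/differentiable_continuous/derivable1_diffP.
rewrite /Rintegral (@continuous_FTC2 _ h g c d)//.
- split.
  + by move=> u; rewrite in_itv/= => /andP[/ltW cu /ltW ud]; have [|[]] := gh u; rewrite ?cu.
  + by apply: cvg_at_right_filter; apply: cont; rewrite lexx ltW.
  + by apply: cvg_at_left_filter; apply: cont; rewrite lexx ltW.
- move=> u; rewrite in_itv/= => /andP[/ltW cu /ltW ud].
  by rewrite derive1E; have [|[]] := gh u; rewrite ?cu.
Qed.

Lemma derive_path (m : nat) (W : set R) (B : set 'rV[R]_m) (y : R -> 'rV[R]_m)
    (th : 'rV[R]_m -> R) : open W -> open B -> (forall u, W u -> B (y u)) ->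
  Ck 1 W y -> Ck 1 B th ->
  forall u, W u -> is_derive u (1 : R) (th \o y) ('D_('D_1 y u) th (y u)) /\
    {for u, continuous (fun u => 'D_('D_1 y u) th (y u))}.
Proof.
move=> oW oB WB Cy Cth.
have DE u : W u -> 'D_('D_1 y u) th (y u) =
    \sum_k ('D_1 y u) ord0 k * 'D_(delta_mx ord0 k) th (y u).
  move=> Wu; have dth := Ck_diff Cth (WB u Wu).
  rewrite (deriveE _ dth) {1}(row_sum_delta ('D_1 y u)) linear_sum.
  by apply: eq_bigr => k _; rewrite linearZ (deriveE _ dth).
move=> u Wu; have dy := Ck_diff Cy Wu; have dth := Ck_diff Cth (WB u Wu).
split.
  have dc : differentiable (th \o y) u by exact: differentiable_comp.
  apply: DeriveDef; first exact/derivable1_diffP.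
  by rewrite (deriveE _ dc) (diff_comp dy dth) (deriveE _ dth) (deriveE _ dy).
have nW : \forall v \near u, W v by exact: open_nbhs_nbhs.
suff : Ck 0 W (fun u => 'D_('D_1 y u) th (y u)) by exact.
apply: (@Ck_eq _ _ _ _ _ (fun u => \sum_k ('D_1 y u) ord0 k * 'D_(delta_mx ord0 k) th (y u))) => //.
  by move=> v Wv; rewrite DE.
apply: Ck_sum => // k; apply: CkM => //.
  move=> v Wv; apply: (continuous_comp (f := 'D_1 y) (g := fun x : 'rV[R]_m => x ord0 k)).
    exact: (Ck_cont (Ck_derive (1 : R) Cy) Wv).
  exact: coord_continuous.
move=> v Wv; apply: (continuous_comp (f := y) (g := 'D_(delta_mx ord0 k) th)).
  exact: (Ck_cont Cy Wv).
exact: (Ck_cont (Ck_derive _ Cth) (WB v Wv)).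
Qed.

End IntegralsOnIntervals.

(** * The lifting integral is the holonomy *)

Section LiftingIntegral.
Context {R : realType} {n : nat} {Sigma : topologicalType}.
Variables (A : atlas Sigma 'rV[R]_n.-1) (f : Sigma -> CP R n).
Hypothesis hSigma : smooth_manifold A.
Hypothesis hf : lagrangian_immersion A f.
Local Notation mu := (@lebesgue_measure R).

Lemma smooth_curve_chart (D : set R) (eta : R -> Sigma) (u0 : R)
    (i : chart_index A) :
  smooth_map (euclid R) A D eta -> D u0 -> dom i (eta u0) ->
  exists W : set R, [/\ open W, W u0, forall u, W u -> dom i (eta u) &
    forall k, Ck k W (chart i \o eta)].
Proof.
move=> /(_ tt i)[oT CT] Du0 iu0.
exists (id @` ([set: R] `&` D `&` eta @^-1` dom i)); split=> //.
- by exists u0.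
- by move=> _ [u [_ iu] <-].
Qed.

Lemma smooth_curve_continuous (D : set R) (eta : R -> Sigma) (u0 : R) :
  smooth_map (euclid R) A D eta -> D u0 -> {for u0, continuous eta}.
Proof.
move=> se Du0; have [i iu0] := chart_cover hSigma (eta u0).
have [W [oW Wu0 Wi CW]] := smooth_curve_chart se Du0 iu0.
have c1 : {for u0, continuous (param i \o (chart i \o eta))}.
  apply: continuous_comp; first exact: (Ck_cont (CW 0%N) Wu0).
  exact: (param_continuous hSigma iu0).
have nW : \forall u \near u0, W u by exact: open_nbhs_nbhs.
have cE : (param i \o (chart i \o eta)) u0 = eta u0 by rewrite /= (chartK hSigma iu0).
move=> U nU; rewrite -cE in nU; have := c1 U nU.
apply: filterS2 nW => u Wu; rewrite /= (chartK hSigma)//; exact: Wi.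
Qed.

Lemma piecewise_smooth_continuous (gamma : R -> Sigma) : piecewise_smooth A gamma ->
  {within [set` `[0 : R, 1]], continuous gamma}.
Proof.
move=> [m [u [u0 um pieces]]].
have := @partition_induction R (fun c d => {within [set` `[c, d]], continuous gamma}) u m.
rewrite u0 um => /(_ _ _ _ _ 0 1); apply; rewrite ?lexx//.
- move=> x y z xy yz c1 c2.
  have -> : `[x, z]%classic = `[x, y]%classic `|` `[y, z]%classic :> set R.
    apply/seteqP; split=> v /=; rewrite !in_itv/=.
      move=> /andP[xv vz]; have [vy|yv] := leP v y; first by left; rewrite xv.
      by right; rewrite (ltW yv).
    by move=> [/andP[xv vy]|/andP[yv vz]]; apply/andP; split; lra.
  by apply: withinU_continuous => //; exact: itv_closed.
- by move=> k /pieces[/ltW].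
- move=> k c d km uc cd du; have [_ [D [eta [se sD eg]]]] := pieces k km.
  have sub v : v \in `[c, d] -> v \in `[u k, u k.+1].
    by rewrite !in_itv/= => /andP[cv vd]; apply/andP; split; lra.
  apply: (@subspace_eq_continuous _ _ _ eta) => [v /set_mem vcd|].
    exact/eg/sub.
  apply: continuous_in_subspaceT => v /set_mem vcd.
  exact/(smooth_curve_continuous se)/sD/sub.
- by move=> c ->; rewrite set_itv1; exact: continuous_subspace1.
Qed.

Section Piece.
Variables (gamma : R -> Sigma) (p : R -> Cn R n) (j : 'I_n).
Hypothesis cgamma : continuous (gamma \o clamp).
Hypothesis lp : forall u, 0 <= u <= 1 -> lift_at (hor A f) (gamma \o clamp) p u.
Let cc : R -> Cn R n.-1 := psi_inv j \o f \o gamma.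
Let T (u : R) : R := tau j (cc u) (derive1 cc u).

(** Along [c, d] the phase of the lift p in the trivialization Psi_j increases by the
    integral of tau_j. *)
Let transport (c d : R) : Prop := mu.-integrable `[c, d] (EFin \o T) /\
  forall t, p c = Psi j (cc c, t) ->
    p d = Psi j (cc d, t + \int[mu]_(u in `[c, d]) T u).

Let transport_add x y z : x <= y -> y <= z -> transport x y -> transport y z -> transport x z.
Proof.
move=> xy yz [i1 t1] [i2 t2]; have [i e] := integrable_cat xy yz i1 i2.
by split=> // t /t1/t2; rewrite e addrA.
Qed.

Let Psi_eqmod (c : CP R n) (s t : R) : Uset j c -> Psi j (psi_inv j c, s) = Psi j (psi_inv j c, t) ->
  eqmod2pi s t.
Proof.
move=> jc e; apply/eqmod2pi0P.
apply/(@phase_fix _ _ _ (Psi j (psi_inv j c, t))).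
  exact: (over_hopf_norm (over_hopf_Psi t jc)).
by rewrite -[RHS]e /Psi/= phaseD subrK.
Qed.

(** Near each time the lift p is a constant phase times a local section
    Psi_j (g, th) with d th = g^* tau_j, so the phase of p changes by the increment
    of th along the curve, which is the integral of its derivative. *)
Lemma transport_smooth (D : set R) (eta : R -> Sigma) (c d : R) :
  smooth_map (euclid R) A D eta -> [set` `[c, d]] `<=` D ->
  (forall u, u \in `[c, d] -> eta u = gamma u) ->
  (forall u, u \in `[c, d] -> Uset j (f (gamma u))) ->
  0 <= c -> c <= d -> d <= 1 -> transport c d.
Proof.
move=> se sD eg jg c0 cd d1; apply: (interval_induction cd).
  by move=> x y z _ xy yz _; exact: transport_add.
move=> u0 u0cd; have u0i : u0 \in `[c, d] by rewrite in_itv.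
have /andP[cu0 u0d] := u0cd.
have u001 : 0 <= u0 <= 1 by apply/andP; split; lra.
have Du0 := sD _ u0i; have gu0 := eg _ u0i; have ju0 := jg _ u0i.
have [i iu0] := chart_cover hSigma (eta u0).
have [W [oW Wu0 Wi CW]] := smooth_curve_chart se Du0 iu0.
rewrite -gu0 in ju0.
have [r [th [l [r0 BU Cthl Dth hl]]]] := local_section hSigma hf iu0 ju0.
pose y := chart i \o eta; pose B := ball (chart i (eta u0)) r.
have oB : open B by exact: ball_open.
have [l0 hl0 pl0] := lp u001.
have e0 : (gamma \o clamp) u0 = eta u0 by rewrite /= clamp_id.
have hlu0 : hor A f (eta u0) l.
  have := (hl (chart i (eta u0)) (ballxx _ r0)).1.
  by rewrite (chartK hSigma iu0).
rewrite e0 in hl0.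
have [a la] := hor_unique hSigma hlu0 hl0.
have n1 : \forall u \near u0, B (y u).
  have cy : {for u0, continuous y} := Ck_cont (CW 0%N) Wu0.
  by apply: (near_continuous cy); apply: open_nbhs_nbhs; split=> //; exact: ballxx.
have n2 : \forall u \near u0, W u by exact: open_nbhs_nbhs.
have n3 : \forall u \near u0, p u = phase a (l (gamma (clamp u))).
  have la' : \forall x \near (gamma \o clamp) u0, l0 x = phase a (l x) by rewrite e0.
  have := near_continuous (@cgamma u0) la'; apply: filterS2 pl0 => u pu lu.
  by rewrite pu lu.
have n123 : nbhs u0 [set u | B (y u) /\ W u /\ p u = phase a (l (gamma (clamp u)))].
  exact: filterI n1 (filterI n2 n3).
move: n123 => /nbhs_ballP[e /= e_gt0 Be].
exists e => // c' d' cc' cd' dd' ec ed.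
have inb u : c' <= u <= d' -> ball u0 e u.
  by move=> /andP[cu ud]; rewrite /ball/= ltr_distl; apply/andP; split; lra.
pose W' := ball u0 e.
have oW' : open W' by exact: ball_open.
have WB u : W' u -> B (y u) by move=> /Be[].
have CW' : Ck 1 W' y by apply: Ck_sub (CW 1%N) => u /Be[_ []].
have Cth : Ck 1 B th := (Cthl 1%N).1.
have yK u : W' u -> param i (y u) = eta u.
  by move=> /Be[_ [Wu _]]; rewrite /y /= (chartK hSigma)//; exact: Wi.
pose h u := 'D_('D_(1 : R) y u) th (y u).
have [oU CF] := coord_map_smooth hf i j.
have TE u : c' < u < d' -> T u = h u.
  move=> /andP[cu ud]; have W'u : W' u by apply: inb; rewrite !ltW.
  have Uy := BU _ (WB u W'u).
  have dF := Ck_diff (CF 1%N) Uy; have dy := Ck_diff CW' W'u.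
  have nE : \forall v \near u, (coord_map f i j \o y) v = cc v.
    have m1 : \forall v \near u, W' v by exact: open_nbhs_nbhs.
    have m2 : nbhs u `]c', d'[%classic.
      by apply: open_nbhs_nbhs; split; [exact: itv_open|rewrite /= in_itv/= cu].
    apply: filterS2 m1 m2 => v W'v /=; rewrite in_itv/= => /andP[cv vd].
    by rewrite /coord_map /cc /= yK// eg// in_itv/=
      (le_trans cc' (ltW cv)) (le_trans (ltW vd) dd').
  have cE : cc u = coord_map f i j (y u) by rewrite -(nbhs_singleton nE).
  have dE : derive1 cc u = 'D_('D_(1 : R) y u) (coord_map f i j) (y u).
    rewrite derive1E; apply: etrans (esym (near_eq_derive (1 : R) nE)) _.
    have dc : differentiable (coord_map f i j \o y) u by exact: differentiable_comp.
    by rewrite (deriveE _ dc) (diff_comp dy dF) (deriveE _ dF) (deriveE _ dy).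
  by rewrite /T /h cE dE (Dth _ _ (WB u W'u)).
have [iT IT] := FTC_itv cd'
  (fun u ucd => derive_path oW' oB WB CW' Cth (inb u ucd)) TE.
split; first exact: iT.
rewrite IT => t.
have pE u : c' <= u <= d' -> p u = Psi j (cc u, a + th (y u)) /\ Uset j (f (gamma u)).
  move=> ucd; have [By [_ ->]] := Be _ (inb u ucd).
  have /andP[cu ud] := ucd.
  have uin : u \in `[c, d] by rewrite in_itv/= (le_trans cc' cu) (le_trans ud dd').
  split; last exact: jg.
  have u01 : 0 <= u <= 1.
    by rewrite (le_trans c0 (le_trans cc' cu)) (le_trans ud (le_trans dd' d1)).
  rewrite (clamp_id u01).
  rewrite -(eg u uin) -(yK u (inb u ucd)) (hl _ By).2 /Psi/= phaseD.
  by rewrite /coord_map /cc /= (yK u (inb u ucd)) (eg u uin).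
have [-> jc'] := pE c' (introT andP (conj (lexx c') cd')).
have [-> _] := pE d' (introT andP (conj cd' (lexx d'))) => pt.
have [k ke] := Psi_eqmod jc' pt.
have [cE sE] : cos (a + th (y d')) = cos (t + (th (y d') - th (y c'))) /\
    sin (a + th (y d')) = sin (t + (th (y d') - th (y c'))).
  by apply: eqmod2pi_cos_sin; exists k; rewrite -ke; ring.
exact: phase_eq.
Qed.

End Piece.

Section Path.
Variables (gamma : R -> Sigma) (p : R -> Cn R n).
Hypothesis sgamma : piecewise_smooth A gamma.
Hypothesis lp : forall u, 0 <= u <= 1 -> lift_at (hor A f) (gamma \o clamp) p u.

Let cgamma : continuous (gamma \o clamp).
Proof. exact/within_clamp/piecewise_smooth_continuous. Qed.

(** The break points of gamma and those of the subdivision in the lifting integral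
    are unrelated: a piece of the latter is cut at the break points of gamma. *)
Lemma transport_piecewise j (c d : R) :
  (forall u, u \in `[c, d] -> Uset j (f (gamma u))) ->
  0 <= c -> c <= d -> d <= 1 ->
  let cc : R -> Cn R n.-1 := psi_inv j \o f \o gamma in
  forall t, p c = Psi j (cc c, t) ->
    p d = Psi j (cc d, t + \int[mu]_(u in `[c, d]) tau j (cc u) (derive1 cc u)).
Proof.
move=> jg c0 cd d1 cc.
pose T (u : R) : R := tau j (cc u) (derive1 cc u).
pose Q x y := mu.-integrable `[x, y] (EFin \o T) /\
  forall t, p x = Psi j (cc x, t) -> p y = Psi j (cc y, t + \int[mu]_(u in `[x, y]) T u).
suff [] : Q c d by [].
have [m [u [u0 um pieces]]] := sgamma.
have := @partition_induction R (fun x y => c <= x -> y <= d -> Q x y) u m.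
rewrite u0 um => /(_ _ _ _ _ c d c0 cd d1); apply; rewrite ?lexx//.
- move=> x y z xy yz q1 q2 cx zd.
  have [i1 t1] := q1 cx (le_trans yz zd); have [i2 t2] := q2 (le_trans cx xy) zd.
  have [i e] := integrable_cat xy yz i1 i2.
  by split=> // t /t1/t2; rewrite e addrA.
- by move=> k /pieces[/ltW].
- move=> k x y km ux xy yu cx yd; have [_ [D [eta [se sD eg]]]] := pieces k km.
  have sub v : v \in `[x, y] -> v \in `[u k, u k.+1].
    by rewrite !in_itv/= => /andP[xv vy]; apply/andP; split; lra.
  apply: (transport_smooth cgamma lp se _ _ _ _ xy).
  + by move=> v /sub/sD.
  + by move=> v /sub/eg.
  + by move=> v; rewrite in_itv/= => /andP[xv vy]; apply: jg; rewrite in_itv/=; apply/andP; split; lra.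
  + lra.
  + lra.
- move=> x -> _ _; rewrite /Q set_itv1 Rintegral_set1; split; last by move=> t; rewrite addr0.
  apply/integrableP; split; first exact: measurable_fun_set1.
  by rewrite integral_set1.
Qed.

Lemma lift_sum_transport (s : nat -> R) (j : nat -> 'I_n) (m : nat) (a : R) :
  subordinate f gamma s j m ->
  p 0 = Psi (j 0%N) (psi_inv (j 0%N) (f (gamma 0)), a) ->
  p 1 = Psi (j m) (psi_inv (j m) (f (gamma 1)), lift_sum f gamma s j a m).
Proof.
move=> [s0 s1 sj] p0; rewrite -s1.
have s_incr k : (k <= m)%N -> s k <= s k.+1 by move=> /sj[/ltW].
have s_ge0 k : (k <= m.+1)%N -> 0 <= s k.
  elim: k => [|k IH] km; first by rewrite s0.
  by apply: le_trans (IH (ltnW km)) _; apply: s_incr.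
have s_le1 k : (k <= m.+1)%N -> s k <= 1.
  move=> km; rewrite -s1 -(subKn km); elim: (m.+1 - k)%N => [|q IH]; first by rewrite subn0.
  apply: le_trans IH; have [qm|mq] := ltnP q m.+1; last first.
    by rewrite (eqP (mq : m.+1 - q == 0)%N) (eqP (leqW mq : m.+1 - q.+1 == 0)%N).
  by rewrite -(subnSK qm); apply: s_incr; rewrite subSS leq_subr.
suff claim k : (k <= m)%N -> p (s k.+1) =
    Psi (j k) (psi_inv (j k) (f (gamma (s k.+1))), lift_sum f gamma s j a k) by exact: claim.
elim: k => [_|k IH km].
  have [_ jk] := sj 0%N (leq0n _).
  have := transport_piecewise jk (s_ge0 0%N isT) (s_incr 0%N isT) (s_le1 1%N isT).
  by rewrite /= s0 => /(_ a p0); rewrite addrC /tau_int s0.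
have pk := IH (ltnW km).
have [_ jk] := sj k.+1 km; have [_ jk'] := sj k (ltnW km).
have := transport_piecewise jk (s_ge0 k.+1 (ltnW km)) (s_incr _ km) (s_le1 k.+2 km).
move=> /(_ _ _)/=; rewrite addrC; apply.
have U1 : Uset (j k.+1) (f (gamma (s k.+1))).
  by apply: jk; rewrite in_itv/= lexx s_incr.
have U0 : Uset (j k) (f (gamma (s k.+1))).
  by apply: jk'; rewrite in_itv/= lexx s_incr// ltnW.
by rewrite pk (Psi_transP _ U0 U1).
Qed.

End Path.

(** The angle t of the initial point in the first trivialization is removed by
    rotating the whole lift; as the first and the last chart agree, the same
    section is the origin of angles at both ends. *)
Lemma lifting_integral_transport (gamma : R -> Sigma) (p : R -> Cn R n) (v : R) :
  piecewise_smooth A gamma ->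
  (forall u, 0 <= u <= 1 -> lift_at (hor A f) (gamma \o clamp) p u) ->
  f (gamma 0) = f (gamma 1) -> lifting_integral f gamma v -> p 1 = phase v (p 0).
Proof.
move=> sg lp f01 [m [s [j [sub jm [k vk]]]]].
have [s0 _ sj] := sub.
have U0 : Uset (j 0%N) (f (gamma 0)).
  have [lt01 j0] := sj 0%N (leq0n _); apply: j0; rewrite s0 in lt01 *.
  by rewrite in_itv/= lexx ltW.
have ov0 : over_hopf (f (gamma 0)) (p 0).
  have z01 : 0 <= (0 : R) <= 1 by rewrite lexx ler01.
  by have := @lift_over _ _ (fun x w => over_hopf (f x) w) _ (hor_over hSigma) _ _ _ _ (lp 0 z01); rewrite /= clamp_id.
have [t pt] := over_hopf_trans ov0 (over_hopf_Psi 0 U0).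
have lpt u : 0 <= u <= 1 -> lift_at (hor A f) (gamma \o clamp) (phase t \o p) u.
  by move=> u01; by apply: (@lift_at_act _ _ _ (@phase R n) _ (@hor_act _ _ _ _ _)); exact: lp.
have := lift_sum_transport sg lpt sub (esym pt).
rewrite jm -f01 => p1.
have E : phase t (p 1) = phase t (phase v (p 0)).
  rewrite [LHS]p1 phaseD addrC -phaseD -pt /Psi/= phaseD addr0.
  have [c1 c2] := eqmod2pi_cos_sin (ex_intro _ k vk : eqmod2pi _ _).
  exact/esym/phase_eq.
have := f_equal (phase (- t)) E; by rewrite [LHS]phaseD [RHS]phaseD addNr !phase0.
Qed.

End LiftingIntegral.

(** * Tangent vectors of submanifolds *)

Section TangentVectors.
Context {R : realType} {n : nat}.
Local Notation V := (Cn R n).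

Lemma Cn_linear_continuous (W : normedModType R) (L : {linear V -> W}) : continuous L.
Proof.
pose er i : V := (delta_mx ord0 i, 0); pose ei i : V := (0, delta_mx ord0 i).
have LE : (L : V -> W) = fun w => \sum_i (re i w *: L (er i) + im i w *: L (ei i)).
  apply/funext => w; rewrite {1}(Cn_decomposition w) linear_sum.
  by apply: eq_bigr => i _; rewrite linearD !linearZ.
rewrite LE; apply: continuous_big => [|i _ w]; first exact: add_continuous.
apply: cvgD; apply: cvgZr_tmp.
  exact: re_continuous.
exact: im_continuous.
Qed.

Lemma Cn_linear_bound (W : normedModType R) (L : {linear V -> W}) :
  exists2 K, 0 < K & forall w, `|L w| <= K * `|w|.
Proof.
have cL := @Cn_linear_continuous W L.
have /linear_boundedP[K [_ LK]] := (linear_bounded_continuous L).2 cL.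
exists (`|K| + 1); first by rewrite ltr_wpDl.
by apply: LK; rewrite (le_lt_trans (ler_norm K))// ltrDl.
Qed.

(** An injective linear map has a linear left inverse, which is bounded. *)
Lemma injective_linear_bound m (g : {linear 'rV[R]_m -> V}) : injective g ->
  exists2 K, 0 < K & forall w, `|w| <= K * `|g w|.
Proof.
move=> ig; have k0 : lker (linfun g) == 0%VS.
  by apply/lker0P => u w; rewrite !lfunE; exact: ig.
pose h : V -> 'rV[R]_m := (linfun g)^-1%VF.
have lh : linear h by move=> a u v; rewrite /h linearP.
pose h' : {linear V -> 'rV[R]_m} := HB.pack h (GRing.isLinear.Build R V 'rV[R]_m *:%R h lh).
have [K K0 gK] := Cn_linear_bound h'.
exists K => // w; have := gK (g w).
by rewrite -[g w](lfunE g) /= /h lker0_lfunK.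
Qed.

Lemma local_approx (E : normedModType R) (phi : E -> V) (y0 : E) (e : R) : 0 < e ->
  differentiable phi y0 ->
  \forall y \near y0, `|phi y - phi y0 - 'd phi y0 (y - y0)| <= e * `|y - y0|.
Proof.
move=> e0 dphi; have /eqaddoP/(_ e e0)/nbhs_ballP[d /= d0 dP] := diff_locally dphi.
apply/nbhs_ballP; exists d => //= y yd.
have yd' : ball (0 : E) d (y - y0).
  by move: yd; rewrite -!ball_normE /= sub0r opprB.
have <- : phi (y - y0 + y0) - (phi y0 + 'd phi y0 (y - y0)) =
    phi y - phi y0 - 'd phi y0 (y - y0) by rewrite subrK opprD addrA.
exact: dP _ yd'.
Qed.

(** A velocity vector of a curve in S is a limit of secants, and near phi y0 these
    are the vectors phi y - phi y0, where |y - y0| is bounded by a multiple of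
    |phi y - phi y0| as the differential of phi is injective.  Hence a linear form
    that vanishes on the image of the differential is o(1) on unit secants. *)
Lemma tangent_annihilator m (S : set V) (U : set 'rV[R]_m) phi y0
    (L : {linear V -> R}) v : local_param S U phi -> U y0 ->
  (forall w, L ('d phi y0 w) = 0) -> tangent S (phi y0) v -> L v = 0.
Proof.
move=> [[oU Cphi] inj_d _ opn] Uy0 L0 [I [c [[oI Cc] I0 cS c0 <-]]].
have dphi := Ck_diff (Cphi 1%N) Uy0.
have dc := Ck_diff (Cc 1%N) I0.
have [K K0 gK] := injective_linear_bound (inj_d _ Uy0).
have [M M0 LM] := Cn_linear_bound L.
rewrite derive1E; set w := 'D_1 c 0.
have quot : (fun h : R => h^-1 *: (c h - c 0)) @ (0 : R)^' --> w.
  have E : (fun h : R => h^-1 *: ((c \o shift 0) (h *: (1 : R)) - c 0)) =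
      (fun h : R => h^-1 *: (c h - c 0)).
    by apply/funext => h; rewrite /= addr0; congr (_ *: (c _ - _)); exact: mulr1.
  by rewrite -E; exact: (@diff_derivable _ _ _ c 0 (1 : R) dc).
(* if phi is e-close to its differential, then |L x| <= 2 M e K |x| on secants x;
   the restriction on e ensures |y - y0| <= 2 K |phi y - phi y0| *)
suff secant (e : R) : 0 < e -> e * K <= 2^-1 -> `|L w| <= M * (e * (K * 2)) * `|w|.
  apply/eqP; rewrite -normr_le0; apply/ler_addgt0Pr => e e0; rewrite add0r.
  (* 1 / D is a closeness for which the bound is at most e *)
  pose D := 2 * K + M * (K * 2) * (`|w| + 1) / e.
  have D0 : 0 < D.
    by rewrite addr_gt0 ?mulr_gt0 ?invr_gt0// ltr_wpDl.
  have De : D^-1 * K <= 2^-1.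
    rewrite mulrC ler_pdivrMr// mulrDr mulKf// lerDl.
    by rewrite !mulr_ge0 ?invr_ge0 ?addr_ge0// ltW.
  apply: (le_trans (secant D^-1 _ De)); first by rewrite invr_gt0.
  rewrite mulrCA mulrAC -!mulrA mulrC ler_pdivrMr//.
  have -> : e * D = e * (2 * K) + M * (K * 2) * (`|w| + 1).
    by rewrite /D; field; exact: lt0r_neq0.
  have p1 : 0 < e * (2 * K) by rewrite !mulr_gt0.
  have p2 : 0 < M * (K * 2) by rewrite !mulr_gt0.
  by move: `|w| (M * _) (e * _) p1 p2 => a x y x0 y0'; lra.
move=> e0 eK.
have [W [oW Wy0 We]] : exists W, [/\ open W, W y0 &
    forall y, W y -> U y /\ `|phi y - phi y0 - 'd phi y0 (y - y0)| <= e * `|y - y0|].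
  have nU : nbhs y0 U by exact: open_nbhs_nbhs.
  have := filterI nU (local_approx e0 dphi).
  set N := (X in nbhs y0 X) => nN; exists N^°; split; first exact: open_interior.
    exact: nN.
  by move=> y /interior_subset.
have [Q oQ QE] := opn W (fun y Wy => (We y Wy).1) oW.
have Qc0 : Q (c 0).
  have : (S `&` Q) (phi y0) by rewrite -QE; exists y0.
  by rewrite c0 => -[].
have near_sec : \forall h \near (0 : R),
    `|L (c h - c 0)| <= M * (e * (K * 2)) * `|c h - c 0|.
  have nQ : \forall h \near (0 : R), Q (c h).
    by apply: (near_continuous (Ck_cont (Cc 0%N) I0)); exact: open_nbhs_nbhs.
  have nI : \forall h \near (0 : R), I h by exact: open_nbhs_nbhs.
  apply: filterS2 nQ nI => h Qh /cS Sh.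
  have : (S `&` Q) (c h) by [].
  rewrite -QE c0 => -[y Wy <-]; have [_ ye] := We y Wy.
  set r := phi y - phi y0 in ye *; set d := 'd phi y0 (y - y0) in ye.
  have Lr : `|L r| <= M * (e * `|y - y0|).
    have Ld : L d = 0 by exact: L0.
    have -> : L r = L (r - d) by rewrite [RHS]linearB Ld subr0.
    by rewrite (le_trans (LM _))// ler_pM2l.
  have yr : `|y - y0| <= (K * 2) * `|r|.
    have := gK (y - y0); rewrite -/d => yd.
    have dr : `|d| <= `|r| + e * `|y - y0|.
      by rewrite -[d in leLHS](subKr r) (le_trans (ler_normB _ _))// lerD2l.
    have : `|y - y0| <= K * `|r| + (e * K) * `|y - y0|.
      by apply: (le_trans yd); rewrite [e * K]mulrC -mulrA -mulrDr ler_pM2l.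
    have : (e * K) * `|y - y0| <= 2^-1 * `|y - y0| by rewrite ler_wpM2r.
    by move: `|y - y0| (K * `|r|) (_ * _) (mulrAC K 2 `|r|) => a b x ->; lra.
  by apply: (le_trans Lr); rewrite -!mulrA ler_pM2l// ler_pM2l// mulrA.
have Lquot : (fun h : R => `|L (h^-1 *: (c h - c 0))|) @ (0 : R)^' --> `|L w|.
  apply: cvg_norm; apply: (@cvg_comp _ _ _ _ L _ _ _ quot).
  exact: Cn_linear_continuous.
have Rquot : (fun h : R => M * (e * (K * 2)) * `|h^-1 *: (c h - c 0)|) @ (0 : R)^' -->
    M * (e * (K * 2)) * `|w|.
  by apply: cvgM; [exact: cvg_cst|exact: cvg_norm quot].
apply: (ler_cvg_to Lquot Rquot).
apply: nbhs_dnbhs.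
apply: filterS near_sec => h hs; rewrite linearZ !normrZ mulrCA.
by rewrite ler_wpM2l.
Qed.

End TangentVectors.

(** * Regularity of global horizontal lifts *)

Section HorizontalLift.
Context {R : realType} {n : nat} {Sigma : topologicalType}.
Variables (A : atlas Sigma 'rV[R]_n.-1) (f : Sigma -> CP R n).
Hypothesis hSigma : smooth_manifold A.
Hypothesis hf : lagrangian_immersion A f.
Local Notation E := 'rV[R]_n.-1.
Implicit Types (i : chart_index A) (j : 'I_n) (x : Sigma) (y v : E).

Lemma hor_eq x (l l' : Sigma -> Cn R n) : hor A f x l ->
  (\forall x' \near x, l' x' = l x') -> hor A f x l'.
Proof.
move=> [i ix cl] ll'; exists i; first exact: ix.
have /nbhs_interior nE := param_near hSigma ix ll'.
apply: filterS2 cl nE => y [ov dl hl] nEy.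
have e : l' (param i y) = l (param i y) := nbhs_singleton nEy.
have nEy' : \forall z \near y, (l \o param i) z = (l' \o param i) z.
  by apply: filterS nEy => z ez; exact: esym ez.
rewrite /hor_cond e; split; first exact: ov.
  exact: (near_differentiable nEy' dl).
by move=> v; rewrite -(near_eq_derive v nEy'); exact: hl.
Qed.

Variable F : Sigma -> Cn R n.
Hypothesis hF : forall x, hor A f x F.

Lemma lift_over_hopf x : over_hopf (f x) (F x).
Proof. exact: nbhs_singleton (hor_over hSigma (hF x)). Qed.

Lemma lift_local_form i j x : dom i x -> Uset j (f x) ->
  exists (W : set E) (th : E -> R),
  [/\ open W, W (chart i x), W `<=` coord_dom f i j, forall k, Ck k W th &
     forall y, W y -> F (param i y) = Psi j (coord_map f i j y, th y)].
Proof.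
move=> ix jx; have [r [th [l [r0 BU C _ hl]]]] := local_section hSigma hf ix jx.
pose B := ball (chart i x) r.
have hl0 : hor A f x l.
  by have := (hl _ (ballxx _ r0)).1; rewrite (chartK hSigma ix).
have [c lc] := hor_unique hSigma hl0 (hF x).
have nE := param_near hSigma ix lc.
have nB : nbhs (chart i x) B by exact: nbhsx_ballx.
pose N := B `&` [set y | F (param i y) = phase c (l (param i y))].
have nN : nbhs (chart i x) N by exact: filterI nB nE.
have NB y : N^° y -> N y by move=> /interior_subset.
have oN : open N^° by exact: open_interior.
exists N^°, (fun y => c + th y); split.
- exact: oN.
- exact: nN.
- by move=> y /NB[/BU].
- move=> k; apply: (CkD oN (Ck_cst _ _ _)); apply: Ck_sub (C k).1.
  by move=> y /NB[].
- by move=> y /NB[By ->]; rewrite (hl y By).2 /Psi/= phaseD.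
Qed.

Lemma lift_smooth i k : Ck k (chart i @` dom i) (F \o param i).
Proof.
apply: Ck_local => _ [x ix <-]; have [j jx] := Uset_cover (f x).
have [W [th [oW Wx WU Cth FE]]] := lift_local_form ix jx; exists W; first exact: Wx.
have [_ CG] := coord_map_smooth hf i j.
have WB y : W y -> hball (coord_map f i j y) by move=> /WU/(coord_domP hSigma)[].
apply: Ck_eq (Ck_phase oW (Cth k) (Ck_hsect_comp j oW WB (Ck_sub WU (CG k)))) => //.
by move=> y Wy; rewrite [RHS]/= FE.
Qed.

Lemma lift_differentiable i x : dom i x -> differentiable (F \o param i) (chart i x).
Proof. by move=> ix; apply: (Ck_diff (lift_smooth i 1)); exists x. Qed.

Lemma lift_horizontal i y v : (chart i @` dom i) y ->
  omega0 (F (param i y)) ('D_v (F \o param i) y) = 0.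
Proof.
by move=> [x ix <-]; have [_ _ h] := nbhs_singleton (hor_chart hSigma (hF x) ix); exact: h.
Qed.

(** The derivative of F = phase th (hsect_j (g)) is, up to a rotation, the derivative
    of hsect_j (g) plus D_v th times the rotation field.  On the j-th coordinate the
    first is real and the second is purely imaginary and nonzero unless D_v th = 0;
    the other coordinates then give D_v g = 0, and f is an immersion. *)
Lemma lift_derive_inj i x v : dom i x -> 'D_v (F \o param i) (chart i x) = 0 -> v = 0.
Proof.
move=> ix; have [j jx] := Uset_cover (f x); set y := chart i x.
have [W [th [oW Wy WU Cth FE]]] := lift_local_form ix jx.
have [oU CG] := coord_map_smooth hf i j; set G := coord_map f i j in FE CG.
have zB : hball (G y) by have [] := coord_domP hSigma (WU _ Wy).
have nE : \forall z \near y, (F \o param i) z = phase (th z) ((hsect j \o G) z).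
  have nW : \forall z \near y, W z by exact: open_nbhs_nbhs.
  by apply: filterS nW => z Wz; rewrite /= FE.
have dG : differentiable G y := Ck_diff (CG 1%N) (WU _ Wy).
have dh : differentiable (hsect j \o G) y.
  exact: differentiable_comp dG (hsect_diff j zB).
have dt : differentiable th y := Ck_diff (Cth 1%N) Wy.
rewrite (near_eq_derive v nE) (derive_phase v dt dh (diff_phase dt dh)).
have -> : 'D_v (hsect j \o G) y = 'D_('D_v G y) (hsect j) (G y).
  have ds := hsect_diff j zB.
  by rewrite deriveE ?diff_comp//= ?deriveE//; exact: differentiable_comp.
set w := 'D_v G y; set a := 'D_w (hsect j) (G y).
set s := 'D_v th y; rewrite -phase_J -phaseZv -phaseDv /= => e.
have {}e : a + s *: Jc (hsect j (G y)) = 0.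
  have := f_equal (phase (- th y)) e; rewrite phaseD addNr phase0 => ->.
  by apply: Cn_eq => k; rewrite !coordE !linear0; ring.
have s0 : s = 0.
  have := f_equal (im j) e; rewrite !coordE linear0 im_dhsect_self// add0r.
  move=> /eqP; rewrite mulf_eq0 re_hsect_self (gt_eqF (hsect_self_gt0 zB)) orbF.
  by move=> /eqP.
have {}e : a = 0 by move: e; rewrite s0 scale0r addr0.
have w0 : w = 0.
  apply: Cn_eq => k; rewrite !linear0.
    by have := f_equal (re (lift j k)) e; rewrite linear0 re_dhsect.
  by have := f_equal (im (lift j k)) e; rewrite linear0 im_dhsect.
have inj := hf.1.2 i j x ix jx.
apply: inj; rewrite linear0; apply: etrans w0.
by rewrite /w deriveE.
Qed.

Lemma lift_diff_inj i x : dom i x -> injective ('d (F \o param i) (chart i x)).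
Proof.
move=> ix u v uv; apply/eqP; rewrite -subr_eq0; apply/eqP.
apply: (lift_derive_inj ix); rewrite deriveE; last exact: lift_differentiable.
by rewrite linearB uv subrr.
Qed.

Lemma lift_continuous : continuous F.
Proof.
move=> x; have [i ix] := chart_cover hSigma x.
have nE : \forall x' \near x, (F \o param i \o chart i) x' = F x'.
  have := chart_near hSigma ix (@filterT _ _ (nbhs_filter (chart i x))).
  by apply: filterS => x' [ix' _]; rewrite /= (chartK hSigma ix').
have c1 : {for x, continuous (F \o param i \o chart i)}.
  apply: (continuous_comp (f := chart i) (g := F \o param i)).
    exact: chart_continuous.
  by apply: (Ck_cont (lift_smooth i 0)); exists x.
rewrite /continuous_at -(nbhs_singleton nE).
apply: cvg_trans c1; apply: near_eq_cvg; exact: nE.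
Qed.

Lemma lift_immersion : immersion A (euclid (Cn R n)) F.
Proof.
split=> [i []|i [] x ix _]; last exact: (lift_diff_inj ix).
rewrite setIT (_ : F @^-1` _ = setT)// setIT.
by split; [exact: chart_image_open|exact: lift_smooth].
Qed.

Lemma lift_local_param i : injective F ->
  (forall O, open O -> exists2 O', open O' & F @` O = range F `&` O') ->
  local_param (range F) (chart i @` dom i) (F \o param i).
Proof.
move=> iF oF; split.
- by split; [exact: chart_image_open|exact: lift_smooth].
- by move=> _ [x ix <-]; exact: lift_diff_inj.
- move=> _ _ /set_mem[x ix <-] /set_mem[x' ix' <-].
  by rewrite /= !(chartK hSigma)// => /iF ->.
- move=> O OV oO; have [|O' oO' O'E] := oF (dom i `&` chart i @^-1` O).
    rewrite openE => x [ix Ox]; apply: (chart_near hSigma ix).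
    exact: open_nbhs_nbhs.
  exists O'; rewrite // -O'E; apply/seteqP; split=> [_ [y Oy <-]|_ [x [ix Ox] <-]].
    have [x ix xy] := OV y Oy; exists x; first by split=> //=; rewrite xy.
    by rewrite /= -xy (chartK hSigma ix).
  by exists (chart i x); rewrite //= (chartK hSigma ix).
Qed.

End HorizontalLift.

(** * Embeddings of compact spaces *)

Section CompactEmbedding.
Context {T U : topologicalType}.

Lemma compact_embedding (g : T -> U) : hausdorff_space U -> compact [set: T] ->
  continuous g -> injective g ->
  forall O, open O -> exists2 O', open O' & g @` O = range g `&` O'.
Proof.
move=> hU cT cg ig O oO; exists (~` (g @` (~` O))).
  apply: closed_openC; apply: compact_closed => //; apply: continuous_compact.
    exact: continuous_subspaceT.
  apply: (subclosed_compact _ cT) => //; exact: open_closedC.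
apply/seteqP; split=> [_ [x Ox <-]|_ [[x _ <-] nx]].
  by split; [exists x|move=> [x' nOx' /ig xx]; apply: nOx'; rewrite xx].
by exists x => //; apply: contrapT => nOx; apply: nx; exists x.
Qed.

End CompactEmbedding.

(** * Legendrian submanifolds and their cones *)

Section UnitHorizontalMaps.
Context {R : realType} {E : normedModType R} {m : nat}.
Variables (U : set E) (G : E -> Cn R m).
Hypothesis oU : open U.
Hypothesis C2 : Ck 2 U G.

(** Differentiating the identity omega0 (G, D_v G) = 0 in the direction u and
    comparing with the same identity for u and v exchanged, the second
    derivatives cancel by symmetry. *)
Lemma horizontal_isotropic y u v :
  (forall z w, U z -> omega0 (G z) ('D_w G z) = 0) -> U y ->
  omega0 ('D_u G y) ('D_v G y) = 0.
Proof.
move=> hG Uy.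
have nU : \forall z \near y, U z by exact: open_nbhs_nbhs.
have D a b : omega0 ('D_a G y) ('D_b G y) + omega0 (G y) ('D_a ('D_b G) y) = 0.
  have [_ e] := is_derive_omega a (Ck_diff C2 Uy) (Ck_diff (Ck_derive b C2) Uy).
  apply: etrans (esym e) _.
  apply: etrans (@near_eq_derive _ _ _ _ (cst (0 : R)) y a _) (derive_cst _ _ _).
  by apply: filterS nU => z Uz; exact: hG.
have sym := derive_symmetric_Cn u v oU C2 Uy.
have cancel (p q r : R) : p = - q -> p + r = 0 -> q + r = 0 -> q = 0 by lra.
have Duv := D u v; rewrite sym in Duv.
exact: cancel (omegaC _ _) (D v u) Duv.
Qed.

End UnitHorizontalMaps.

Section Legendrian.
Context {R : realType}.

Fact omega0_linear n (u : Cn R n) : linear (omega0 u : Cn R n -> R).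
Proof. by move=> a v w; rewrite omegaDr omegaZr. Qed.
HB.instance Definition _ n (u : Cn R n) :=
  GRing.isLinear.Build R (Cn R n) R *:%R (omega0 u) (omega0_linear u).

Lemma legendrian_of_horizontal n (S : set (Cn R n)) :
  (forall p, S p -> normsq p = 1) ->
  (forall p, S p -> exists V phi, [/\ local_param (d := n.-1) S V phi, (phi @` V) p &
     forall y v, V y -> omega0 (phi y) ('D_v phi y) = 0]) ->
  legendrian S.
Proof.
move=> S1 loc; split=> // [p Sp|p v Sp tv]; have [V [phi [lp Vp hp]]] := loc p Sp.
  by exists V, phi.
have [y Vy yp] := Vp; rewrite -yp in tv *.
have dphi : differentiable phi y by case: lp => -[_ C] _ _ _; exact: Ck_diff (C 1%N) Vy.
rewrite alphaE (tangent_annihilator (L := omega0 (phi y)) lp Vy _ tv) ?mulr0//.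
by move=> w; rewrite -deriveE//; exact: hp.
Qed.

Lemma Ck_scaleM (E : normedModType R) n k (U : set E) (g : E -> R) (h : E -> Cn R n) :
  open U -> Ck k U g -> Ck k U h -> Ck k U (fun x => g x *: h x).
Proof.
move=> oU Cg Ch; apply: Ck_Cn => // i.
  rewrite (_ : _ \o _ = fun x => g x * (re i \o h) x); last first.
    by apply/funext => x; rewrite /= reZ.
  by apply: CkM => //; apply: Ck_lin => //; exact: re_continuous.
rewrite (_ : _ \o _ = fun x => g x * (im i \o h) x); last first.
  by apply/funext => x; rewrite /= imZ.
by apply: CkM => //; apply: Ck_lin => //; exact: im_continuous.
Qed.

Lemma derive_scaleM (E : normedModType R) n (g : E -> R) (h : E -> Cn R n) x v :
  differentiable g x -> differentiable h x -> differentiable (fun x => g x *: h x) x ->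
  'D_v (fun x => g x *: h x) x = 'D_v g x *: h x + g x *: 'D_v h x.
Proof.
move=> dg dh dgh.
have Dg : is_derive x v g ('D_v g x) by apply/derivableP/diff_derivable.
apply: Cn_eq => i.
  rewrite derive_re// (_ : _ \o _ = g * (re i \o h)); last first.
    by apply/funext => z; rewrite /= reZ.
  have Dh : is_derive x v (re i \o h) (re i ('D_v h x)).
    by rewrite derive_re//; apply/derivableP/diff_derivable/diff_re.
  have [_ e] := is_deriveM Dg Dh; apply: etrans e _.
  by rewrite reD !reZ /GRing.scale/=; move: ('D_v g x) ('D_v h x) => a b; ring.
rewrite derive_im// (_ : _ \o _ = g * (im i \o h)); last first.
  by apply/funext => z; rewrite /= imZ.
have Dh : is_derive x v (im i \o h) (im i ('D_v h x)).
  by rewrite derive_im//; apply/derivableP/diff_derivable/diff_im.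
have [_ e] := is_deriveM Dg Dh; apply: etrans e _.
by rewrite imD !imZ /GRing.scale/=; move: ('D_v g x) ('D_v h x) => a b; ring.
Qed.

Lemma Ck_along (E : normedModType R) n k (U : set E) (h : E -> Cn R n) (y v : E) : open U ->
  Ck k U h -> Ck k [set t : R | U (y + t *: v)] (fun t : R => h (y + t *: v)).
Proof.
move=> oU; have cl := @line_continuous _ _ y v.
have oI : open [set t : R | U (y + t *: v)] by apply: open_comp => // t _; exact: cl.
elim: k h => [|k IH] h.
  by move=> ch t Ut; apply: (continuous_comp (cl t)); exact: ch.
move=> Ch; have dh t : U (y + t *: v) -> differentiable (fun t : R => h (y + t *: v)) t.
  move=> Ut; apply: (@differentiable_comp _ _ _ _ (fun t : R => y + t *: v) h).
    by have [] := is_diff_line y v t.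
  exact: Ck_diff Ch Ut.
split=> // s; apply: (@Ck_eq _ _ _ _ _ (fun t : R => s *: 'D_v h (y + t *: v))) => //.
  move=> t Ut; have [_ <-] := is_derive_line (Ck_diff Ch Ut).
  by rewrite -deriveZv; [rewrite [s *: _]mulr1|exact: dh].
by apply: Ck_scaleM => //; [exact: Ck_cst|exact: IH (Ck_derive v Ch)].
Qed.

Lemma local_param_in d n (S : set (Cn R n)) V (phi : 'rV[R]_d -> Cn R n) y :
  local_param S V phi -> V y -> S (phi y).
Proof.
move=> [[oV _] _ _ opn] Vy; have [Q _ E] := opn V (fun _ h => h) oV.
by have [] : (S `&` Q) (phi y) by rewrite -E; exists y.
Qed.

(** The derivative of phi along v is the velocity of the image of a straight line. *)
Lemma tangent_derive d n (S : set (Cn R n)) V (phi : 'rV[R]_d -> Cn R n) y v :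
  local_param S V phi -> V y -> tangent S (phi y) ('D_v phi y).
Proof.
move=> lp Vy; have [[oV Cphi] _ _ _] := lp.
exists [set t : R | V (y + t *: v)], (fun t : R => phi (y + t *: v)); split.
- split=> [|k]; last exact: Ck_along.
  by apply: open_comp => // t _; exact: line_continuous.
- by rewrite /= scale0r addr0.
- by move=> t /(local_param_in lp).
- by rewrite scale0r addr0.
- rewrite derive1E; have := @is_derive_line _ _ _ phi y v 0.
  by rewrite scale0r addr0 => /(_ (Ck_diff (Cphi 1%N) Vy))[_ ->].
Qed.

End Legendrian.

Section Cone.
Context {R : realType} {m : nat}.
Local Notation V0 := (Cn R m.+1).

(** The coordinates (r, y) in R x R^m of a vector w of R^{m+1}, and the vector with
    given coordinates. *)
Definition radius (w : 'rV[R]_m.+1) : R := w ord0 ord0.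
Definition base (w : 'rV[R]_m.+1) : 'rV[R]_m := \row_k w ord0 (lift ord0 k).
Definition polar (r : R) (y : 'rV[R]_m) : 'rV[R]_m.+1 :=
  \row_j oapp (fun k => y ord0 k) r (unlift ord0 j).

Fact radius_linear : linear (radius : _ -> R).
Proof. by move=> a u v; rewrite /radius !mxE. Qed.
HB.instance Definition _ := GRing.isLinear.Build R _ R *:%R radius radius_linear.
Fact base_linear : linear base.
Proof. by move=> a u v; apply/rowP => k; rewrite !mxE. Qed.
HB.instance Definition _ := GRing.isLinear.Build R _ _ *:%R base base_linear.

Lemma radius_polar r y : radius (polar r y) = r.
Proof. by rewrite /radius mxE unlift_none. Qed.
Lemma base_polar r y : base (polar r y) = y.
Proof. by apply/rowP => k; rewrite !mxE liftK. Qed.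
Lemma polar_eq u w : radius u = radius w -> base u = base w -> u = w.
Proof.
move=> r b; apply/rowP => j; have [k ->|->] := unliftP ord0 j; last exact: r.
by have /rowP/(_ k) := b; rewrite !mxE.
Qed.

Lemma base_norm w : `|base w| <= `|w|.
Proof.
rewrite [leLHS]/Num.Def.normr/= mx_normrE; apply: bigmax_le => // -[i k] _ /=.
by rewrite mxE; exact: rV_coord_le.
Qed.

Lemma radius_continuous : continuous radius.
Proof. exact: coord_continuous. Qed.

Lemma base_continuous : continuous base.
Proof.
apply/linear_bounded_continuous/linear_boundedP; near=> K => w.
by apply: (le_trans (base_norm w)); rewrite ler_peMl.
Unshelve. all: by end_near. Qed.

Lemma normsqZ (r : R) (p : V0) : normsq (r *: p) = r ^+ 2 * normsq p.
Proof. by rewrite !normsqE dotZl dotZr mulrA. Qed.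

Lemma length_scale (r : R) (p : V0) : 0 < r -> normsq p = 1 -> Num.sqrt (normsq (r *: p)) = r.
Proof. by move=> r0 p1; rewrite normsqZ p1 mulr1 sqrtr_sqr gtr0_norm. Qed.

Lemma length_continuous : continuous (fun q : V0 => Num.sqrt (normsq q)).
Proof.
move=> q; apply: (continuous_comp (f := @normsq R m.+1) (g := Num.sqrt)).
  by apply: (@Ck_cont _ _ _ 0 setT) => //; apply: Ck_normsq => //; [exact: openT|exact: Ck_id].
exact: sqrt_continuous.
Qed.

Variables (S : set V0) (V : set 'rV[R]_m) (phi : 'rV[R]_m -> V0).
Hypothesis S1 : forall p, S p -> normsq p = 1.
Hypothesis lp : local_param S V phi.

Definition cone_dom : set 'rV[R]_m.+1 := [set w | 0 < radius w /\ V (base w)].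
Definition cone_map (w : 'rV[R]_m.+1) : V0 := radius w *: phi (base w).

Let oV : open V. Proof. by have [[]] := lp. Qed.
Let Cphi k : Ck k V phi. Proof. by have [[_]] := lp. Qed.

Let oW : open cone_dom.
Proof.
apply: openI; last by apply: open_comp => // w _; exact: base_continuous.
apply: (@open_comp _ _ radius [set r : R | 0 < r]) => [w _|]; first exact: radius_continuous.
exact: open_gt.
Qed.

Lemma Ck_cone k : Ck k cone_dom cone_map.
Proof.
apply: Ck_scaleM; first exact: oW.
  by apply: Ck_linear; exact: radius_continuous.
by apply: Ck_sub (Ck_comp_lin oV base_continuous (Cphi k)) => w [].
Qed.

Lemma derive_cone w v : cone_dom w ->
  'D_v cone_map w = radius v *: phi (base w) + radius w *: 'D_(base v) phi (base w).
Proof.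
move=> Ww; have Vw : V (base w) by case: Ww.
have dphi : differentiable phi (base w) := Ck_diff (Cphi 1) Vw.
have db : differentiable base w by exact/linear_differentiable/base_continuous.
have dr : differentiable radius w by exact/linear_differentiable/radius_continuous.
have dc : differentiable (phi \o base) w by exact: differentiable_comp.
rewrite (derive_scaleM v dr dc (Ck_diff (Ck_cone 1) Ww)).
rewrite (derive_comp_lin v base_continuous dphi).
by rewrite (derive_linear w v radius_continuous).
Qed.

(** phi y is orthogonal to the image of the differential of phi, since phi takes its
    values in the sphere; so both terms of [derive_cone] must vanish. *)
Lemma cone_derive_inj w v : cone_dom w -> 'D_v cone_map w = 0 -> v = 0.
Proof.
move=> Ww; have [r0 Vw] := Ww; rewrite derive_cone// => e.
have n1 : normsq (phi (base w)) = 1 by exact/S1/(local_param_in lp).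
have orth : dot (phi (base w)) ('D_(base v) phi (base w)) = 0.
  apply: (unit_dot (base v) oV) => // [z /(local_param_in lp)/S1//|].
  exact: (Ck_diff (Cphi 1) Vw).
have dphi : differentiable phi (base w) := Ck_diff (Cphi 1) Vw.
have rv : radius v = 0.
  have : dot (phi (base w)) (radius v *: phi (base w) +
      radius w *: 'D_(base v) phi (base w)) = 0.
    by rewrite e -(scale0r (0 : V0)) dotZr mul0r.
  by rewrite dotDr !dotZr orth mulr0 addr0 -normsqE n1 mulr1.
have bv : base v = 0.
  have [_ inj _ _] := lp; apply: (inj _ Vw); rewrite linear0 -deriveE//.
  move: e; rewrite rv scale0r add0r => /eqP.
  by rewrite scaler_eq0 (gt_eqF r0)/= => /eqP.
by apply: polar_eq; rewrite ?rv ?bv linear0.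
Qed.

Lemma cone_local_param : local_param (cone S) cone_dom cone_map.
Proof.
split.
- by split; [exact: oW|exact: Ck_cone].
- move=> w Ww u v uv; apply/eqP; rewrite -subr_eq0; apply/eqP.
  apply: (cone_derive_inj Ww); rewrite deriveE; last exact: (Ck_diff (Ck_cone 1) Ww).
  by rewrite linearB uv subrr.
- move=> u w /set_mem[ru Vu] /set_mem[rw Vw] uw.
  have r_eq : radius u = radius w.
    rewrite -(length_scale ru (S1 (local_param_in lp Vu))).
    by rewrite -(length_scale rw (S1 (local_param_in lp Vw))) -/(cone_map u) uw.
  have [_ _ inj _] := lp; apply: (polar_eq r_eq).
  apply: inj; rewrite ?inE//; move: uw; rewrite /cone_map r_eq.
  by apply: scalerI; rewrite gt_eqF.
- move=> O OW oO.
  (* the inverse of cone_map is given by q |-> (|q|, q / |q|), so the image of a box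
     around w0 is cut out by conditions on |q| and q / |q| *)
  pose len (q : V0) := Num.sqrt (normsq q).
  have local w0 : O w0 -> exists2 Q, open Q & Q (cone_map w0) /\
      cone S `&` Q `<=` cone_map @` O.
    move=> Ow0; have [r0 V0w] := OW _ Ow0.
    have /nbhs_ballP[e /= e0 eO] : nbhs w0 O by exact: open_nbhs_nbhs.
    pose B := V `&` ball (base w0) e.
    have oB : open B by apply: openI => //; exact: ball_open.
    have Bw0 : B (base w0) by split=> //; exact: ballxx.
    have [_ _ _ opn] := lp.
    have [Q oQ QE] := opn B (fun y By => By.1) oB.
    have len0 : len (cone_map w0) = radius w0 by rewrite /len length_scale//; exact/S1/(local_param_in lp).
    pose P := [set q : V0 | (0 < len q /\ ball (radius w0) e (len q)) /\
      Q ((len q)^-1 *: q)].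
    exists P.
      rewrite openE => q [[q0 qe] Qq].
      have n1 : \forall r \near len q, 0 < r /\ ball (radius w0) e r.
        apply: open_nbhs_nbhs; split=> //.
        by apply: openI; [exact: open_gt|exact: ball_open].
      have n2 : \forall z \near (len q)^-1 *: q, Q z by exact: open_nbhs_nbhs.
      have c2 : {for q, continuous (fun q : V0 => (len q)^-1 *: q)}.
        apply: cvgZ; last exact: cvg_id.
        by apply: cvgV; [rewrite gt_eqF|exact: length_continuous].
      exact: filterI (near_continuous (@length_continuous q) n1) (near_continuous c2 n2).
    split.
      split; first by rewrite len0; split=> //; exact: ballxx.
      rewrite len0 /cone_map scalerA mulVf ?gt_eqF// scale1r.
      have : (S `&` Q) (phi (base w0)) by rewrite -QE; exists (base w0).
      by case.
    move=> _ [[r [p [r1 Sp ->]]] [[_ re] Qp]].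
    have lr : len (r *: p) = r by rewrite /len length_scale//; exact: S1.
    rewrite lr in re Qp; rewrite scalerA mulVf ?gt_eqF// scale1r in Qp.
    have : (S `&` Q) p by [].
    rewrite -QE => -[y [Vy ye] <-]; exists (polar r y); last first.
      by rewrite /cone_map radius_polar base_polar.
    apply: eO; rewrite -ball_normE /=.
    rewrite [ltLHS]/Num.Def.normr/= mx_normrE; apply: bigmax_lt => // -[i j] _ /=.
    rewrite ord1 !mxE; have [k ->|->] := unliftP ord0 j.
      move: ye; rewrite -ball_normE /= => ye; apply: le_lt_trans ye.
      by have := rV_coord_le (base w0 - y) k; rewrite !mxE.
    by move: re; rewrite -ball_normE.
  pose Q0 := \bigcup_(Q in [set Q | open Q /\ cone S `&` Q `<=` cone_map @` O]) Q.
  exists Q0; first by apply: bigcup_open => Q [].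
  apply/seteqP; split=> [_ [w Ow <-]|q [Sq [Q [_ sub] Qq]]]; last exact: sub.
  have [Q oQ [Qw sub]] := local w Ow; split; last by exists Q.
  have [r0 Vw] := OW _ Ow.
  by exists (radius w), (phi (base w)); split=> //; exact: (local_param_in lp).
Qed.

End Cone.

(** In polar coordinates the tangent vectors of the cone at r p are a p + r q
    with q tangent to S at p, and omega0 vanishes on p and q since S is
    Legendrian and on two such q by horizontal_isotropic. *)
Lemma cone_lagrangian {R : realType} {m : nat} (S : set (Cn R m.+1)) :
  legendrian S -> lagrangian (cone S).
Proof.
move=> [S1 sub tan]; split=> [_ [r [p [r0 Sp ->]]]|_ u v [r [p [r0 Sp ->]]]].
  have [V [phi [lp [y Vy yp]]]] := sub p Sp.
  exists (cone_dom V), (cone_map phi); split; first exact: cone_local_param.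
  exists (polar r y); first by rewrite /cone_dom /= radius_polar base_polar.
  by rewrite /cone_map radius_polar base_polar yp.
have [V [phi [lp [y Vy yp]]]] := sub p Sp.
have [[oV Cphi] _ _ _] := lp.
pose w := polar r y.
have Ww : cone_dom V w by rewrite /cone_dom /= radius_polar base_polar.
have wE : cone_map phi w = r *: p by rewrite /cone_map radius_polar base_polar yp.
have hor z b : V z -> omega0 (phi z) ('D_b phi z) = 0.
  move=> Vz; have := tan _ _ (local_param_in lp Vz) (tangent_derive b lp Vz).
  by rewrite alphaE => /eqP; rewrite mulf_eq0 invr_eq0 pnatr_eq0 => /eqP.
have clp := cone_local_param S1 lp.
have dcone : differentiable (cone_map phi) w := Ck_diff (Ck_cone lp 1) Ww.
have Vw : V (base w) by case: Ww.
have pairing (q q' : Cn R m.+1) (a a' t : R) : omega0 p q = 0 -> omega0 p q' = 0 ->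
    omega0 q q' = 0 -> omega0 (a *: p + t *: q) (a' *: p + t *: q') = 0.
  move=> pq pq' qq'; rewrite omegaDl !omegaDr !omegaZl !omegaZr omega_self pq' qq'.
  by rewrite (omegaC q p) pq; ring.
have iso a b : omega0 ('d (cone_map phi) w a) ('d (cone_map phi) w b) = 0.
  have D c := derive_cone lp c Ww.
  rewrite -!(deriveE _ dcone).
  apply: etrans (f_equal2 (fun x z => omega0 x z) (D a) (D b)) _.
  have pE : phi (base w) = p by rewrite base_polar.
  have h c := hor (base w) c Vw; rewrite pE in h *.
  apply: pairing; [exact: h|exact: h|].
  exact: (horizontal_isotropic oV (Cphi 2%N) (base a) (base b) hor Vw).
rewrite -wE => tu tv.
have tu0 a : omega0 ('d (cone_map phi) w a) u = 0.
  exact: (tangent_annihilator (L := omega0 _) clp Ww (iso a) tu).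
apply: (tangent_annihilator (L := omega0 u) clp Ww _ tv) => a.
by apply: etrans (omegaC u _) _; rewrite (tu0 a) oppr0.
Qed.

Corollary legendrian_cone {R : realType} {n : nat} (S : set (Cn R n)) : (0 < n)%N ->
  legendrian S -> lagrangian (cone S).
Proof. by case: n S => // m S _; exact: cone_lagrangian. Qed.

(** * The global horizontal lift *)

Section GlobalLift.
Context {R : realType} {n : nat} {Sigma : topologicalType}.
Variables (A : atlas Sigma 'rV[R]_n.-1) (f : Sigma -> CP R n).
Hypothesis hSigma : smooth_manifold A.
Hypothesis hf : lagrangian_immersion A f.

Lemma chart_segments (x : Sigma) U : nbhs x U -> \forall y \near x, exists s : R -> Sigma,
  [/\ continuous s, s 0 = x, s 1 = y & forall u, 0 <= u <= 1 -> U (s u)].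
Proof.
move=> xU; have [i ix] := chart_cover hSigma x; set y0 := chart i x.
have oC : open (chart i @` dom i) by exact: chart_image_open.
have nC : nbhs y0 (chart i @` dom i) by apply: open_nbhs_nbhs; split=> //; exists x.
have nU : nbhs y0 [set y | U (param i y)] by exact: (param_near hSigma ix xU).
have nCU : nbhs y0 ((chart i @` dom i) `&` [set y | U (param i y)]) by exact: filterI.
have /nbhs_ballP[r /= r0 rB] := nCU.
have nB : nbhs y0 (ball y0 r) by exact: nbhsx_ballx.
apply: filterS (chart_near hSigma ix nB) => y [iy By].
pose c (u : R) := y0 + clamp u *: (chart i y - y0).
have cB u : ball y0 r (c u).
  have /andP[u0 u1] := clamp_itv u; move: By; rewrite -!ball_normE /= => By.
  rewrite opprD addrA subrr sub0r normrN normrZ (ger0_norm u0).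
  by apply: le_lt_trans By; rewrite distrC ler_piMl.
exists (param i \o c); split.
- move=> u; have [[x' ix' cx'] _] := rB _ (cB u).
  apply: continuous_comp; last by rewrite -cx'; exact: param_continuous.
  apply: (continuous_comp (f := clamp) (g := fun t : R => y0 + t *: (chart i y - y0))).
    exact: clamp_continuous.
  exact: line_continuous.
- by rewrite /= /c clamp_id ?lexx ?ler01// scale0r addr0 (chartK hSigma).
- by rewrite /= /c clamp_id ?lexx ?ler01// scale1r subrKC (chartK hSigma).
- by move=> u _; have [_] := rB _ (cB u).
Qed.

Let act_fix (x : Sigma) t (w : Cn R n) :
  over_hopf (f x) w -> phase t w = w <-> eqmod2pi t 0.
Proof. by move=> /over_hopf_norm w1; exact: phase_fix. Qed.

(** A closed path with zero lifting integral has a horizontal lift that closes up. *)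
Lemma global_lift : connected [set: Sigma] ->
  (forall z : seq (int * (R -> Sigma)), cycle1 z -> exists gamma : R -> Sigma,
     [/\ piecewise_smooth A gamma, gamma 0 = gamma 1,
         homologous z [:: (1, gamma)] & lifting_integral f gamma 0]) ->
  exists F : Sigma -> Cn R n, forall x, hor A f x F.
Proof.
move=> conS closed.
have [|F FE] := @global_section R Sigma (Cn R n) (@phase R n)
  (fun x w => over_hopf (f x) w) (hor A f) (@phaseD R n) act_fix
  (fun x t w => @over_hopf_phase R n (f x) t w)
  (fun x w w' => @over_hopf_trans R n (f x) w w')
  (hor_over hSigma) (hor_near hSigma) (@hor_act _ _ _ _ _) (hor_unique hSigma)
  (hor_ex hSigma hf) conS chart_segments.
  move=> z /closed[gamma [sg g01 zg lg]].
  have cg : continuous (gamma \o clamp).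
    exact/within_clamp/(piecewise_smooth_continuous hSigma).
  have [p lp] := path_lift act_fix (fun x w w' => @over_hopf_trans R n (f x) w w')
    (hor_over hSigma) (hor_near hSigma) (@hor_act _ _ _ _ _) (hor_unique hSigma)
    (hor_ex hSigma hf) cg.
  exists gamma, p; split=> //.
  have f01 : f (gamma 0) = f (gamma 1) by rewrite g01.
  by rewrite (lifting_integral_transport hSigma hf sg lp f01 lg) phase0.
exists F => x; have [l hl] := hor_ex hSigma hf x; have [c cE] := FE x l hl.
exact: (hor_eq hSigma (hor_act c hl) cE).
Qed.

Variable F : Sigma -> Cn R n.
Hypothesis hF : forall x, hor A f x F.

Lemma lift_path_end (gamma : R -> Sigma) v : piecewise_smooth A gamma ->
  f (gamma 0) = f (gamma 1) -> lifting_integral f gamma v ->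
  F (gamma 1) = phase v (F (gamma 0)).
Proof.
move=> sg f01 lg; have c0 : clamp (0 : R) = 0 by rewrite clamp_id ?lexx ?ler01.
have c1 : clamp (1 : R) = 1 by rewrite clamp_id ?lexx ?ler01.
have := @lifting_integral_transport _ _ _ _ _ hSigma hf gamma (F \o (gamma \o clamp)) v sg.
rewrite /= c0 c1; apply=> //= u _; exact: lift_at_hor.
Qed.

(** A path joining two points with the same image under F has holonomy 0. *)
Lemma lift_injective :
  (forall (k : nat) (x : 'I_k.+1 -> Sigma), (1 <= k)%N -> injective x ->
      (forall i, f (x ord0) = f (x i)) ->
      exists (gamma : 'I_k -> R -> Sigma) (v : 'I_k -> R),
        [/\ forall i, [/\ piecewise_smooth A (gamma i), gamma i 0 = x ord0 &
                          gamma i 1 = x (lift ord0 i)],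
            forall i, lifting_integral f (gamma i) (v i),
            forall i i', i <> i' -> ~ eqmod2pi (v i) (v i') &
            forall i, ~ eqmod2pi (v i) 0]) ->
  injective F.
Proof.
move=> paths a b Fab; apply: contrapT => ab.
have fab : f a = f b.
  have [p pF <-] := lift_over_hopf hSigma hF a.
  by have [q qF <-] := lift_over_hopf hSigma hF b; congr hopf; apply: val_inj; rewrite pF qF.
pose x (k : 'I_2) := if k == ord0 then a else b.
have x1 : x (lift ord0 ord0) = b by [].
have [|k|gamma [v [gammaP vP _ v0]]] := paths 1%N x isT.
- move=> k l; rewrite /x.
  have [->|k0] := eqVneq k ord0; have [->|l0] := eqVneq l ord0 => //.
  + by move=> /esym.
  + by move: k0 l0; case: k l => [[|[|//]] ?] [[|[|//]] ?] // _ _ _; exact: val_inj.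
- by rewrite /x eqxx; case: eqP.
have [sg g0 g1] := gammaP ord0; rewrite x1 /x eqxx in g0 g1.
have f01 : f (gamma ord0 0) = f (gamma ord0 1) by rewrite g0 g1.
apply: (v0 ord0); apply/(act_fix (x := a)); first exact: (lift_over_hopf hSigma hF).
have := lift_path_end sg f01 (vP ord0); rewrite g0 g1 => e.
by rewrite -e Fab.
Qed.

End GlobalLift.

Theorem mainTheorem1 (R : realType) (n : nat) (hn : (2 <= n)%N)
    (Sigma : topologicalType) (A : atlas Sigma 'rV[R]_n.-1)
    (hSigma : smooth_manifold A)
    (hcompact : compact [set: Sigma]) (hconnected : connected [set: Sigma])
    (f : Sigma -> CP R n) (hf : lagrangian_immersion A f) :
  (* Psi_j^* alpha = (1/2) (dt - tau_j) on B_j x S^1 *)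
  (forall (j : 'I_n) (z : Cn R n.-1) (t : R), hball z ->
     forall (v : Cn R n.-1) (c : R),
       alpha (Psi j (z, t)) ('d (Psi j) (z, t) (v, c))
         = 2^-1 * (c - tau j z v)) /\
  ((* (1): every class in H_1(Sigma; Z) is represented by a closed path with
      zero lifting integral *)
   (forall z : seq (int * (R -> Sigma)), cycle1 z ->
      exists gamma : R -> Sigma,
        [/\ piecewise_smooth A gamma, gamma 0 = gamma 1,
            homologous z [:: (1, gamma)] & lifting_integral f gamma 0]) ->
   (* (2), with k + 1 points x_0, ..., x_k *)
   (forall (k : nat) (x : 'I_k.+1 -> Sigma), (1 <= k)%N -> injective x ->
      (forall i, f (x ord0) = f (x i)) ->
      exists (gamma : 'I_k -> R -> Sigma) (v : 'I_k -> R),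
        [/\ forall i, [/\ piecewise_smooth A (gamma i), gamma i 0 = x ord0 &
                          gamma i 1 = x (lift ord0 i)],
            forall i, lifting_integral f (gamma i) (v i),
            forall i i', i <> i' -> ~ eqmod2pi (v i) (v i') &
            forall i, ~ eqmod2pi (v i) 0]) ->
   exists ft : Sigma -> sphere R n,
     [/\ forall x, hopf (ft x) = f x,
         embedding A (val \o ft),
         legendrian (range (val \o ft)) &
         lagrangian (cone (range (val \o ft)))]).
Proof.
split=> [j z t zB v c|closed paths]; first exact: alpha_Psi.
have [F hF] := global_lift hSigma hf hconnected closed.
have over x : exists2 p : sphere R n, val p = F x & hopf p = f x.
  have := lift_over_hopf hSigma hF x; rewrite /over_hopf.
  exact.
pose ft x := s2val (cid2 (over x)).
have ftF : val \o ft = F by apply/funext => x; exact: (s2valP (cid2 (over x))).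
exists ft; rewrite ftF.
have injF := lift_injective hSigma hf hF paths.
have opnF := compact_embedding (@norm_hausdorff _ _) hcompact
  (lift_continuous hSigma hf hF) injF.
have legF : legendrian (range F).
  apply: legendrian_of_horizontal => _ [x _ <-].
    exact: over_hopf_norm (lift_over_hopf hSigma hF x).
  have [i ix] := chart_cover hSigma x.
  exists (chart i @` dom i), (F \o param i); split.
  - exact: (lift_local_param hSigma hf hF).
  - by exists (chart i x); [exists x|rewrite /= (chartK hSigma)].
  - by move=> y v; exact: (lift_horizontal hSigma hF).
split=> //.
- by move=> x; exact: (s2valP' (cid2 (over x))).
- by split=> //; exact: (lift_immersion hSigma hf hF).
- exact: legendrian_cone (ltnW hn) legF.
Qed.
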